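(* Let $p\in\mathbb N$, $r>0$, $J=\begin{bmatrix}0&I_p\\ I_p&0\end{bmatrix}$, and let $\beta\in\mathcal U^{p\times 2p}[0,r]$ satisfy $$\beta(x)J\beta(x)^*\equiv 0,\qquad \beta'(x)J\beta(x)^*\equiv \mathrm{i} I_p \quad (0\le x\le r).$$ Write $\beta=\begin{bmatrix}\beta_1&\beta_2\end{bmatrix}$ with $p\times p$ blocks $\beta_1,\beta_2$, and assume $\det\beta_2(0)\neq 0$. Let $A$ and $K$ be the operators on $L_2^p(0,r)$ given by $$(Af)(x)=\int_0^x(t-x)f(t)\,dt,\qquad (Kf)(x)=\mathrm{i}\,\beta(x)J\int_0^x\beta(t)^*f(t)\,dt .$$ Then there is a bounded operator $E$ on $L_2^p(0,r)$ with bounded inverse, of the form $$(Ef)(x)=u(x)\beta_2(0)f(x)+\int_0^x\mathcal E(x,t)f(t)\,dt,$$ where $u\in\mathcal U^{p\times p}[0,r]$, $u(x)^*=u(x)^{-1}$ for all $x$, and $u(0)=I_p$, such that the following hold. (i) $K=EAE^{-1}$. (ii) $E^{-1}\beta_2\equiv I_p$, where $E^{-1}$ is applied to $\beta_2$ column by column. (iii) Both $E$ and $E^{-1}$ map $\mathcal U^{p}[0,r]$ into $\mathcal U^{p}[0,r]$.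
   Context: For $q\in\mathbb N$, $\mathcal U^{p\times q}[0,r]$ denotes the class of $p\times q$ matrix functions $\mathcal G$ on $[0,r]$ that are differentiable and satisfy $\mathcal G'(x)=\mathcal G'(0)+\int_0^x\mathcal G''(t)\,dt$ for some $\mathcal G''\in L_2^{p\times q}(0,r)$, the class of $p\times q$ matrix functions with entries in $L_2(0,r)$. We write $\mathcal U^p[0,r]:=\mathcal U^{p\times 1}[0,r]$ and $L_2^p(0,r):=L_2^{p\times 1}(0,r)$. *)

(* Defs.v *)
From HB Require Import structures.
From mathcomp Require Import all_boot all_order all_algebra.
From mathcomp Require Import all_classical all_reals all_analysis.
From mathcomp Require Import complex.
Set Implicit Arguments. Unset Strict Implicit. Unset Printing Implicit Defensive.
Import Order.TTheory GRing.Theory Num.Theory.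
Import numFieldNormedType.Exports.
Local Open Scope classical_set_scope.
Local Open Scope ring_scope.

Section Defs.
Variable R : realType.
Local Notation C := (R[i]).
Local Notation mu := (@lebesgue_measure R).

Definition Icc (a b : R) : set R := [set t | a <= t <= b].

Definition mxstar m n (A : 'M[C]_(m, n)) : 'M[C]_(n, m) := (map_mx Num.conj A)^T.

Definition cint m n (a b : R) (F : R -> 'M[C]_(m, n)) : 'M[C]_(m, n) :=
  \matrix_(i, j) (Complex (Rintegral mu (Icc a b) (fun t => complex.Re (F t i j)))
                  (Rintegral mu (Icc a b) (fun t => complex.Im (F t i j)))).

Definition cintegrable m n (a b : R) (F : R -> 'M[C]_(m, n)) : Prop :=
  forall i j, mu.-integrable (Icc a b) (fun t => (complex.Re (F t i j))%:E) /\
              mu.-integrable (Icc a b) (fun t => (complex.Im (F t i j))%:E).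

Definition L2 m n (r : R) (F : R -> 'M[C]_(m, n)) : Prop :=
  forall i j,
    measurable_fun (Icc 0 r) (fun t => complex.Re (F t i j)) /\
    measurable_fun (Icc 0 r) (fun t => complex.Im (F t i j)) /\
    mu.-integrable (Icc 0 r) (fun t => ((complex.Re (F t i j)) ^+ 2)%:E) /\
    mu.-integrable (Icc 0 r) (fun t => ((complex.Im (F t i j)) ^+ 2)%:E).

Definition L2norm m n (r : R) (F : R -> 'M[C]_(m, n)) : R :=
  Num.sqrt (Rintegral mu (Icc 0 r)
     (fun t => \sum_i \sum_j ((complex.Re (F t i j)) ^+ 2 + (complex.Im (F t i j)) ^+ 2))).

Definition aeq m n (r : R) (F G : R -> 'M[C]_(m, n)) : Prop :=
  {ae mu, forall x, Icc 0 r x -> F x = G x}.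

(* h : R -> R has derivative d at x within [0,r] (one-sided at endpoints) *)
Definition rderiv_within (r : R) (h : R -> R) (x d : R) : Prop :=
  (fun y => (h y - h x) / (y - x)) @ within [set y | Icc 0 r y /\ y != x] (nbhs x)
    --> d.

Definition mderiv_on m n (r : R) (G dG : R -> 'M[C]_(m, n)) : Prop :=
  forall x, Icc 0 r x -> forall i j,
    rderiv_within r (fun y => complex.Re (G y i j)) x (complex.Re (dG x i j)) /\
    rderiv_within r (fun y => complex.Im (G y i j)) x (complex.Im (dG x i j)).

(* G in U^{m x n}[0,r] with derivative dG:
   G' (x) = G'(0) + int_0^x G''(t) dt with G'' in L_2 *)
Definition U_with m n (r : R) (G dG : R -> 'M[C]_(m, n)) : Prop :=
  mderiv_on r G dG /\
  exists G2 : R -> 'M[C]_(m, n), L2 r G2 /\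
    forall x, Icc 0 r x -> dG x = dG 0 + cint 0 x G2.

Definition Ucls m n (r : R) (G : R -> 'M[C]_(m, n)) : Prop :=
  exists dG, U_with r G dG.

Definition Jmx p : 'M[C]_(p + p) := block_mx 0 1%:M 1%:M 0.

Definition Aop p (f : R -> 'cV[C]_p) : R -> 'cV[C]_p :=
  fun x => cint 0 x (fun t => Complex (t - x) 0 *: f t).

Definition Kop p (beta : R -> 'M[C]_(p, p + p)) (f : R -> 'cV[C]_p) : R -> 'cV[C]_p :=
  fun x => Complex 0 1 *: (beta x *m Jmx p *m cint 0 x (fun t => mxstar (beta t) *m f t)).

Definition Eop p (u : R -> 'M[C]_p) (b : 'M[C]_p) (Ek : R -> R -> 'M[C]_p)
  (f : R -> 'cV[C]_p) : R -> 'cV[C]_p :=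
  fun x => u x *m b *m f x + cint 0 x (fun t => Ek x t *m f t).

End Defs.
Arguments Jmx {R} p.

(* Main.v *)
Require Import Defs.
From HB Require Import structures.
From mathcomp Require Import all_boot all_order all_algebra.
From mathcomp Require Import all_classical all_reals all_analysis.
From mathcomp Require Import measurable_realfun.
From mathcomp Require Import complex ring lra.
Set Implicit Arguments. Unset Strict Implicit. Unset Printing Implicit Defensive.
Import Order.TTheory GRing.Theory Num.Theory.
Import numFieldNormedType.Exports.
Local Open Scope classical_set_scope.
Local Open Scope ring_scope.

(* Write Y = beta_1 + beta_2 and X = beta_2 - beta_1.  The hypotheses say that
   Y Y^* = X X^* and Y' Y^* - X' X^* = 2i, which makes Y and X invertible and,
   with V the integration from 0, gives K = - (Y V Y^-1) (X^-* V X^* ), whereas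
   A = - V^2.  It therefore suffices to find E and a companion E_2 with
   E V = Y V Y^-1 E_2 and E_2 V = X^-* V X^* E.  Differentiating, this is a
   first order system with coefficients a = Y' Y^-1 and a' = (X' X^-1)^*.  The
   unitary solution of u' = (a - a') u / 2, u(0) = 1, reduces it to coefficients
   v and - v with v = u^* (a + a') u / 2, for which E and E_2 are u times an even
   and an odd transmutation operator whose common kernel n solves a Volterra
   equation.  A further term with psi = u^* (beta_2' - a beta_2) arranges that
   E 1 = beta_2.  E^-1 exists since E is a Volterra operator of the second kind. *)

(** Splitting -V^2 into two first order relations keeps the regularity low: the kernel [n] only has
    to be a primitive in its first variable, for which bounded measurable coefficients suffice. The
    integration variable m enters through f(|x - 2m|) because differentiation in x exchanges the
    even and the odd extension of f, evaluated at x - 2m, while the reflection m -> x - m fixes the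
    even one and reverses the odd one. One kernel therefore serves both operators when their
    coefficients are opposite, which is why (a - a')/2 is gauged away first. The relations between Y
    and X make this part skew-adjoint, hence the gauge u unitary. After the translation [U_with_ac]
    no derivative is taken any more: a function is carried with a density ([ac]), the product rule
    is Fubini on a triangle, and identities are proved as uniqueness for homogeneous equations. For
    (iii) the companion is essential: the density of E f contains E_2 f', so E preserves the class
    once E_2 preserves absolutely continuous functions with L_2 density; for E^-1 the same equations
    are solved backwards. *)

Section IntervalIntegrals.
Variable R : realType.
Local Notation mu := (@lebesgue_measure R).
Local Notation ig a b f := (mu.-integrable (Icc a b) (EFin \o f)).
Local Notation Ig a b f := (Rintegral mu (Icc a b) f).
Implicit Types (f g : R -> R) (a b c x y : R).

(** * Real integrals over closed intervals *)

Lemma IccE a b : Icc a b = `[a, b]%classic.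
Proof. by apply/seteqP; split=> x /=; rewrite in_itv. Qed.

Lemma measurable_Icc a b : measurable (Icc a b : set (measurableTypeR R)).
Proof. by rewrite IccE; exact: measurable_itv. Qed.
Hint Resolve measurable_Icc : core.

Lemma Icc_gt a b : b < a -> Icc a b = set0.
Proof.
move=> ba; apply/seteqP; split=> x //= /andP[ax xb].
by move: (lt_le_trans ba ax); rewrite ltNge xb.
Qed.

Lemma mu_Icc_lty a b : (mu (Icc a b) < +oo)%E.
Proof. by rewrite IccE lebesgue_measure_itv/=; case: ifP => _; rewrite ltry. Qed.

Lemma mu_Icc a b : a <= b -> fine (mu (Icc a b)) = b - a.
Proof.
move=> ab; rewrite IccE lebesgue_measure_itv/= lte_fin.
by case: ltgtP ab => // -> _; rewrite subrr.
Qed.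

Lemma sub_Icc a b c d : a <= c -> d <= b -> Icc c d `<=` Icc a b.
Proof.
by move=> ac db x /andP[cx xd]; apply/andP; split; [exact: le_trans cx | exact: le_trans db].
Qed.

Lemma ig_sub a b c d f : a <= c -> d <= b -> ig a b f -> ig c d f.
Proof. by move=> ac db; apply: integrableS => //; exact: sub_Icc. Qed.

Lemma ig_meas a b f : ig a b f -> measurable_fun (Icc a b) f.
Proof. by move/measurable_int/measurable_EFinP. Qed.

Lemma igD a b f g : ig a b f -> ig a b g -> ig a b (fun t => f t + g t).
Proof. by move=> hf hg; have := integrableD (measurable_Icc a b) hf hg. Qed.

Lemma igZ a b k f : ig a b f -> ig a b (fun t => k * f t).
Proof. by move=> hf; have := integrableZl (measurable_Icc a b) k hf. Qed.

Lemma igN a b f : ig a b f -> ig a b (fun t => - f t).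
Proof.
by move=> hf; under [_ \o _]funext do rewrite /= -mulN1r; exact: igZ.
Qed.

Lemma igB a b f g : ig a b f -> ig a b g -> ig a b (fun t => f t - g t).
Proof. by move=> hf hg; apply: igD => //; exact: igN. Qed.

Lemma ig0 a b : ig a b (fun=> 0).
Proof. exact: integrable0. Qed.

Lemma ig_sum a b (J : Type) (s : seq J) (F : J -> R -> R) :
  (forall j, ig a b (F j)) -> ig a b (fun t => \sum_(j <- s) F j t).
Proof.
move=> h; elim: s => [|j s IH].
  by under [_ \o _]funext do rewrite /= big_nil; exact: ig0.
by under [_ \o _]funext do rewrite /= big_cons; exact: igD.
Qed.

Lemma ig_abs a b f : ig a b f -> ig a b (fun t => `|f t|).
Proof. exact: integrable_norm. Qed.

Lemma ig_dom a b f g : measurable_fun (Icc a b) f ->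
  (forall t, Icc a b t -> `|f t| <= g t) -> ig a b g -> ig a b f.
Proof.
move=> mf fg; apply: le_integrable => //; first exact/measurable_EFinP.
by move=> t /fg h /=; rewrite lee_fin (le_trans h)// ler_norm.
Qed.

Lemma ig_cst a b c : ig a b (fun=> c).
Proof.
apply/integrableP; split; first exact/measurable_EFinP/measurable_cst.
under eq_integral do rewrite /=.
by rewrite integral_cst//= lte_mul_pinfty// ?mu_Icc_lty.
Qed.

Lemma ig_bdd a b f c : measurable_fun (Icc a b) f ->
  (forall t, Icc a b t -> `|f t| <= c) -> ig a b f.
Proof. by move=> mf fc; apply: (ig_dom (g := fun=> c)) => //; exact: ig_cst. Qed.

Lemma ig_eq a b f g : (forall t, Icc a b t -> f t = g t) -> ig a b f -> ig a b g.
Proof.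
move=> fg; apply: eq_integrable => // t; rewrite inE => h.
by rewrite /= fg.
Qed.

Lemma Ig_eq a b f g : (forall t, Icc a b t -> f t = g t) -> Ig a b f = Ig a b g.
Proof. by move=> fg; apply: eq_Rintegral => t; rewrite inE; exact: fg. Qed.

Lemma Ig_sum a b (J : Type) (s : seq J) (F : J -> R -> R) :
  (forall j, ig a b (F j)) ->
  Ig a b (fun t => \sum_(j <- s) F j t) = \sum_(j <- s) Ig a b (F j).
Proof.
move=> h; elim: s => [|j s IH].
  rewrite big_nil (Ig_eq (g := fun=> 0)) ?Rintegral_cst ?mul0r// => t _.
  by rewrite big_nil.
rewrite big_cons -IH -RintegralD//; last exact: ig_sum.
by apply: Ig_eq => t _; rewrite big_cons.
Qed.

Lemma Ig_cst a b c : a <= b -> Ig a b (fun=> c) = c * (b - a).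
Proof. by move=> ab; rewrite Rintegral_cst// mu_Icc. Qed.

Lemma Ig_pt a f : Ig a a f = 0.
Proof. by rewrite IccE set_itv1 Rintegral_set1. Qed.

Lemma Ig_gt a b f : b < a -> Ig a b f = 0.
Proof. by move=> ab; rewrite Icc_gt// Rintegral_set0. Qed.

Lemma Ig_chasles a b c f : a <= b -> b <= c -> ig a c f ->
  Ig a c f = Ig a b f + Ig b c f.
Proof.
rewrite !IccE => ab bc hf.
have := @Rintegral_itvB _ f (BLeft a) (BRight c) b hf.
rewrite !bnd_simp => /(_ ab bc) h.
rewrite -(@Rintegral_itv_obnd_cbnd _ b (BRight c)).
  by rewrite -h addrC subrK.
by apply: integrableS hf => //; apply: subset_itvr; rewrite bnd_simp.
Qed.

Lemma Ig_le a b f g : ig a b f -> ig a b g ->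
  (forall t, Icc a b t -> f t <= g t) -> Ig a b f <= Ig a b g.
Proof. by move=> hf hg fg; exact: le_Rintegral. Qed.

Lemma Ig_ge0 a b f : (forall t, Icc a b t -> 0 <= f t) -> 0 <= Ig a b f.
Proof. by move=> h; exact: (@Rintegral_ge0 _ _ _ mu (Icc a b) f h). Qed.

Lemma Ig_abs a b f : ig a b f -> `|Ig a b f| <= Ig a b (fun t => `|f t|).
Proof. by move=> hf; exact: le_normr_Rintegral. Qed.

Lemma Ig_subset_le a b c d f : a <= c -> c <= d -> d <= b -> ig a b f ->
  (forall t, Icc a b t -> 0 <= f t) -> Ig c d f <= Ig a b f.
Proof.
move=> ac cd db hf f0.
have ad := le_trans ac cd.
rewrite (@Ig_chasles a d b)// (@Ig_chasles a c d)//; last first.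
  exact: ig_sub hf.
rewrite addrAC lerDr addr_ge0//; apply: Ig_ge0 => t th; apply: f0.
  by apply: sub_Icc th => //; rewrite (le_trans cd db).
exact: sub_Icc th.
Qed.

Lemma Ig_eq_oc a b f g : ig a b f -> ig a b g ->
  (forall t, a < t <= b -> f t = g t) -> Ig a b f = Ig a b g.
Proof.
move=> hf hg fg.
have [ba|ab] := ltP b a; first by rewrite !Ig_gt.
rewrite !IccE in hf hg *.
rewrite -!Rintegral_itv_obnd_cbnd; first last.
- by apply: integrableS hf => //; apply: subset_itvr; rewrite bnd_simp.
- by apply: integrableS hg => //; apply: subset_itvr; rewrite bnd_simp.
by apply: eq_Rintegral => t; rewrite inE/= in_itv/= => /fg.
Qed.

Lemma Ig_eq_co a b f g : ig a b f -> ig a b g ->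
  (forall t, a <= t < b -> f t = g t) -> Ig a b f = Ig a b g.
Proof.
move=> hf hg fg.
have [ba|ab] := ltP b a; first by rewrite !Ig_gt.
rewrite !IccE in hf hg *.
rewrite -!Rintegral_itv_bndo_bndc; first last.
- by apply: integrableS hf => //; apply: subset_itvl; rewrite bnd_simp.
- by apply: integrableS hg => //; apply: subset_itvl; rewrite bnd_simp.
by apply: eq_Rintegral => t; rewrite inE/= in_itv/= => /fg.
Qed.

(** Integrating the weight gains a factor 1/l whatever the lower limit, which turns an integral
    operator into a contraction once l is large. For x < m the interval is empty and the bound is
    trivial. *)
Lemma Ig_exp_le m x (l : R) : 0 < l ->
  ig m x (fun y => expR (l * y)) /\
  Ig m x (fun y => expR (l * y)) <= expR (l * x) / l.
Proof.
move=> l0.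
have cl : continuous (fun y : R => expR (l * y)).
  move=> y; apply: continuous_comp; last exact: continuous_expR.
  by apply: continuousM; [exact: cvg_cst | exact: cvg_id].
have mexp D : measurable_fun D (fun y : R => expR (l * y)).
  by apply: measurable_funTS; exact: continuous_measurable_fun.
have iexp : ig m x (fun y => expR (l * y)).
  apply: (ig_bdd (c := expR (l * x))) => // t /= /andP[_ tx].
  by rewrite ger0_norm ?expR_ge0// ler_expR ler_pM2l.
split=> //.
have [xm|] := ltP x m; first by rewrite Ig_gt// divr_ge0// ?expR_ge0// ltW.
rewrite le_eqVlt => /predU1P[->|mx].
  by rewrite Ig_pt divr_ge0// ?expR_ge0// ltW.
pose F y := l^-1 * expR (l * y).
have dF (y : R) : is_derive y 1 F (expR (l * y)).
  have d1 : is_derive y 1 (l \*: (id : R -> R)) (l *: 1) by exact: is_deriveZ.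
  have d2 := is_derive1_comp (is_derive_expR _) d1.
  have d3 := is_deriveZ l^-1 d2.
  apply: is_derive_eq d3 _ => /=.
  by rewrite /GRing.scale/= mulr1 mulrCA mulVf ?mulr1// gt_eqF.
rewrite IccE /Rintegral (@continuous_FTC2 _ _ F) //.
- rewrite -EFinB /= /F mulrC lerBlDr lerDl mulr_ge0 ?expR_ge0// ?invr_ge0 ?ltW//.
- exact: continuous_subspaceT.
- have cF (y : R) : {for y, continuous F}.
    apply: differentiable_continuous; apply/derivable1_diffP.
    by have [] := dF y.
  split=> [y _||].
  + by have [] := dF y.
  + exact: cvg_at_right_filter (cF _).
  + exact: cvg_at_left_filter (cF _).
- by move=> y _; rewrite derive1E; have [] := dF y.
Qed.

End IntervalIntegrals.

(** * Affine changes of variable *)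

Section Substitution.
Variable R : realType.
Local Notation mu := (@lebesgue_measure R).
Local Notation ig a b f := (mu.-integrable (Icc a b) (EFin \o f)).
Local Notation Ig a b f := (Rintegral mu (Icc a b) f).
Hint Resolve measurable_Icc : core.
Variables (s c0 : R).
Hypothesis s0 : s != 0.
Let phi : measurableTypeR R -> measurableTypeR R := fun t => c0 + s * t.

Let mphi : measurable_fun setT phi.
Proof.
apply: measurable_funD; first exact: measurable_cst.
by apply: measurable_funM; [exact: measurable_cst | exact: measurable_id].
Qed.

Let ns : {nonneg R} := NngNum (normr_ge0 s).

(** Keeps the pushforward measure opaque: only its values on sets and the transport of nonnegative
    integrals are used afterwards. *)
Let pm_ : exists pm : {measure set (measurableTypeR R) -> \bar R},
  (forall A, pm A = mu (phi @^-1` A)) /\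
  (forall D (F : R -> \bar R), measurable D -> measurable_fun setT F ->
   (forall t, (0 <= F t)%E) ->
   (\int[pm]_(t in D) F t = \int[mu]_(t in phi @^-1` D) F (phi t))%E).
Proof.
unshelve eexists (pushforward mu phi); first exact: mphi.
split=> // D F mD mF F0.
by rewrite (@ge0_integral_pushforward _ _ _ _ _ phi)//; exact: measurable_funTS.
Qed.

(** Both sides are measures in [A], so by uniqueness of Lebesgue measure it suffices to compare them
    on half-open intervals. For s < 0 the preimage of ]a, b] is half-open at the other end, which
    does not change its length. *)
Lemma lebesgue_measure_affine (A : set (measurableTypeR R)) : measurable A ->
  mu A = (`|s|%:E * mu (phi @^-1` A))%E.
Proof.
have [pm [pmE _]] := pm_.
move=> mA; suff h : forall X, ocitv X -> mu X = mscale ns pm X.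
  by rewrite (lebesgue_measure_unique h mA) /mscale; congr (_ * _)%E; exact: pmE.
move=> _ [[a b] _ <-]; rewrite /mscale.
have -> : pm `]a, b]%classic = mu (phi @^-1` `]a, b]%classic) by exact: pmE.
have [sp|sn] := ltP 0 s.
  have -> : phi @^-1` `]a, b]%classic = `](a - c0) / s, (b - c0) / s]%classic.
    apply/seteqP; split=> t /=; rewrite !in_itv/= /phi.
      by rewrite ltr_pdivrMr// ler_pdivlMr// mulrC ltrBlDl lerBrDl.
    by rewrite ltr_pdivrMr// ler_pdivlMr// mulrC ltrBlDl lerBrDl.
  rewrite !lebesgue_measure_itv/= !lte_fin ltr_pM2r ?invr_gt0// ltrD2r.
  case: ifP => _; last by rewrite mule0.
  rewrite -!EFinB -EFinM gtr0_norm//; congr EFin.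
  by field.
have {}sn : s < 0 by rewrite lt_neqAle s0.
have -> : phi @^-1` `]a, b]%classic = `[(b - c0) / s, (a - c0) / s[%classic.
  apply/seteqP; split=> t /=; rewrite !in_itv/= /phi.
    by rewrite ltr_ndivlMr// ler_ndivrMr// mulrC ltrBlDl lerBrDl andbC.
  by rewrite ltr_ndivlMr// ler_ndivrMr// mulrC ltrBlDl lerBrDl andbC.
rewrite !lebesgue_measure_itv/= !lte_fin ltr_nM2r ?invr_lt0// ltrD2r.
case: ifP => _; last by rewrite mule0.
rewrite -!EFinB -EFinM ltr0_norm//; congr EFin.
by field.
Qed.

Lemma ge0_integral_affine (D : set (measurableTypeR R)) (F : R -> \bar R) :
  measurable D ->
  measurable_fun setT F -> (forall t, (0 <= F t)%E) ->
  (\int[mu]_(t in D) F t = `|s|%:E * \int[mu]_(t in phi @^-1` D) F (phi t))%E.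
Proof.
move=> mD mF F0; have [pm [pmE pmI]] := pm_.
rewrite (eq_measure_integral (mscale ns pm)) => [|A mA _]; last first.
  have e1 := lebesgue_measure_affine mA; rewrite /= in e1.
  transitivity (`|s|%:E * mu (phi @^-1` A))%E; first exact: e1.
  by rewrite /mscale; congr (_ * _)%E; apply/esym; exact: pmE.
rewrite ge0_integral_mscale//; last exact: measurable_funTS.
by congr (_ * _)%E; exact: pmI.
Qed.

(** The equivalence in the hypothesis says that [a, b] is the preimage of [c, d], so both signs of s
    are covered without orienting the interval. The formula for nonnegative functions is applied to
    the positive and the negative part, and once to |f| to transfer integrability. *)
Lemma integral_affine a b c d (f : R -> R) :
  measurable_fun setT f -> (forall t, Icc a b t <-> Icc c d (c0 + s * t)) ->
  ig c d f ->
  ig a b (fun t => f (c0 + s * t)) /\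
  Ig c d f = `|s| * Ig a b (fun t => f (c0 + s * t)).
Proof.
move=> mf hD hf.
have mfp : measurable_fun setT (f \o phi) by exact: measurableT_comp.
have pD : phi @^-1` (Icc c d) = Icc a b.
  by apply/seteqP; split=> t /=; have [h1 h2] := hD t; rewrite /phi.
have [_ /integrableP[_ ifin]] := (I, hf).
have hi : ig a b (fun t => f (c0 + s * t)).
  apply/integrableP; split.
    by apply/measurable_EFinP; apply: measurable_funTS; exact: mfp.
  move: ifin; rewrite (@ge0_integral_affine _ (fun t => `|f t|%:E)%E)//; last first.
    by apply/measurable_EFinP; exact: measurableT_comp.
  rewrite pD => h.
  have sp : 0 < `|s| by rewrite normr_gt0.
  (* An infinite integral over the new interval, multiplied by |s| > 0, would make the finite
     integral of |f| infinite. *)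
  rewrite ltNge leye_eq; apply/negP => /eqP e.
  move: h; rewrite (_ : (\int[mu]_(t in Icc a b) _)%E = +oo%E)//.
  by rewrite gt0_muley ?lte_fin.
split=> //.
rewrite /Rintegral integralE [in RHS]integralE.
rewrite (@ge0_integral_affine _ (EFin \o f)^\+%E)//; last first.
  by apply: measurable_funepos; exact/measurable_EFinP.
rewrite (@ge0_integral_affine _ (EFin \o f)^\-%E)//; last first.
  by apply: measurable_funeneg; exact/measurable_EFinP.
rewrite pD; pose h t := f (c0 + s * t).
have eN : (\int[mu]_(t in Icc a b) (EFin \o f)^\- (phi t) =
    \int[mu]_(t in Icc a b) (EFin \o h)^\- t)%E.
  by apply: eq_integral => t _; rewrite !funenegE.
have eP : (\int[mu]_(t in Icc a b) (EFin \o f)^\+ (phi t) =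
    \int[mu]_(t in Icc a b) (EFin \o h)^\+ t)%E.
  by apply: eq_integral => t _; rewrite !funeposE.
rewrite eN eP.
have fN := integrable_fin_num (measurable_Icc a b) (integrable_funeneg (measurable_Icc a b) hi).
have fP := integrable_fin_num (measurable_Icc a b) (integrable_funepos (measurable_Icc a b) hi).
rewrite -muleBr//; last by apply: fin_num_adde_defl; rewrite fin_numN.
by rewrite fineM// fin_numB fP fN.
Qed.

End Substitution.

(** * Integrals depending on a parameter, and Fubini on a triangle *)

Section ParametricIntegrals.
Variable R : realType.
Local Notation mu := (@lebesgue_measure R).
Local Notation ig a b f := (mu.-integrable (Icc a b) (EFin \o f)).
Local Notation Ig a b f := (Rintegral mu (Icc a b) f).
Hint Resolve measurable_Icc : core.

Lemma integral_Icc_patch a b (f : R -> R) :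
  (\int[mu]_(t in Icc a b) (f t)%:E =
   \int[mu]_t (if (a <= t <= b)%R then f t else 0%R)%:E)%E.
Proof.
rewrite integral_mkcond; apply: eq_integral => t _; rewrite patchE.
case: ifPn => [|]; first by rewrite inE => h; rewrite h.
by rewrite notin_setE /Icc/= => /negP/negbTE ->.
Qed.

(** The moving limits are absorbed into the integrand as a measurable condition on pairs. Tonelli
    then gives measurability of the integrals of the positive and of the negative part
    separately. *)
Lemma measurable_Ig (d : measure_display) (Z : measurableType d)
    (H : Z * R -> R) (a b : Z -> R) :
  measurable_fun setT H -> measurable_fun setT a -> measurable_fun setT b ->
  measurable_fun setT (fun z => Ig (a z) (b z) (fun t => H (z, t))).
Proof.
move=> mH ma mb.
pose H' (w : Z * R) := if a w.1 <= w.2 <= b w.1 then H w else 0.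
have mH' : measurable_fun setT H'.
  apply: measurable_fun_ifT => //.
  apply: measurable_and; apply: measurable_fun_ler => //;
    by apply: measurableT_comp => //; exact: measurable_fst.
have -> : (fun z => Ig (a z) (b z) (fun t => H (z, t))) =
   (fun z => fine ((\int[mu]_t (EFin \o H')^\+ (z, t)) - (\int[mu]_t (EFin \o H')^\- (z, t)))%E).
  apply/funext => z; rewrite /Rintegral integral_Icc_patch integralE; congr fine.
  by congr (_ - _)%E; apply: eq_integral => t _; rewrite ?funeposE ?funenegE.
apply: measurableT_comp; first exact: fine_measurable.
have mE : measurable_fun setT (EFin \o H') by exact/measurable_EFinP.
apply: emeasurable_funB.
  apply: (@measurable_fun_fubini_tonelli_F _ _ _ _ _ mu (EFin \o H')^\+%E) => //.
  exact: measurable_funepos.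
apply: (@measurable_fun_fubini_tonelli_F _ _ _ _ _ mu (EFin \o H')^\-%E) => //.
exact: measurable_funeneg.
Qed.

(** The triangle is A <= m <= y <= X. The majorant [C] of the inner absolute integrals gives
    integrability on the product by Tonelli, after which Fubini applies to the extension by zero. *)
Lemma Fubini_triangle (H : R * R -> R) (A X : R) (C : R -> R) :
  measurable_fun setT H -> ig A X C ->
  (forall m, Icc A X m -> ig m X (fun y => H (y, m)) /\
     Ig m X (fun y => `|H (y, m)|) <= C m) ->
  (forall y, Icc A X y -> ig A y (fun m => H (y, m))) ->
  [/\ ig A X (fun m => Ig m X (fun y => H (y, m))),
      ig A X (fun y => Ig A y (fun m => H (y, m))) &
      Ig A X (fun m => Ig m X (fun y => H (y, m))) =
      Ig A X (fun y => Ig A y (fun m => H (y, m)))].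
Proof.
move=> mH iC h1 h2.
(* The arguments are swapped here: m comes first. *)
pose H' (w : R * R) := if (A <= w.1) && (w.1 <= w.2 <= X) then H (w.2, w.1) else 0.
have mH' : measurable_fun setT H'.
  apply: measurable_fun_ifT => //.
    apply: measurable_and; first exact: measurable_fun_ler.
    apply: measurable_and; exact: measurable_fun_ler.
  apply: measurableT_comp => //; apply: measurable_fun_pair.
    exact: measurable_snd.
  exact: measurable_fst.
have E1 m : (\int[mu]_y (H' (m, y))%:E =
    ((fun m => (Ig m X (fun y => H (y, m)))%:E) \_ (Icc A X)) m)%E.
  rewrite patchE; case: ifPn => [|].
    rewrite inE => mX; have [hi _] := h1 _ mX.
    rewrite /Rintegral fineK; last exact: integrable_fin_num.
    rewrite integral_Icc_patch; apply: eq_integral => y _.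
    by case/andP: mX => m0 _; rewrite /H'/= m0.
  rewrite notin_setE /Icc/= => mX; apply: integral0_eq => y _.
  rewrite /H'/=; case: ifPn => // /and3P[m0 my yX]; exfalso; apply: mX.
  by rewrite m0 (le_trans my yX).
have E1a m : (\int[mu]_y `|(H' (m, y))%:E| =
    ((fun m => (Ig m X (fun y => `|H (y, m)|%R))%:E) \_ (Icc A X)) m)%E.
  rewrite patchE; case: ifPn => [|].
    rewrite inE => mX; have [hi _] := h1 _ mX.
    rewrite /Rintegral fineK; last by apply: integrable_fin_num => //; exact: ig_abs.
    rewrite (integral_Icc_patch m X (fun y => `|H (y, m)|)); apply: eq_integral => y _.
    case/andP: mX => m0 _; rewrite /H'/= m0/=.
    by case: ifP => //=; rewrite normr0.
  rewrite notin_setE /Icc/= => mX; apply: integral0_eq => y _.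
  rewrite /H'/=; case: ifPn => [/and3P[m0 my yX]|_]; last by rewrite normr0.
  by exfalso; apply: mX; rewrite m0 (le_trans my yX).
have E2 y : (\int[mu]_m (H' (m, y))%:E =
    ((fun y => (Ig A y (fun m => H (y, m)))%:E) \_ (Icc A X)) y)%E.
  rewrite patchE; case: ifPn => [|].
    rewrite inE => yX; have hi := h2 _ yX.
    rewrite /Rintegral fineK; last exact: integrable_fin_num.
    rewrite integral_Icc_patch; apply: eq_integral => m _.
    by case/andP: yX => _ yX; rewrite /H'/= yX andbT.
  rewrite notin_setE /Icc/= => yX; apply: integral0_eq => m _.
  rewrite /H'/=; case: ifPn => // /and3P[m0 my yX']; exfalso; apply: yX.
  by rewrite yX' (le_trans m0 my).
have fin : (\int[mu]_m \int[mu]_y `|(EFin \o H') (m, y)| < +oo)%E.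
  under eq_integral do rewrite /= E1a.
  rewrite -integral_mkcond.
  apply: (@le_lt_trans _ _ (\int[mu]_(m in Icc A X) (C m)%:E)%E).
    apply: ge0_le_integral => //.
    - by move=> m _; rewrite lee_fin; apply: Ig_ge0.
    - apply/measurable_EFinP; apply: measurable_funTS.
      apply: (@measurable_Ig _ _ (fun w => `|H (w.2, w.1)|) id (fun=> X)) => //.
      apply: measurableT_comp => //; apply: measurableT_comp => //.
      by apply: measurable_fun_pair; [exact: measurable_snd|exact: measurable_fst].
    - exact: measurable_int iC.
    - by move=> m mX; rewrite lee_fin (h1 m mX).2.
  exact: (integrable_lty (measurable_Icc A X) iC).
have iH : (mu \x mu)%E.-integrable setT (EFin \o H').
  by apply/integrable12ltyP => //; exact/measurable_EFinP.
have iH' : (mu \x mu)%E.-integrable setT (EFin \o (fun w => H' (w.2, w.1))).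
  apply/integrable21ltyP => //; apply/measurable_EFinP; apply: measurableT_comp => //.
  by apply: measurable_fun_pair; [exact: measurable_snd|exact: measurable_fst].
have i1 : ig A X (fun m => Ig m X (fun y => H (y, m))).
  apply/integrable_mkcond => //.
  have := integrable_fubini_F iH; apply: eq_integrable => // m _.
  by rewrite /fubini_F/= E1.
have i2 : ig A X (fun y => Ig A y (fun m => H (y, m))).
  apply/integrable_mkcond => //.
  have := integrable_fubini_F iH'; apply: eq_integrable => // m _.
  by rewrite /fubini_F/= E2.
split=> //; have := Fubini iH.
under eq_integral do rewrite /= E1.
under [RHS]eq_integral do rewrite /= E2.
by rewrite -!integral_mkcond /Rintegral => ->.
Qed.

End ParametricIntegrals.

(** * The fundamental theorem of calculus with one-sided derivatives at the endpoints *)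

Section FundamentalTheorem.
Variable R : realType.
Local Notation mu := (@lebesgue_measure R).
Local Notation ig a b f := (mu.-integrable (Icc a b) (EFin \o f)).
Local Notation Ig a b f := (Rintegral mu (Icc a b) f).
Hint Resolve measurable_Icc : core.

Lemma within_continuous_eps r (f : R -> R) :
  {within `[0, r], continuous f} -> forall x, Icc 0 r x ->
  forall e, 0 < e -> exists2 d, 0 < d &
    forall y, Icc 0 r y -> `|y - x| < d -> `|f y - f x| <= e.
Proof.
move=> /subspace_continuousP cf x xr e e0.
rewrite -IccE in cf.
have /cvgrPdist_le/(_ e e0) := cf x xr.
move=> /nbhs_ballP[d /= d0 h]; exists d => // y yr yx.
rewrite distrC; apply: h => //.
by rewrite /ball/= distrC.
Qed.

Lemma rderiv_within_lipschitz r (h : R -> R) x d : rderiv_within r h x d ->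
  exists2 de, 0 < de &
    forall y, Icc 0 r y -> `|y - x| < de -> `|h y - h x| <= (`|d| + 1) * `|y - x|.
Proof.
move=> /cvgrPdist_le/(_ 1 ltr01)/nbhs_ballP[de /= de0 H]; exists de => // y yr yx.
have [->|nxy] := eqVneq y x; first by rewrite !subrr normr0 mulr0.
have := H y; rewrite /ball/= distrC => /(_ yx (conj yr nxy)) h1.
have yx0 : y - x != 0 by rewrite subr_eq0.
rewrite -[h y - h x](divfK yx0) normrM ler_wpM2r//.
rewrite -[_ / _](addrNK d) (le_trans (ler_normD _ _))// addrC lerD2l.
by rewrite distrC.
Qed.

(** In a small ball around an interior point the constraint to [0, r] holds automatically, so the
    restricted limit is the usual one. *)
Lemma rderiv_within_interior (r : R) (h : R -> R) (x d : R) : 0 < x -> x < r ->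
  rderiv_within r h x d -> derivable h x 1 /\ derive1 h x = d.
Proof.
move=> x0 xr hd.
have H : (fun k => k^-1 *: ((h \o shift x) (k *: (1 : R)) - h x)) @ 0^' --> d.
  apply/cvgrPdist_le => e e0.
  have /cvgrPdist_le/(_ e e0)/nbhs_ballP[de /= de0 H] := hd.
  near=> k.
  have k0 : k != 0 by near: k; exact: nbhs_dnbhs_neq.
  rewrite /= [k *: 1]mulr1 /GRing.scale/=.
  have := H (k + x); rewrite /= addrK mulrC; apply.
    rewrite /ball/= opprD addrCA subrr addr0 normrN.
    by near: k; apply: dnbhs0_lt.
  split; last by rewrite -subr_eq0 addrK.
  apply/andP; split.
    rewrite addrC -lerBlDl sub0r lerNl (le_trans (ler_norm _))// normrN.
    by near: k; apply: dnbhs0_le.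
  rewrite -lerBrDr (le_trans (ler_norm _))//.
  by near: k; apply: dnbhs0_le; rewrite subr_gt0.
split; first by apply: cvgP H.
by rewrite derive1E; apply/cvg_lim.
Unshelve. all: by end_near. Qed.

Lemma Ig_continuous r (f : R -> R) : 0 <= r -> ig 0 r f ->
  {within `[0, r], continuous (fun x => Ig 0 x f)}.
Proof.
move=> r0; rewrite IccE => hf.
have := parameterized_integral_continuous r0 hf.
rewrite /parameterized_integral.
by under [X in _ -> {within _, continuous X}]funext do rewrite IccE.
Qed.

Lemma Ig_rderiv r (f : R -> R) x : ig 0 r f -> {within `[0, r], continuous f} ->
  Icc 0 r x -> rderiv_within r (fun y => Ig 0 y f) x (f x).
Proof.
move=> hf cf xr; apply/cvgrPdist_le => e e0.
have [de de0 H] := within_continuous_eps cf xr e0.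
apply/nbhs_ballP; exists de => //= y; rewrite /ball/= => xy [yr nxy].
(* Stated for an ordered interval on which f stays within e of f x; it is used once with x as left
   endpoint and once with x as right endpoint. *)
have key a b : Icc 0 r a -> Icc 0 r b -> a < b ->
    (forall t, Icc a b t -> `|f t - f x| <= e) ->
    `|Ig 0 b f - Ig 0 a f - f x * (b - a)| <= e * (b - a).
  move=> /andP[a0 ar] /andP[b0 br] ab ht.
  have iab : ig a b f by exact: ig_sub hf.
  rewrite (@Ig_chasles _ 0 a b)// ?(ltW ab)//; last exact: ig_sub hf.
  rewrite [_ - Ig 0 a f]addrAC subrr add0r -(Ig_cst (f x) (ltW ab)) -RintegralB//; last exact: ig_cst.
  have iB : ig a b (fun t => f t - f x) by apply: igB => //; exact: ig_cst.
  apply: (le_trans (Ig_abs iB)); rewrite -(Ig_cst e (ltW ab)).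
  by apply: Ig_le => //; [exact: ig_abs | exact: ig_cst].
have quo (B p : R) : 0 < p -> `|B - f x * p| <= e * p -> `|f x - B / p| <= e.
  move=> p0 h; rewrite -(ler_pM2r p0) -{2}(gtr0_norm p0) -normrM mulrBl.
  by rewrite divfK ?gt_eqF// distrC.
have [xy'|yx'|xy'] := ltgtP x y; last by rewrite xy' eqxx in nxy.
  apply: quo; first by rewrite subr_gt0.
  apply: key => // t /andP[xt ty]; apply: H.
    case/andP: xr => x0 _; case/andP: yr => _ yr.
    by apply/andP; split; [exact: le_trans xt|exact: le_trans yr].
  rewrite ger0_norm ?subr_ge0//; apply: le_lt_trans xy.
  by rewrite distrC ger0_norm ?subr_ge0 ?(ltW xy')// lerD2r.
rewrite -[Ig 0 y f - _]opprB -[y - x]opprB invrN mulrNN.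
apply: quo; first by rewrite subr_gt0.
apply: key => // t /andP[xt ty]; apply: H.
  case/andP: yr => x0 _; case/andP: xr => _ yr.
  by apply/andP; split; [exact: le_trans xt|exact: le_trans yr].
rewrite distrC ger0_norm ?subr_ge0//; apply: le_lt_trans xy.
by rewrite ger0_norm ?subr_ge0 ?(ltW yx')// lerD2l lerN2.
Qed.

(** The derivative is two-sided only at interior points. At 0 and x the fundamental theorem asks for
    mere continuity of h, which comes from the local Lipschitz bound. *)
Lemma rderiv_integral r (h d : R -> R) :
  (forall x, Icc 0 r x -> rderiv_within r h x (d x)) ->
  {within `[0, r], continuous d} ->
  forall x, Icc 0 r x -> h x = h 0 + Ig 0 x d.
Proof.
move=> hd cd x /andP[+ xr].
rewrite le_eqVlt => /predU1P[<-|x0]; first by rewrite Ig_pt addr0.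
have lipc y : Icc 0 r y -> forall e, 0 < e -> exists2 de, 0 < de &
    forall z, Icc 0 r z -> `|z - y| < de -> `|h z - h y| <= e.
  move=> yr e e0; have [de de0 H] := rderiv_within_lipschitz (hd _ yr).
  have c0 : 0 < `|d y| + 1 by rewrite ltr_wpDl.
  exists (Num.min de (e / (`|d y| + 1))); first by rewrite lt_min de0 divr_gt0.
  move=> z zr; rewrite lt_min => /andP[h1 h2]; apply: le_trans (H _ zr h1) _.
  by rewrite mulrC -ler_pdivlMr// ltW.
rewrite IccE /Rintegral (@continuous_FTC2 _ _ h)//.
- by rewrite -EFinB /= addrC subrK.
- by apply: continuous_subspaceW cd; apply: subset_itvl; rewrite bnd_simp.
- split.
  + move=> y; rewrite in_itv/= => /andP[y0 yx].
    have yr := lt_le_trans yx xr.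
    by have [] := rderiv_within_interior y0 yr (hd y _) => //; rewrite /Icc/= !ltW.
  + apply/cvgrPdist_le => e e0.
    have [|de de0 H] := lipc 0 _ e e0; first by rewrite /Icc/= lexx (ltW (lt_le_trans x0 xr)).
    near=> z; rewrite distrC; apply: H.
      apply/andP; split; near: z; first exact: nbhs_right_ge.
      by apply: nbhs_right_le; exact: lt_le_trans xr.
    rewrite subr0 ger0_norm; near: z; last exact: nbhs_right_ge.
    exact: nbhs_right_lt.
  + apply/cvgrPdist_le => e e0.
    have [|de de0 H] := lipc x _ e e0; first by rewrite /Icc/= xr (ltW x0).
    near=> z; rewrite distrC; apply: H.
      apply/andP; split; first by near: z; apply: nbhs_left_ge.
      apply: le_trans xr; by near: z; exact: nbhs_left_le.
    rewrite ltr0_norm ?subr_lt0; last by near: z; exact: nbhs_left_lt.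
    by rewrite opprB ltrBlDl -ltrBlDr; near: z; apply: nbhs_left_gt; rewrite gtrBl.
- move=> y; rewrite in_itv/= => /andP[y0 yx].
  have yr := lt_le_trans yx xr.
  by have [] := rderiv_within_interior y0 yr (hd y _) => //; rewrite /Icc/= !ltW.
Unshelve. all: by end_near. Qed.

End FundamentalTheorem.

(** * Complex matrices: an entrywise norm, real-linear maps and integrals *)

Section ComplexMatrices.
Variable R : realType.
Local Notation C := (R[i]).
Local Notation mu := (@lebesgue_measure R).
Local Notation ig a b f := (mu.-integrable (Icc a b) (EFin \o f)).
Local Notation Ig a b f := (Rintegral mu (Icc a b) f).
Hint Resolve measurable_Icc : core.

(** A boolean index for the two real coordinates: one real statement quantified over [e] replaces a
    pair of statements about real and imaginary parts. *)
Definition ri (e : bool) (z : C) : R := if e then complex.Im z else complex.Re z.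

Lemma ri_inj (z w : C) : (forall e, ri e z = ri e w) -> z = w.
Proof.
move=> h; have := h true; have := h false; rewrite /ri.
by case: z {h} => a b; case: w => c d /= -> ->.
Qed.

Lemma riD e z w : ri e (z + w) = ri e z + ri e w.
Proof. by case: e; case: z => a b; case: w. Qed.

Lemma ri0 e : ri e 0 = 0. Proof. by case: e. Qed.

Lemma riN e z : ri e (- z) = - ri e z.
Proof. by case: e; case: z. Qed.

Lemma ri_sum e (J : Type) (s : seq J) (F : J -> C) :
  ri e (\sum_(j <- s) F j) = \sum_(j <- s) ri e (F j).
Proof.
elim: s => [|j s IH]; first by rewrite !big_nil ri0.
by rewrite !big_cons riD IH.
Qed.

Lemma ri_scale e (x : R) z : ri e (Complex x 0 * z) = x * ri e z.
Proof. by case: e; case: z => a b /=; rewrite !mul0r ?subr0 ?addr0. Qed.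

Lemma riM e z w : ri e (z * w) =
  if e then ri false z * ri true w + ri true z * ri false w
  else ri false z * ri false w - ri true z * ri true w.
Proof. by case: e; case: z => a b; case: w. Qed.

Definition nc (z : C) : R := `|ri false z| + `|ri true z|.

Lemma nc_ge0 z : 0 <= nc z. Proof. by rewrite addr_ge0. Qed.

Lemma ri_le_nc e z : `|ri e z| <= nc z.
Proof. by case: e; rewrite /nc ?lerDl ?lerDr. Qed.

Lemma nc0 : nc 0 = 0. Proof. by rewrite /nc !ri0 normr0 addr0. Qed.

Lemma ncD z w : nc (z + w) <= nc z + nc w.
Proof. by rewrite /nc !riD addrACA lerD// ler_normD. Qed.

Lemma ncN z : nc (- z) = nc z. Proof. by rewrite /nc !riN !normrN. Qed.

Lemma ncM z w : nc (z * w) <= nc z * nc w.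
Proof.
rewrite /nc !riM mulrDl !mulrDr -!normrM.
have h1 := ler_normB (ri false z * ri false w) (ri true z * ri true w).
have h2 := ler_normD (ri false z * ri true w) (ri true z * ri false w).
lra.
Qed.

Lemma ncZ (x : R) z : nc (Complex x 0 * z) = `|x| * nc z.
Proof. by rewrite /nc !ri_scale !normrM mulrDr. Qed.

(** The l^1 norm over all real coordinates. It is submultiplicative, and bounding the norm of an
    integral reduces to the scalar triangle inequality in each coordinate. *)
Definition nrm m n (M : 'M[C]_(m, n)) : R := \sum_i \sum_j nc (M i j).

Lemma nrm_ge0 m n (M : 'M[C]_(m, n)) : 0 <= nrm M.
Proof. by do 2 (apply: sumr_ge0 => ? _); exact: nc_ge0. Qed.

Lemma nc_le_nrm m n (M : 'M[C]_(m, n)) i j : nc (M i j) <= nrm M.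
Proof.
rewrite /nrm (bigD1 i)//= (bigD1 j)//= -addrA lerDl addr_ge0//.
  by apply: sumr_ge0 => ? _; exact: nc_ge0.
by do 2 (apply: sumr_ge0 => ? _); exact: nc_ge0.
Qed.

Lemma ri_le_nrm m n (M : 'M[C]_(m, n)) e i j : `|ri e (M i j)| <= nrm M.
Proof. exact: le_trans (ri_le_nc _ _) (nc_le_nrm _ _ _). Qed.

Lemma nrm0 m n : nrm (0 : 'M[C]_(m, n)) = 0.
Proof. by rewrite /nrm big1// => i _; rewrite big1// => j _; rewrite mxE nc0. Qed.

Lemma nrm0_eq0 m n (M : 'M[C]_(m, n)) : nrm M <= 0 -> M = 0.
Proof.
move=> h; apply/matrixP => i j; rewrite mxE; apply: ri_inj => e; rewrite ri0.
by apply/eqP; rewrite -normr_le0 (le_trans (ri_le_nrm _ _ _ _)).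
Qed.

Lemma nrmD m n (A B : 'M[C]_(m, n)) : nrm (A + B) <= nrm A + nrm B.
Proof.
rewrite /nrm -big_split; apply: ler_sum => i _; rewrite -big_split.
by apply: ler_sum => j _; rewrite mxE ncD.
Qed.

Lemma nrmN m n (A : 'M[C]_(m, n)) : nrm (- A) = nrm A.
Proof. by apply: eq_bigr => i _; apply: eq_bigr => j _; rewrite mxE ncN. Qed.

Lemma nrmB m n (A B : 'M[C]_(m, n)) : nrm (A - B) = nrm (B - A).
Proof. by rewrite -nrmN opprB. Qed.

Lemma nrmZ m n (x : R) (A : 'M[C]_(m, n)) : nrm (Complex x 0 *: A) = `|x| * nrm A.
Proof.
rewrite /nrm mulr_sumr; apply: eq_bigr => i _; rewrite mulr_sumr.
by apply: eq_bigr => j _; rewrite mxE ncZ.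
Qed.

Lemma nc_sum (J : Type) (s : seq J) (F : J -> C) :
  nc (\sum_(j <- s) F j) <= \sum_(j <- s) nc (F j).
Proof.
elim: s => [|j s IH]; first by rewrite !big_nil nc0.
by rewrite !big_cons (le_trans (ncD _ _))// lerD2l.
Qed.

Lemma nrmM m n k (A : 'M[C]_(m, n)) (B : 'M[C]_(n, k)) :
  nrm (A *m B) <= nrm A * nrm B.
Proof.
rewrite /nrm mulr_suml; apply: ler_sum => i _.
apply: (@le_trans _ _ (\sum_j \sum_l nc (A i l) * nc (B l j))).
  apply: ler_sum => j _; rewrite mxE (le_trans (nc_sum _ _))//.
  by apply: ler_sum => l _; exact: ncM.
rewrite exchange_big mulr_suml; apply: ler_sum => l _.
rewrite -mulr_sumr ler_wpM2l ?nc_ge0//.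
rewrite [leRHS](bigD1 l)//= lerDl.
by do 2 (apply: sumr_ge0 => ? _); exact: nc_ge0.
Qed.

Definition mxmeas (d : measure_display) (T : measurableType d) m n
    (D : set T) (F : T -> 'M[C]_(m, n)) : Prop :=
  forall e i j, measurable_fun D (fun t => ri e (F t i j)).

(* Only real scalars, so that [mxstar] qualifies. *)
Definition rlin m n k l (L : 'M[C]_(m, n) -> 'M[C]_(k, l)) : Prop :=
  (forall A B, L (A + B) = L A + L B) /\
  (forall (x : R) A, L (Complex x 0 *: A) = Complex x 0 *: L A).

Definition rbase m n (q : 'I_m * 'I_n * bool) : 'M[C]_(m, n) :=
  (if q.2 then Complex 0 1 else 1) *: delta_mx q.1.1 q.1.2.

(** Over the reals the matrix units and i times them form a basis, so each real coordinate of [L A]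
    is a fixed real combination of those of [A]. Measurability, integrability and commutation with
    integrals then all come from the scalar case. *)
Lemma rlin_expand m n k l (L : 'M[C]_(m, n) -> 'M[C]_(k, l)) : rlin L ->
  forall A e i j, ri e (L A i j) =
  \sum_(q : 'I_m * 'I_n * bool) ri e (L (rbase q) i j) * ri q.2 (A q.1.1 q.1.2).
Proof.
move=> [LD LZ] A e i j.
have L0 : L 0 = 0 by have := LZ 0 0; rewrite !scaler0 => ->; rewrite [Complex 0 0](_ : _ = 0)// scale0r.
have Lsum (J : Type) (s : seq J) (F : J -> 'M[C]_(m, n)) :
    L (\sum_(j <- s) F j) = \sum_(j <- s) L (F j).
  by elim: s => [|x s IH]; rewrite ?big_nil// !big_cons LD IH.
have {1}-> : A = \sum_(q : 'I_m * 'I_n * bool) Complex (ri q.2 (A q.1.1 q.1.2)) 0 *: rbase q.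
  rewrite [LHS]matrix_sum_delta pair_bigA /=.
  rewrite -(pair_bigA _ (fun (w : 'I_m * 'I_n) (e : bool) =>
     Complex (ri e (A w.1 w.2)) 0 *: rbase (w, e)))/=.
  apply: eq_bigr => w _; rewrite big_bool /= /rbase /= !scalerA -scalerDl.
  congr (_ *: _); case: (A w.1 w.2) => x y; apply: ri_inj => -[];
  by rewrite riD mulr1 ri_scale /= ?(mulr0, mulr1, addr0, add0r).
rewrite Lsum summxE ri_sum; apply: eq_bigr => q _.
by rewrite LZ mxE ri_scale mulrC.
Qed.

Section Linear.
Variables (m n k l : nat) (L : 'M[C]_(m, n) -> 'M[C]_(k, l)).
Hypothesis hL : rlin L.

Lemma cintegrableP m' n' a b (F : R -> 'M[C]_(m', n')) :
  cintegrable a b F <-> forall e i j, ig a b (fun t => ri e (F t i j)).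
Proof.
split=> [h [] i j|h i j]; try by have [] := h i j.
by split; [exact: (h false)|exact: (h true)].
Qed.

Lemma ri_cint m' n' a b (F : R -> 'M[C]_(m', n')) e i j :
  ri e (cint a b F i j) = Ig a b (fun t => ri e (F t i j)).
Proof. by rewrite mxE; case: e. Qed.

Lemma cintegrable_rlin a b F : cintegrable a b F -> cintegrable a b (fun t => L (F t)).
Proof.
move=> /cintegrableP h; apply/cintegrableP => e i j.
under [_ \o _]funext do rewrite /= (rlin_expand hL).
by apply: ig_sum => q; apply: igZ.
Qed.

Lemma cint_rlin a b F : cintegrable a b F -> cint a b (fun t => L (F t)) = L (cint a b F).
Proof.
move=> /cintegrableP h; apply/matrixP => i j; apply: ri_inj => e.
rewrite ri_cint (rlin_expand hL).
under eq_Rintegral do rewrite (rlin_expand hL).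
rewrite Ig_sum => [|q]; last exact: igZ.
by apply: eq_bigr => q _; rewrite RintegralZl// ri_cint.
Qed.

Lemma mxmeas_rlin (d : measure_display) (T : measurableType d) (D : set T) F :
  mxmeas D F -> mxmeas D (fun t => L (F t)).
Proof.
move=> h e i j; under [X in measurable_fun _ X]funext do rewrite (rlin_expand hL).
by apply: measurable_sum => q; apply: measurable_funM => //; exact: h.
Qed.

End Linear.

Lemma rlin_mulmxl m n k (A : 'M[C]_(k, m)) : rlin (fun M : 'M[C]_(m, n) => A *m M).
Proof. by split=> [*|*]; rewrite ?mulmxDr// -scalemxAr. Qed.

Lemma rlin_mulmxr m n k (A : 'M[C]_(n, k)) : rlin (fun M : 'M[C]_(m, n) => M *m A).
Proof. by split=> [*|*]; rewrite ?mulmxDl// -scalemxAl. Qed.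

Lemma rlin_scale m n (z : C) : rlin (fun M : 'M[C]_(m, n) => z *: M).
Proof. by split=> [*|*]; rewrite ?scalerDr// !scalerA mulrC. Qed.

Lemma rlin_star m n : rlin (@mxstar R m n).
Proof.
split=> [A B|x A]; apply/matrixP => i j; rewrite !mxE ?rmorphD// rmorphM.
by congr (_ * _); apply/eqP; rewrite eq_complex /= oppr0 !eqxx.
Qed.

Lemma rlin_opp m n : rlin (fun M : 'M[C]_(m, n) => - M).
Proof. by split=> [*|*]; rewrite ?opprD// scalerN. Qed.

Lemma rlin_lsubmx m n k : rlin (fun M : 'M[C]_(m, n + k) => lsubmx M).
Proof. by split=> [*|*]; apply/matrixP => i j; rewrite !mxE. Qed.

Lemma rlin_rsubmx m n k : rlin (fun M : 'M[C]_(m, n + k) => rsubmx M).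
Proof. by split=> [*|*]; apply/matrixP => i j; rewrite !mxE. Qed.

Section Cint.
Variables (m n : nat).
Implicit Types (F G : R -> 'M[C]_(m, n)).

Lemma cintegrableD a b F G : cintegrable a b F -> cintegrable a b G ->
  cintegrable a b (fun t => F t + G t).
Proof.
move=> /cintegrableP hF /cintegrableP hG; apply/cintegrableP => e i j.
by under [_ \o _]funext do rewrite /= mxE riD; apply: igD.
Qed.

Lemma cintegrableN a b F : cintegrable a b F -> cintegrable a b (fun t => - F t).
Proof. exact/cintegrable_rlin/rlin_opp. Qed.

Lemma cintegrableB a b F G : cintegrable a b F -> cintegrable a b G ->
  cintegrable a b (fun t => F t - G t).
Proof. by move=> hF hG; apply: cintegrableD => //; exact: cintegrableN. Qed.

Lemma cintD a b F G : cintegrable a b F -> cintegrable a b G ->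
  cint a b (fun t => F t + G t) = cint a b F + cint a b G.
Proof.
move=> /cintegrableP hF /cintegrableP hG; apply/matrixP => i j; apply: ri_inj => e.
rewrite [X in _ = ri e X]mxE riD !ri_cint -RintegralD//.
by under eq_Rintegral do rewrite mxE riD.
Qed.

Lemma cintN a b F : cintegrable a b F -> cint a b (fun t => - F t) = - cint a b F.
Proof. exact/cint_rlin/rlin_opp. Qed.

Lemma cintB a b F G : cintegrable a b F -> cintegrable a b G ->
  cint a b (fun t => F t - G t) = cint a b F - cint a b G.
Proof. by move=> hF hG; rewrite cintD ?cintN//; exact: cintegrableN. Qed.

Lemma cint_eq a b F G : (forall t, Icc a b t -> F t = G t) -> cint a b F = cint a b G.
Proof.
move=> h; apply/matrixP => i j; apply: ri_inj => e; rewrite !ri_cint.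
by apply: Ig_eq => t /h ->.
Qed.

Lemma cintegrable_eq a b F G : (forall t, Icc a b t -> F t = G t) ->
  cintegrable a b F -> cintegrable a b G.
Proof.
move=> h /cintegrableP hF; apply/cintegrableP => e i j.
by apply: ig_eq (hF e i j) => t /h ->.
Qed.

Lemma cintegrable_sub a b c d F : a <= c -> d <= b -> cintegrable a b F -> cintegrable c d F.
Proof.
move=> ac db /cintegrableP hF; apply/cintegrableP => e i j; exact: ig_sub (hF e i j).
Qed.

Lemma cint_pt a F : cint a a F = 0.
Proof. by apply/matrixP => i j; apply: ri_inj => e; rewrite ri_cint Ig_pt mxE ri0. Qed.

Lemma cint_chasles a b c F : a <= b -> b <= c -> cintegrable a c F ->
  cint a c F = cint a b F + cint b c F.
Proof.
move=> ab bc /cintegrableP h; apply/matrixP => i j; apply: ri_inj => e.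
by rewrite [X in _ = ri e X]mxE riD !ri_cint (Ig_chasles ab bc).
Qed.

Lemma cint_eq_oc a b F G : cintegrable a b F -> cintegrable a b G ->
  (forall t, a < t <= b -> F t = G t) -> cint a b F = cint a b G.
Proof.
move=> /cintegrableP hF /cintegrableP hG h; apply/matrixP => i j; apply: ri_inj => e.
by rewrite !ri_cint; apply: Ig_eq_oc => // t /h ->.
Qed.

Lemma cint_eq_co a b F G : cintegrable a b F -> cintegrable a b G ->
  (forall t, a <= t < b -> F t = G t) -> cint a b F = cint a b G.
Proof.
move=> /cintegrableP hF /cintegrableP hG h; apply/matrixP => i j; apply: ri_inj => e.
by rewrite !ri_cint; apply: Ig_eq_co => // t /h ->.
Qed.

Lemma cintegrable_meas a b F : cintegrable a b F -> mxmeas (Icc a b) F.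
Proof. by move=> /cintegrableP h e i j; exact: ig_meas. Qed.

Lemma cintegrable_nrm a b F : cintegrable a b F -> ig a b (fun t => nrm (F t)).
Proof.
move=> /cintegrableP h.
by apply: ig_sum => i; apply: ig_sum => j; apply: igD; apply: ig_abs.
Qed.

Lemma mxmeas_nrm (d : measure_display) (T : measurableType d) (D : set T)
    (F : T -> 'M[C]_(m, n)) : mxmeas D F -> measurable_fun D (fun t => nrm (F t)).
Proof.
move=> h; apply: measurable_sum => i; apply: measurable_sum => j.
by apply: measurable_funD; apply: measurableT_comp => //; exact: h.
Qed.

Lemma cintegrable_dom a b F g : mxmeas (Icc a b) F ->
  (forall t, Icc a b t -> nrm (F t) <= g t) -> ig a b g -> cintegrable a b F.
Proof.
move=> mF Fg hg; apply/cintegrableP => e i j; apply: ig_dom hg => //.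
by move=> t /Fg; apply: le_trans; exact: ri_le_nrm.
Qed.

Lemma cintegrable_bdd a b F c : mxmeas (Icc a b) F ->
  (forall t, Icc a b t -> nrm (F t) <= c) -> cintegrable a b F.
Proof. by move=> mF Fc; apply: (cintegrable_dom mF Fc); exact: ig_cst. Qed.

Lemma nrm_cint a b F : cintegrable a b F -> nrm (cint a b F) <= Ig a b (fun t => nrm (F t)).
Proof.
move=> /cintegrableP h; rewrite /nrm Ig_sum => [|i]; last first.
  by apply: ig_sum => j; apply: igD; apply: ig_abs.
apply: ler_sum => i _; rewrite Ig_sum => [|j]; last by apply: igD; apply: ig_abs.
apply: ler_sum => j _; rewrite /nc RintegralD//; try exact: ig_abs.
by rewrite !ri_cint lerD// Ig_abs.
Qed.

Lemma mxmeas_cst (d : measure_display) (T : measurableType d) (D : set T)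
  (A : 'M[C]_(m, n)) : mxmeas D (fun=> A).
Proof. by move=> e i j; exact: measurable_cst. Qed.

Lemma cintegrable_cst a b (A : 'M[C]_(m, n)) : cintegrable a b (fun=> A).
Proof. by apply/cintegrableP => e i j; exact: ig_cst. Qed.

Lemma cint_cst a b (A : 'M[C]_(m, n)) : a <= b -> cint a b (fun=> A) = Complex (b - a) 0 *: A.
Proof.
move=> ab; apply/matrixP => i j; apply: ri_inj => e.
by rewrite ri_cint Ig_cst// [X in _ = ri e X]mxE ri_scale mulrC.
Qed.

Lemma mxmeasD (d : measure_display) (T : measurableType d) (D : set T)
    (F G : T -> 'M[C]_(m, n)) : mxmeas D F -> mxmeas D G -> mxmeas D (fun t => F t + G t).
Proof.
move=> hF hG e i j; under [X in measurable_fun _ X]funext do rewrite mxE riD.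
by apply: measurable_funD; [exact: hF|exact: hG].
Qed.

Lemma mxmeas_if (d : measure_display) (T : measurableType d) (q : T -> bool)
    (F G : T -> 'M[C]_(m, n)) : measurable_fun setT q ->
  mxmeas setT F -> mxmeas setT G -> mxmeas setT (fun t => if q t then F t else G t).
Proof.
move=> mq hF hG e i j.
rewrite (_ : (fun t => _) = fun t => if q t then ri e (F t i j) else ri e (G t i j)).
  by apply: measurable_fun_ifT; [exact: mq|exact: hF|exact: hG].
by apply/funext => t; case: ifP.
Qed.

Lemma mxmeas_comp (d d' : measure_display) (T : measurableType d) (T' : measurableType d')
    (g : T -> T') (F : T' -> 'M[C]_(m, n)) : measurable_fun setT g ->
  mxmeas setT F -> mxmeas setT (fun t => F (g t)).
Proof. by move=> mg hF e i j; exact: (measurableT_comp (hF e i j) mg). Qed.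

Lemma mxmeas_cint (d : measure_display) (Z : measurableType d)
    (H : Z * R -> 'M[C]_(m, n)) (a b : Z -> R) :
  mxmeas setT H -> measurable_fun setT a -> measurable_fun setT b ->
  mxmeas setT (fun z => cint (a z) (b z) (fun t => H (z, t))).
Proof.
move=> mH ma mb e i j.
under [X in measurable_fun _ X]funext do rewrite ri_cint.
by apply: (@measurable_Ig _ _ _ (fun w => ri e (H w i j))) => //; exact: mH.
Qed.

Lemma cint_affine s c0 a b c d F : s != 0 ->
  mxmeas setT F -> (forall t, Icc a b t <-> Icc c d (c0 + s * t)) ->
  cintegrable c d F ->
  cintegrable a b (fun t => F (c0 + s * t)) /\
  cint c d F = Complex `|s| 0 *: cint a b (fun t => F (c0 + s * t)).
Proof.
move=> s0 mF hD /cintegrableP hF.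
have h e i j := @integral_affine R s c0 s0 a b c d _ (mF e i j) hD (hF e i j).
split; first by apply/cintegrableP => e i j; have [] := h e i j.
apply/matrixP => i j; apply: ri_inj => e; rewrite [X in _ = ri e X]mxE ri_scale !ri_cint.
by have [] := h e i j.
Qed.

Lemma cint_Fubini (H : R * R -> 'M[C]_(m, n)) (a b : R) (c : R -> R) :
  mxmeas setT H -> ig a b c ->
  (forall y, Icc a b y -> cintegrable y b (fun t => H (t, y)) /\
     Ig y b (fun t => nrm (H (t, y))) <= c y) ->
  (forall y, Icc a b y -> cintegrable a y (fun t => H (y, t))) ->
  [/\ cintegrable a b (fun t => cint t b (fun y => H (y, t))),
      cintegrable a b (fun y => cint a y (fun t => H (y, t))) &
      cint a b (fun t => cint t b (fun y => H (y, t))) =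
      cint a b (fun y => cint a y (fun t => H (y, t)))].
Proof.
move=> mH ic h1 h2.
have h e i j : [/\ ig a b (fun t => Ig t b (fun y => ri e (H (y, t) i j))),
      ig a b (fun y => Ig a y (fun t => ri e (H (y, t) i j))) &
      Ig a b (fun t => Ig t b (fun y => ri e (H (y, t) i j))) =
      Ig a b (fun y => Ig a y (fun t => ri e (H (y, t) i j)))].
  apply: (@Fubini_triangle _ (fun w => ri e (H w i j)) a b c).
  - exact: mH.
  - exact: ic.
  - move=> y yX; have [hi hc] := h1 _ yX; have /cintegrableP hi' := hi.
    split; first exact: hi'.
    apply: le_trans hc; apply: Ig_le => [||t _]; last exact: ri_le_nrm.
      by apply: ig_abs; exact: hi'.
    exact: cintegrable_nrm.
  - by move=> y yX; have /cintegrableP h := h2 _ yX; exact: h.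
split.
- apply/cintegrableP => e i j; under [_ \o _]funext do rewrite /= ri_cint.
  by have [] := h e i j.
- apply/cintegrableP => e i j; under [_ \o _]funext do rewrite /= ri_cint.
  by have [] := h e i j.
- apply/matrixP => i j; apply: ri_inj => e; rewrite !ri_cint.
  under eq_Rintegral do rewrite ri_cint.
  under [RHS]eq_Rintegral do rewrite ri_cint.
  by have [] := h e i j.
Qed.

End Cint.

Lemma mxmeasM (d : measure_display) (T : measurableType d) (D : set T) m n k
    (F : T -> 'M[C]_(m, n)) (G : T -> 'M[C]_(n, k)) :
  mxmeas D F -> mxmeas D G -> mxmeas D (fun t => F t *m G t).
Proof.
move=> hF hG e i j; under [X in measurable_fun _ X]funext do rewrite mxE ri_sum.
apply: measurable_sum => l; under [X in measurable_fun _ X]funext do rewrite riM.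
case: e; [apply: measurable_funD | apply: measurable_funB];
  apply: measurable_funM; solve [exact: hF | exact: hG].
Qed.

End ComplexMatrices.

(* As ssreflect's [done], but [discriminate] is only tried on boolean
   hypotheses: on equations between matrices it tries to evaluate both sides. *)
Ltac done :=
  trivial; hnf; intros; solve
   [ do ![solve [trivial | simple refine (@sym_equal _ _ _ _); trivial]
         | contradiction
         | match goal with H : _ = _ :> bool |- _ => discriminate H end
         | split]
   | match goal with H : is_true false |- _ => discriminate H end
   | match goal with H : ~ _ |- _ => solve [case H; trivial] end ].

(** * Primitives, the product rule and absolutely continuous matrix functions *)

Section AbsolutelyContinuous.
Variable R : realType.
Local Notation C := (R[i]).
Local Notation mu := (@lebesgue_measure R).
Local Notation ig a b f := (mu.-integrable (Icc a b) (EFin \o f)).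
Local Notation Ig a b f := (Rintegral mu (Icc a b) f).
Hint Resolve measurable_Icc : core.
Local Opaque cint cintegrable.

(** Parametric integrals and substitutions want functions measurable on the whole line, while the
    data are only controlled on an interval. *)
Definition patch0 m n (a b : R) (F : R -> 'M[C]_(m, n)) (t : R) :=
  if a <= t <= b then F t else 0.

Lemma patch0E m n a b (F : R -> 'M[C]_(m, n)) t : Icc a b t -> patch0 a b F t = F t.
Proof. by rewrite /patch0 => ->. Qed.

Lemma mxmeas_patch m n a b (F : R -> 'M[C]_(m, n)) :
  mxmeas (Icc a b) F -> mxmeas setT (patch0 a b F).
Proof.
move=> h e i j.
have := (measurable_restrictT (fun t => ri e (F t i j)) (measurable_Icc a b)).1 (h e i j).
congr measurable_fun; apply/funext => t; rewrite patchE /patch0.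
case: ifPn => [|]; first by rewrite inE => ->.
by rewrite notin_setE /Icc/= => /negP/negbTE ->; rewrite mxE ri0.
Qed.

Lemma mxmeas_sub (d : measure_display) (T : measurableType d) m n (D D' : set T)
    (F : T -> 'M[C]_(m, n)) : measurable D -> D' `<=` D -> mxmeas D F -> mxmeas D' F.
Proof. by move=> mD DD h e i j; apply: measurable_funS (h e i j). Qed.

Lemma mxmeas_ext (d : measure_display) (T : measurableType d) m n (D : set T)
    (F G : T -> 'M[C]_(m, n)) : (forall t, D t -> F t = G t) -> mxmeas D F -> mxmeas D G.
Proof.
move=> h hF e i j; apply: eq_measurable_fun (hF e i j) => t.
by rewrite inE => /h ->.
Qed.

Lemma mxmeas_prim m n a b (f : R -> 'M[C]_(m, n)) : cintegrable a b f ->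
  mxmeas (Icc a b) (fun x => cint a x f).
Proof.
move=> hf; have mf := mxmeas_patch (cintegrable_meas hf).
have : mxmeas setT (fun x : R => cint a x (patch0 a b f)).
  apply: (@mxmeas_cint _ _ _ _ _ (fun w : R * R => patch0 a b f w.2) (fun=> a) id) => //.
  by apply: (mxmeas_comp _ mf); exact: measurable_snd.
move/(mxmeas_sub measurableT (@subsetT _ (Icc a b))); apply: mxmeas_ext => x /andP[_ xb].
apply: cint_eq => t /andP[at_ tx]; apply: patch0E; apply/andP; split=> //.
exact: le_trans xb.
Qed.

Lemma nrm_cint_le m n a b x (f : R -> 'M[C]_(m, n)) : cintegrable a b f -> Icc a b x ->
  nrm (cint a x f) <= Ig a b (fun t => nrm (f t)).
Proof.
move=> hf /andP[ax xb]; have hfx : cintegrable a x f by exact: cintegrable_sub hf.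
apply: (le_trans (nrm_cint hfx)); apply: Ig_subset_le => //.
  exact: cintegrable_nrm.
by move=> t _; exact: nrm_ge0.
Qed.

Lemma cintegrableMl m n k a b (A : R -> 'M[C]_(k, m)) (f : R -> 'M[C]_(m, n)) c :
  mxmeas (Icc a b) A -> (forall t, Icc a b t -> nrm (A t) <= c) ->
  cintegrable a b f -> cintegrable a b (fun t => A t *m f t).
Proof.
move=> mA hA hf.
apply: (@cintegrable_dom _ _ _ _ _ _ (fun t => c * nrm (f t))).
- by apply: mxmeasM => //; exact: cintegrable_meas.
- by move=> t /hA h; rewrite (le_trans (nrmM _ _))// ler_wpM2r// nrm_ge0.
- by apply: igZ; exact: cintegrable_nrm.
Qed.

Lemma cintegrableMr m n k a b (A : R -> 'M[C]_(n, k)) (f : R -> 'M[C]_(m, n)) c :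
  mxmeas (Icc a b) A -> (forall t, Icc a b t -> nrm (A t) <= c) ->
  cintegrable a b f -> cintegrable a b (fun t => f t *m A t).
Proof.
move=> mA hA hf.
apply: (@cintegrable_dom _ _ _ _ _ _ (fun t => c * nrm (f t))).
- by apply: mxmeasM => //; exact: cintegrable_meas.
- by move=> t /hA h; rewrite mulrC (le_trans (nrmM _ _))// ler_wpM2l// nrm_ge0.
- by apply: igZ; exact: cintegrable_nrm.
Qed.

Lemma cint_mulmxl m n k a b (A : 'M[C]_(k, m)) (f : R -> 'M[C]_(m, n)) :
  cintegrable a b f -> cint a b (fun t => A *m f t) = A *m cint a b f.
Proof. exact/cint_rlin/rlin_mulmxl. Qed.

Lemma cint_mulmxr m n k a b (A : 'M[C]_(n, k)) (f : R -> 'M[C]_(m, n)) :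
  cintegrable a b f -> cint a b (fun t => f t *m A) = cint a b f *m A.
Proof. by move=> hf; rewrite (cint_rlin (rlin_mulmxr m A) hf). Qed.

Lemma cintegrable_mulmxl m n k a b (A : 'M[C]_(k, m)) (f : R -> 'M[C]_(m, n)) :
  cintegrable a b f -> cintegrable a b (fun t => A *m f t).
Proof. exact/cintegrable_rlin/rlin_mulmxl. Qed.

Lemma cintegrable_mulmxr m n k a b (A : 'M[C]_(n, k)) (f : R -> 'M[C]_(m, n)) :
  cintegrable a b f -> cintegrable a b (fun t => f t *m A).
Proof. by move=> hf; exact: (cintegrable_rlin (rlin_mulmxr m A) hf). Qed.

(** The product of the two integrals is the double integral of f(s) g(t) over a square, cut along
    the diagonal into two triangles; the order of integration is exchanged on one of them. *)
Lemma cint_mul_prim m n k a b (f : R -> 'M[C]_(m, n)) (g : R -> 'M[C]_(n, k)) :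
  a <= b -> cintegrable a b f -> cintegrable a b g ->
  cint a b f *m cint a b g =
  cint a b (fun t => f t *m cint a t g + cint a t f *m g t).
Proof.
move=> ab hf hg.
pose f' := patch0 a b f; pose g' := patch0 a b g.
have mf' : mxmeas setT f' by apply: mxmeas_patch; exact: cintegrable_meas.
have mg' : mxmeas setT g' by apply: mxmeas_patch; exact: cintegrable_meas.
have ef t : Icc a b t -> f' t = f t by exact: patch0E.
have eg t : Icc a b t -> g' t = g t by exact: patch0E.
have hf' : cintegrable a b f' by apply: cintegrable_eq hf => t /ef.
have hg' : cintegrable a b g' by apply: cintegrable_eq hg => t /eg.
pose P x := cint a x f'; pose Q x := cint a x g'.
have mP : mxmeas (Icc a b) P by exact: mxmeas_prim.
have mQ : mxmeas (Icc a b) Q by exact: mxmeas_prim.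
have bP := nrm_cint_le hf'; have bQ := nrm_cint_le hg'.
(* The integral of |f(t)| |g(y)| over t in [y, b] is at most the full integral of |f| times |g(y)|,
   an integrable function of y. *)
have [] := @cint_Fubini R m k (fun w => f' w.1 *m g' w.2) a b
   (fun y => Ig a b (fun t => nrm (f' t)) * nrm (g' y)).
- apply: mxmeasM; first by apply: (mxmeas_comp _ mf'); exact: measurable_fst.
  by apply: (mxmeas_comp _ mg'); exact: measurable_snd.
- by apply: igZ; exact: cintegrable_nrm.
- move=> y /andP[ay yb]; have hfy : cintegrable y b f' by exact: cintegrable_sub hf'.
  have hp : cintegrable y b (fun t => f' t *m g' y) by exact: cintegrable_mulmxr.
  split=> //; apply: (@le_trans _ _ (Ig y b (fun t => nrm (f' t) * nrm (g' y)))).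
    apply: Ig_le => [||t _]; [exact: cintegrable_nrm| |exact: nrmM].
    have := igZ (nrm (g' y)) (cintegrable_nrm hfy); apply: ig_eq => t _.
    by rewrite mulrC.
  rewrite RintegralZr//; last exact: cintegrable_nrm.
  rewrite ler_wpM2r ?nrm_ge0//; apply: Ig_subset_le => //.
    exact: cintegrable_nrm.
  by move=> t _; exact: nrm_ge0.
- move=> y /andP[ay yb] /=; apply: cintegrable_mulmxl; exact: cintegrable_sub hg'.
move=> i1 i2 /= e0.
(* Integrating f from t to b gives P b - P t. *)
have eL : cint a b (fun t => cint t b (fun y => f' y *m g' t)) =
    cint a b (fun t => (P b - P t) *m g' t).
  apply: cint_eq; move=> t /andP[at_ tb]; rewrite /= cint_mulmxr; last exact: cintegrable_sub hf'.
  by rewrite /P (cint_chasles at_ tb hf') addrC addKr.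
have eR : cint a b (fun y => cint a y (fun t => f' y *m g' t)) =
    cint a b (fun y => f' y *m Q y).
  by apply: cint_eq => t /andP[at_ tb]; rewrite cint_mulmxl//; exact: cintegrable_sub hg'.
have iPg : cintegrable a b (fun t => P t *m g' t) by exact: (cintegrableMl mP bP).
have ifQ : cintegrable a b (fun t => f' t *m Q t) by exact: (cintegrableMr mQ bQ).
have eM : cint a b (fun t => (P b - P t) *m g' t) =
    P b *m cint a b g' - cint a b (fun t => P t *m g' t).
  rewrite -(cint_mulmxl _ hg') -(cintB (cintegrable_mulmxl _ hg') iPg).
  by apply: cint_eq => t _; rewrite mulmxBl.
have e : P b *m cint a b g' = cint a b (fun t => f' t *m Q t) + cint a b (fun t => P t *m g' t).
  by apply/eqP; rewrite -subr_eq -eM -eL e0 eR.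
have ePb : P b = cint a b f by apply: cint_eq.
have eQb : cint a b g' = cint a b g by apply: cint_eq.
rewrite -ePb -eQb e -(cintD ifQ iPg).
apply: cint_eq => t tab; rewrite (ef _ tab) (eg _ tab); have /andP[at_ tb] := tab.
have -> : Q t = cint a t g.
  by apply: cint_eq => s /andP[as_ st]; apply: eg; rewrite /Icc/= as_ (le_trans st tb).
have -> // : P t = cint a t f.
by apply: cint_eq => s /andP[as_ st]; apply: ef; rewrite /Icc/= as_ (le_trans st tb).
Qed.

(** Integration by parts without derivatives: the initial values F a and G a split off, and the
    product of the two remaining primitives is [cint_mul_prim]. *)
Lemma product_rule m n k a b (F f : R -> 'M[C]_(m, n)) (G g : R -> 'M[C]_(n, k)) :
  a <= b -> cintegrable a b f -> cintegrable a b g ->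
  (forall x, Icc a b x -> F x = F a + cint a x f) ->
  (forall x, Icc a b x -> G x = G a + cint a x g) ->
  cintegrable a b (fun t => f t *m G t + F t *m g t) /\
  F b *m G b = F a *m G a + cint a b (fun t => f t *m G t + F t *m g t).
Proof.
move=> ab hf hg hF hG.
have mP := mxmeas_prim hf; have mQ := mxmeas_prim hg.
have bP := nrm_cint_le hf; have bQ := nrm_cint_le hg.
have iPg : cintegrable a b (fun t => cint a t f *m g t) by exact: (cintegrableMl mP bP).
have ifQ : cintegrable a b (fun t => f t *m cint a t g) by exact: (cintegrableMr mQ bQ).
have i1 : cintegrable a b (fun t => F a *m g t) by exact: cintegrable_mulmxl.
have i2 : cintegrable a b (fun t => f t *m G a) by exact: cintegrable_mulmxr.
have e t : Icc a b t -> (f t *m G a + F a *m g t) + (f t *m cint a t g + cint a t f *m g t) =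
    f t *m G t + F t *m g t.
  by move=> tab; rewrite (hF t)// (hG t)// mulmxDr mulmxDl addrACA.
split.
  by apply: (cintegrable_eq e); apply: cintegrableD; apply: cintegrableD.
rewrite -(cint_eq e) cintD; try exact: cintegrableD.
rewrite -cint_mul_prim// cintD// cint_mulmxl// cint_mulmxr//.
have bb : Icc a b b by rewrite /Icc/= ab lexx.
rewrite (hF b)// (hG b)// mulmxDr !mulmxDl -!addrA; congr (_ + _).
Qed.

(** Absolute continuity with the density as data. A differential equation is expressed by making the
    density an expression in F, so it holds in integrated form at every point of [0, r]. *)
Definition ac (r : R) m n (F f : R -> 'M[C]_(m, n)) : Prop :=
  cintegrable 0 r f /\ forall x, Icc 0 r x -> F x = F 0 + cint 0 x f.

Section Ac.
Variables (r : R) (m n : nat).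
Implicit Types (F f G g : R -> 'M[C]_(m, n)).

Lemma ac_meas F f : ac r F f -> mxmeas (Icc 0 r) F.
Proof.
move=> [hf hF]; apply: (@mxmeas_ext _ _ _ _ _ (fun x => F 0 + cint 0 x f)).
  by move=> t /hF.
by apply: mxmeasD; [exact: mxmeas_cst | exact: mxmeas_prim].
Qed.

Lemma ac_bdd F f : ac r F f -> exists c, forall x, Icc 0 r x -> nrm (F x) <= c.
Proof.
move=> [hf hF]; exists (nrm (F 0) + Ig 0 r (fun t => nrm (f t))) => x xr.
by rewrite hF// (le_trans (nrmD _ _))// lerD2l nrm_cint_le.
Qed.

Lemma ac_ext F f G g : (forall x, Icc 0 r x -> F x = G x) ->
  (forall x, Icc 0 r x -> f x = g x) -> ac r F f -> ac r G g.
Proof.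
move=> FG fg [hf hF]; split; first exact: cintegrable_eq hf.
move=> x xr; have /andP[x0 xr'] := xr.
have h0 : Icc 0 r 0 by rewrite /Icc/= lexx (le_trans x0 xr').
rewrite -!FG// hF//; congr (_ + _); apply: cint_eq => t /andP[t0 tx].
by apply: fg; rewrite /Icc/= t0 (le_trans tx xr').
Qed.

Lemma acD F f G g : ac r F f -> ac r G g -> ac r (fun x => F x + G x) (fun x => f x + g x).
Proof.
move=> [hf hF] [hg hG]; split; first exact: cintegrableD.
move=> x xr; have /andP[x0 xr'] := xr.
have hfx := cintegrable_sub (lexx _) xr' hf; have hgx := cintegrable_sub (lexx _) xr' hg.
by rewrite (cintD hfx hgx) (hF _ xr) (hG _ xr) addrACA.
Qed.

Lemma ac_cst (A : 'M[C]_(m, n)) : ac r (fun=> A) (fun=> 0).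
Proof.
split; first exact: cintegrable_cst.
by move=> x /andP[x0 _]; rewrite cint_cst// scaler0 addr0.
Qed.

Lemma ac_prim (A : 'M[C]_(m, n)) f : cintegrable 0 r f -> ac r (fun x => A + cint 0 x f) f.
Proof. by move=> hf; split=> // x _; rewrite cint_pt addr0. Qed.

Lemma ac_zero F f : ac r F f -> (forall x, Icc 0 r x -> f x = 0) ->
  forall x, Icc 0 r x -> F x = F 0.
Proof.
move=> [hf hF] f0 x xr; have /andP[x0 xr'] := xr.
rewrite hF// (@cint_eq _ _ _ _ _ _ (fun=> 0)); last first.
  by move=> t /andP[t0 tx]; apply: f0; rewrite /Icc/= t0 (le_trans tx xr').
by rewrite cint_cst// scaler0 addr0.
Qed.

End Ac.

Lemma ac_rlin r m n k l (L : 'M[C]_(m, n) -> 'M[C]_(k, l)) F f :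
  rlin L -> ac r F f -> ac r (fun x => L (F x)) (fun x => L (f x)).
Proof.
move=> hL [hf hF]; split; first exact: cintegrable_rlin.
move=> x xr; have /andP[x0 xr'] := xr.
have hfx := cintegrable_sub (lexx _) xr' hf.
by rewrite (cint_rlin hL hfx) (hF _ xr); case: hL => ->.
Qed.

Lemma acM r m n k (F f : R -> 'M[C]_(m, n)) (G g : R -> 'M[C]_(n, k)) :
  ac r F f -> ac r G g ->
  ac r (fun x => F x *m G x) (fun x => f x *m G x + F x *m g x).
Proof.
move=> aF aG; have [hf hF] := aF; have [hg hG] := aG.
have [c bF] := ac_bdd aF; have [c' bG] := ac_bdd aG.
have mF := ac_meas aF; have mG := ac_meas aG.
split.
  by apply: cintegrableD; [exact: (cintegrableMr mG bG) | exact: (cintegrableMl mF bF)].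
move=> x xr; have /andP[x0 xr'] := xr.
have [] := @product_rule m n k 0 x F f G g x0; last by [].
- exact: cintegrable_sub (lexx _) xr' _.
- exact: cintegrable_sub (lexx _) xr' _.
- by move=> t /andP[t0 tx]; apply: hF; rewrite /Icc/= t0 (le_trans tx xr').
- by move=> t /andP[t0 tx]; apply: hG; rewrite /Icc/= t0 (le_trans tx xr').
Qed.

End AbsolutelyContinuous.

(** * Square-integrable functions, the space H^1 and the class U *)

Section SquareIntegrable.
Variable R : realType.
Local Notation C := (R[i]).
Local Notation mu := (@lebesgue_measure R).
Local Notation ig a b f := (mu.-integrable (Icc a b) (EFin \o f)).
Local Notation Ig a b f := (Rintegral mu (Icc a b) f).
Hint Resolve measurable_Icc : core.
Local Opaque cint cintegrable.

Definition msq m n (M : 'M[C]_(m, n)) : R :=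
  \sum_i \sum_j ((complex.Re (M i j)) ^+ 2 + (complex.Im (M i j)) ^+ 2).

Lemma msq_flat m n (M : 'M[C]_(m, n)) :
  msq M = \sum_(q : 'I_m * 'I_n * bool) (ri q.2 (M q.1.1 q.1.2)) ^+ 2.
Proof.
rewrite /msq pair_bigA /= -(pair_bigA _ (fun (w : 'I_m * 'I_n) (e : bool) =>
     (ri e (M w.1 w.2)) ^+ 2))/=.
by apply: eq_bigr => w _; rewrite big_bool /= addrC.
Qed.

Lemma nrm_flat m n (M : 'M[C]_(m, n)) :
  nrm M = \sum_(q : 'I_m * 'I_n * bool) `|ri q.2 (M q.1.1 q.1.2)|.
Proof.
rewrite /nrm pair_bigA /= -(pair_bigA _ (fun (w : 'I_m * 'I_n) (e : bool) =>
     `|ri e (M w.1 w.2)|))/=.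
by apply: eq_bigr => w _; rewrite big_bool /= addrC.
Qed.

Lemma msq_le m n (M : 'M[C]_(m, n)) : msq M <= nrm M ^+ 2.
Proof.
rewrite msq_flat expr2 [X in _ <= _ * X]nrm_flat mulr_sumr; apply: ler_sum => q _.
by rewrite -real_normK ?num_real// expr2 ler_wpM2r// ri_le_nrm.
Qed.

(** Cauchy-Schwarz against the constant 1, from 2ab <= a^2 + b^2 summed over all pairs. *)
Lemma sqr_sum_le (T : finType) (a : T -> R) :
  (\sum_q a q) ^+ 2 <= #|T|%:R * \sum_q (a q) ^+ 2.
Proof.
rewrite expr2 mulr_suml; under eq_bigr do rewrite mulr_sumr.
pose x q := (a q) ^+ 2 / 2; pose S := \sum_q x q.
apply: (@le_trans _ _ (\sum_q (#|T|%:R * x q + S))).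
  apply: ler_sum => q _.
  have -> : #|T|%:R * x q + S = \sum_q' (x q + x q').
    by rewrite big_split /= mulr_natl sumr_const.
  apply: ler_sum => q' _; rewrite /x.
  have : 0 <= (a q - a q') ^+ 2 by exact: sqr_ge0.
  nra.
have -> : \sum_q (#|T|%:R * x q + S) = #|T|%:R * S + #|T|%:R * S.
  by rewrite big_split /= -mulr_sumr sumr_const -[S *+ _]mulr_natl.
have -> : \sum_q (a q) ^+ 2 = S + S.
  by rewrite /S -big_split /=; apply: eq_bigr => q _; rewrite /x; lra.
by rewrite mulrDr.
Qed.

(** The number of real coordinates of the matrix, which is the constant comparing the l^1 norm [nrm]
    with the Euclidean norm inside [L2norm]. *)
Definition msqK m n : R := (#|{: 'I_m * 'I_n * bool}|)%:R.

Lemma nrm_sqr_le m n (M : 'M[C]_(m, n)) : nrm M ^+ 2 <= msqK m n * msq M.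
Proof.
rewrite nrm_flat msq_flat; apply: (le_trans (sqr_sum_le _)).
by under eq_bigr do rewrite real_normK ?num_real//.
Qed.

Lemma L2P r m n (F : R -> 'M[C]_(m, n)) :
  L2 r F <-> mxmeas (Icc 0 r) F /\ ig 0 r (fun t => nrm (F t) ^+ 2).
Proof.
split=> [h|[mF iF] i j].
  have mF : mxmeas (Icc 0 r) F by move=> [] i j; have [? [? _]] := h i j.
  split=> //.
  apply: (@ig_dom _ _ _ _ (fun t => msqK m n * msq (F t))).
  - by apply: measurable_funX; exact: mxmeas_nrm.
  - by move=> t _; rewrite ger0_norm ?sqr_ge0// nrm_sqr_le.
  - apply: igZ; apply: ig_sum => i; apply: ig_sum => j.
    by have [_ [_ [h1 h2]]] := h i j; exact: igD.
have H e : ig 0 r (fun t => (ri e (F t i j)) ^+ 2).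
  apply: ig_dom iF; first by apply: measurable_funX; exact: mF.
  move=> t _; by rewrite ger0_norm ?sqr_ge0// -real_normK ?num_real// !expr2 ler_pM// ?ri_le_nrm.
by split; [exact: (mF false)|split; [exact: (mF true)|split; [exact: (H false)|exact: (H true)]]].
Qed.

Lemma L2_cintegrable r m n (F : R -> 'M[C]_(m, n)) : L2 r F -> cintegrable 0 r F.
Proof.
move=> /L2P[mF iF]; apply: (@cintegrable_dom _ _ _ _ _ _ (fun t => 1 + nrm (F t) ^+ 2)) => //.
  move=> t _; have := sqr_ge0 (nrm (F t) - 1); have := nrm_ge0 (F t); nra.
by apply: igD => //; exact: ig_cst.
Qed.

(** Cauchy-Schwarz from the nonnegative integral of (|F| - c)^2, where c is the mean A / r of
    |F|. *)
Lemma L2_L1 r m n (F : R -> 'M[C]_(m, n)) : 0 <= r -> L2 r F ->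
  (Ig 0 r (fun t => nrm (F t))) ^+ 2 <= r * Ig 0 r (fun t => nrm (F t) ^+ 2).
Proof.
rewrite le_eqVlt => /predU1P[<- _|r0 LF]; first by rewrite !Ig_pt expr0n mul0r.
have i1 := cintegrable_nrm (L2_cintegrable LF).
have [_ i2] := (L2P _ _).1 LF.
set A := Ig 0 r _; set B := Ig 0 r _.
pose c := A / r.
have i3 := igZ (2 * c) i1.
have : 0 <= Ig 0 r (fun t => (nrm (F t) - c) ^+ 2) by apply: Ig_ge0 => t _; exact: sqr_ge0.
have -> : Ig 0 r (fun t => (nrm (F t) - c) ^+ 2) = B - 2 * c * A + c ^+ 2 * r.
  rewrite (@Ig_eq _ _ _ _ (fun t => (nrm (F t) ^+ 2 - 2 * c * nrm (F t)) + c ^+ 2)); last first.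
    by move=> t _; ring.
  rewrite RintegralD//; [|exact: (igB i2 i3)|exact: ig_cst].
  by rewrite RintegralB// RintegralZl// Ig_cst ?subr0// ltW.
have -> : B - 2 * c * A + c ^+ 2 * r = B - A ^+ 2 / r by rewrite /c; field; rewrite gt_eqF.
by rewrite subr_ge0 ler_pdivrMr// mulrC.
Qed.

(** A Volterra operator of the second kind with bounded kernel satisfies such a pointwise estimate,
    so this one bound serves both E and its inverse. The constant comes from (s + t)^2 <= 2 s^2 + 2
    t^2, from [L2_L1] and from passing between the two matrix norms. *)
Lemma L2_bounded_by r m n k l (F : R -> 'M[C]_(m, n)) (G : R -> 'M[C]_(k, l)) c1 c2 :
  0 <= r -> L2 r F -> mxmeas (Icc 0 r) G ->
  (forall t, Icc 0 r t -> nrm (G t) <= c1 * nrm (F t) + c2 * Ig 0 r (fun s => nrm (F s))) ->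
  L2 r G /\
  L2norm r G <= Num.sqrt ((2 * c1 ^+ 2 + 2 * c2 ^+ 2 * r ^+ 2) * msqK m n) * L2norm r F.
Proof.
move=> r0 LF mG h; set A := Ig 0 r _ in h.
have [mF i2] := (L2P _ _).1 LF.
have h2 t : Icc 0 r t -> nrm (G t) ^+ 2 <= 2 * c1 ^+ 2 * nrm (F t) ^+ 2 + 2 * c2 ^+ 2 * A ^+ 2.
  move=> /h ht; have g0 := nrm_ge0 (G t).
  have : nrm (G t) ^+ 2 <= (c1 * nrm (F t) + c2 * A) ^+ 2.
    by rewrite ler_sqr ?nnegrE// (le_trans g0).
  have := sqr_ge0 (c1 * nrm (F t) - c2 * A); nra.
have i3 : ig 0 r (fun t => 2 * c1 ^+ 2 * nrm (F t) ^+ 2 + 2 * c2 ^+ 2 * A ^+ 2).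
  by apply: igD; [exact: igZ|exact: ig_cst].
have iG : ig 0 r (fun t => nrm (G t) ^+ 2).
  apply: ig_dom i3; first by apply: measurable_funX; exact: mxmeas_nrm.
  by move=> t tr; rewrite ger0_norm ?sqr_ge0//; exact: h2.
have LG : L2 r G by apply/L2P.
split=> //.
have msqi q1 q2 (H : R -> 'M[C]_(q1, q2)) : L2 r H -> ig 0 r (fun t => msq (H t)).
  move=> LH; apply: ig_sum => i; apply: ig_sum => j.
  by have [_ [_ [H1 H2]]] := LH i j; exact: igD.
have D0 : 0 <= 2 * c1 ^+ 2 + 2 * c2 ^+ 2 * r ^+ 2.
  have := sqr_ge0 c1; have := sqr_ge0 (c2 * r); rewrite exprMn; lra.
have K0 : 0 <= (2 * c1 ^+ 2 + 2 * c2 ^+ 2 * r ^+ 2) * msqK m n by rewrite mulr_ge0// ler0n.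
rewrite /L2norm -sqrtrM// ler_wsqrtr//.
apply: (@le_trans _ _ (Ig 0 r (fun t => nrm (G t) ^+ 2))).
  by apply: Ig_le => //; [exact: msqi|move=> t _; exact: msq_le].
apply: (le_trans (Ig_le iG i3 h2)).
rewrite RintegralD//; [|exact: igZ|exact: ig_cst].
rewrite RintegralZl// Ig_cst// subr0.
have hA := L2_L1 r0 LF; rewrite -/A in hA.
have hB : Ig 0 r (fun t => nrm (F t) ^+ 2) <= msqK m n * Ig 0 r (fun t => msq (F t)).
  rewrite -RintegralZl//; last exact: msqi.
  by apply: Ig_le => //; [apply: igZ; exact: msqi|move=> t _; exact: nrm_sqr_le].
pose B := Ig 0 r (fun t => nrm (F t) ^+ 2); rewrite -/B in hA hB *.
apply: (@le_trans _ _ ((2 * c1 ^+ 2 + 2 * c2 ^+ 2 * r ^+ 2) * B)); last first.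
  rewrite -[leRHS]mulrA; apply: ler_wpM2l => //; exact: hB.
rewrite [leRHS]mulrDl lerD2l.
have := ler_wpM2l (mulr_ge0 (sqr_ge0 c2) r0) hA.
by rewrite !expr2; lra.
Qed.

Lemma L2Ml r m n k (A : R -> 'M[C]_(k, m)) (f : R -> 'M[C]_(m, n)) c :
  mxmeas (Icc 0 r) A -> (forall t, Icc 0 r t -> nrm (A t) <= c) -> L2 r f ->
  L2 r (fun t => A t *m f t).
Proof.
move=> mA hA /L2P[mf i2]; apply/L2P; split; first exact: mxmeasM.
apply: (@ig_dom _ _ _ _ (fun t => c ^+ 2 * nrm (f t) ^+ 2)); last exact: igZ.
  by apply: measurable_funX; apply: mxmeas_nrm; exact: mxmeasM.
move=> t /hA h; rewrite ger0_norm ?sqr_ge0// -exprMn.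
have c0 := le_trans (nrm_ge0 _) h.
rewrite ler_sqr ?nnegrE ?nrm_ge0// ?mulr_ge0 ?nrm_ge0//.
by rewrite (le_trans (nrmM _ _))// ler_wpM2r// nrm_ge0.
Qed.

Lemma L2Mr r m n k (A : R -> 'M[C]_(n, k)) (f : R -> 'M[C]_(m, n)) c :
  mxmeas (Icc 0 r) A -> (forall t, Icc 0 r t -> nrm (A t) <= c) -> L2 r f ->
  L2 r (fun t => f t *m A t).
Proof.
move=> mA hA /L2P[mf i2]; apply/L2P; split; first exact: mxmeasM.
apply: (@ig_dom _ _ _ _ (fun t => c ^+ 2 * nrm (f t) ^+ 2)); last exact: igZ.
  by apply: measurable_funX; apply: mxmeas_nrm; exact: mxmeasM.
move=> t /hA h; rewrite ger0_norm ?sqr_ge0// -exprMn.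
have c0 := le_trans (nrm_ge0 _) h.
rewrite ler_sqr ?nnegrE ?nrm_ge0// ?mulr_ge0 ?nrm_ge0//.
by rewrite mulrC (le_trans (nrmM _ _))// ler_wpM2l// nrm_ge0.
Qed.

Lemma L2D r m n (f g : R -> 'M[C]_(m, n)) : L2 r f -> L2 r g -> L2 r (fun t => f t + g t).
Proof.
move=> /L2P[mf i2] /L2P[mg j2]; apply/L2P; split; first exact: mxmeasD.
apply: (@ig_dom _ _ _ _ (fun t => 2 * nrm (f t) ^+ 2 + 2 * nrm (g t) ^+ 2)).
- by apply: measurable_funX; apply: mxmeas_nrm; exact: mxmeasD.
- move=> t _; rewrite ger0_norm ?sqr_ge0//.
  have h := nrmD (f t) (g t); have h1 := nrm_ge0 (f t + g t).
  have : nrm (f t + g t) ^+ 2 <= (nrm (f t) + nrm (g t)) ^+ 2.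
    by rewrite ler_sqr ?nnegrE// addr_ge0 ?nrm_ge0.
  have := sqr_ge0 (nrm (f t) - nrm (g t)); nra.
- by apply: igD; exact: igZ.
Qed.

Lemma L2_bdd r m n (f : R -> 'M[C]_(m, n)) c : mxmeas (Icc 0 r) f ->
  (forall t, Icc 0 r t -> nrm (f t) <= c) -> L2 r f.
Proof.
move=> mf hf; apply/L2P; split=> //; apply: (@ig_bdd _ _ _ _ (c ^+ 2)).
  by apply: measurable_funX; exact: mxmeas_nrm.
move=> t /hf h; rewrite ger0_norm ?sqr_ge0//.
by rewrite ler_sqr ?nnegrE ?nrm_ge0// (le_trans (nrm_ge0 _) h).
Qed.

Lemma L2_ext r m n (f g : R -> 'M[C]_(m, n)) :
  (forall t, Icc 0 r t -> f t = g t) -> L2 r f -> L2 r g.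
Proof.
move=> e /L2P[mf i2]; apply/L2P; split; first exact: mxmeas_ext mf.
by apply: ig_eq i2 => t /e ->.
Qed.

Lemma L2Z r m n (z : C) (f : R -> 'M[C]_(m, n)) : L2 r f -> L2 r (fun t => z *: f t).
Proof.
move=> Lf; apply: (@L2_ext _ _ _ (fun t => z%:M *m f t)).
  by move=> t _; rewrite mul_scalar_mx.
by apply: (@L2Ml _ _ _ _ (fun=> z%:M) _ (nrm (z%:M : 'M[C]_m))) => //; exact: mxmeas_cst.
Qed.

Lemma ac_L2 r m n (F f : R -> 'M[C]_(m, n)) : ac r F f -> L2 r F.
Proof. by move=> aF; have [c h] := ac_bdd aF; exact: L2_bdd (ac_meas aF) h. Qed.

(** The Sobolev space W^{1,2}(0, r). It is closed under products because its members are bounded. *)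
Definition h1 (r : R) m n (F : R -> 'M[C]_(m, n)) : Prop :=
  exists2 f, L2 r f & ac r F f.

Lemma h1D r m n (F G : R -> 'M[C]_(m, n)) : h1 r F -> h1 r G -> h1 r (fun x => F x + G x).
Proof.
move=> [f Lf aF] [g Lg aG]; exists (fun x => f x + g x); [exact: L2D|exact: acD].
Qed.

Lemma h1M r m n k (F : R -> 'M[C]_(m, n)) (G : R -> 'M[C]_(n, k)) :
  h1 r F -> h1 r G -> h1 r (fun x => F x *m G x).
Proof.
move=> [f Lf aF] [g Lg aG]; exists (fun x => f x *m G x + F x *m g x); last exact: acM.
have [c bF] := ac_bdd aF; have [c' bG] := ac_bdd aG.
by apply: L2D; [exact: (L2Mr (ac_meas aG) bG)|exact: (L2Ml (ac_meas aF) bF)].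
Qed.

Lemma h1_cst r m n (A : 'M[C]_(m, n)) : h1 r (fun=> A).
Proof.
exists (fun=> 0); last exact: ac_cst.
by apply: (L2_bdd (c := 0)); [exact: mxmeas_cst|move=> t _; rewrite nrm0].
Qed.

Lemma h1_ext r m n (F G : R -> 'M[C]_(m, n)) :
  (forall t, Icc 0 r t -> F t = G t) -> h1 r F -> h1 r G.
Proof. by move=> e [f Lf aF]; exists f => //; exact: ac_ext aF. Qed.

Lemma ac_h1 r m n (F f : R -> 'M[C]_(m, n)) : ac r F f -> L2 r f -> h1 r F.
Proof. by move=> aF Lf; exists f. Qed.

Lemma h1_L2 r m n (F : R -> 'M[C]_(m, n)) : h1 r F -> L2 r F.
Proof. by move=> [f _ aF]; exact: ac_L2 aF. Qed.

Lemma h1_star r m n (F : R -> 'M[C]_(m, n)) : h1 r F -> h1 r (fun x => mxstar (F x)).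
Proof.
move=> [f Lf aF]; exists (fun x => mxstar (f x)); last exact: (ac_rlin (@rlin_star R m n) aF).
have /L2P[mf i2] := Lf; apply/L2P; split; first exact: (mxmeas_rlin (@rlin_star R m n) mf).
have e (M : 'M[C]_(m, n)) : nrm (mxstar M) = nrm M.
  rewrite /nrm exchange_big; apply: eq_bigr => i _; apply: eq_bigr => j _.
  by rewrite !mxE /nc /ri; case: (M i j) => a b /=; rewrite normrN.
by under [_ \o _]funext do rewrite /= e.
Qed.

Lemma ac_continuous r m n (F f : R -> 'M[C]_(m, n)) e i j : 0 <= r -> ac r F f ->
  {within `[0, r], continuous (fun x => ri e (F x i j))}.
Proof.
move=> r0 [/cintegrableP hf hF].
have h : {within `[0, r], continuous (fun x => ri e (F 0 i j) + Ig 0 x (fun t => ri e (f t i j)))}.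
  by move=> x; apply: cvgD; [exact: cvg_cst|exact: (Ig_continuous r0 (hf e i j))].
apply: subspace_eq_continuous h.
move=> x; rewrite -IccE inE => xr.
by rewrite /from_subspace/= (hF x xr) [X in _ = ri e X]mxE riD ri_cint.
Qed.

(** The bridge from the class U to integral equations. The derivative of a member of U is itself a
    primitive, hence continuous, so the fundamental theorem applies in both directions at every
    point. *)
Lemma U_with_ac r m n (G dG : R -> 'M[C]_(m, n)) : 0 <= r ->
  U_with r G dG <-> ac r G dG /\ h1 r dG.
Proof.
move=> r0; split.
  move=> [hd [G2 [LG2 hG2]]].
  have adG : ac r dG G2 by split=> //; exact: L2_cintegrable.
  split; last by exists G2.
  split; first exact/L2_cintegrable/(ac_L2 adG).
  move=> x xr; apply/matrixP => i j; apply: ri_inj => e.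
  rewrite [X in _ = ri e X]mxE riD ri_cint.
  apply: (@rderiv_integral R r (fun x => ri e (G x i j)) (fun x => ri e (dG x i j))) => //.
    by move=> y /hd/(_ i j)[]; case: e.
  exact: ac_continuous adG.
move=> [[hG aG] [G2 LG2 adG]]; split; last by exists G2; split=> //; case: adG.
have /cintegrableP hG' := hG.
have H e x i j : Icc 0 r x -> rderiv_within r (fun y => ri e (G y i j)) x (ri e (dG x i j)).
  move=> xr; have := Ig_rderiv (hG' e i j) (@ac_continuous r _ _ dG G2 e i j r0 adG) xr.
  rewrite /rderiv_within; apply: cvg_trans; apply: near_eq_cvg.
  apply/nbhs_ballP; exists 1 => //= y _ [yr _].
  by rewrite (aG y yr) (aG x xr) !mxE !riD -!ri_cint !mxE opprD addrACA subrr add0r.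
by move=> x xr i j; split; [exact: (H false)|exact: (H true)].
Qed.

End SquareIntegrable.

(** * Fixed points by Picard iteration in a weighted norm *)

Section Picard.
Variable R : realType.
Local Notation C := (R[i]).
Hint Resolve measurable_Icc : core.
Local Opaque cint cintegrable.

Lemma le_halves_eq0 (A B : R) : (forall k, A <= B / 2 ^+ k) -> A <= 0.
Proof.
move=> h; rewrite leNgt; apply/negP => A0.
have [k hk] : exists k : nat, B / A < k%:R.
  exists (Num.truncn (`|B / A|)).+1.
  by rewrite (le_lt_trans (ler_norm _))// truncnS_gt.
have := h k; apply/negP; rewrite -ltNge ltr_pdivrMr ?exprn_gt0//.
move: hk; rewrite ltr_pdivrMr// mulrC => /lt_le_trans; apply.
rewrite ler_pM2l//; have := ltn_expl k (ltnSn 1); rewrite -(ltr_nat R) natrX.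
exact: ltW.
Qed.

(** The intervals with centre [a k] and radius 2 d / 2^k, the sum of the steps still to come, are
    nested; the limit is the supremum of their left endpoints. *)
Lemma halves_limit (a : nat -> R) (d : R) :
  (forall k, `|a k.+1 - a k| <= d / 2 ^+ k) ->
  exists l, forall k, `|l - a k| <= 2 * d / 2 ^+ k.
Proof.
move=> h.
pose e k := 2 * d / 2 ^+ k.
have eS k : e k.+1 = e k - d / 2 ^+ k.
  rewrite /e exprS; field; rewrite expf_neq0//.
have up k j : a (k + j)%N + e (k + j)%N <= a k + e k.
  elim: j => [|j IH]; first by rewrite addn0.
  apply: le_trans IH; rewrite addnS eS.
  by have := ler_normlW (h (k + j)%N); lra.
have dn k j : a k - e k <= a (k + j)%N - e (k + j)%N.
  elim: j => [|j IH]; first by rewrite addn0.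
  apply: (le_trans IH); rewrite addnS eS.
  by have := lerNnormlW (h (k + j)%N); lra.
have e0 k : 0 <= e k.
  rewrite /e -mulrA mulr_ge0//; exact: le_trans (normr_ge0 _) (h k).
have bd k j : a j - e j <= a k + e k.
  have h1 := dn j k; have h2 := up k j; rewrite addnC in h1.
  by have := e0 (k + j)%N; lra.
pose A := range (fun k => a k - e k).
have nA : A !=set0 by exists (a 0%N - e 0%N); exists 0%N.
have ub k : ubound A (a k + e k) by move=> _ [j _ <-]; exact: bd.
exists (sup A) => k; rewrite -/(e k) ler_distl; apply/andP; split.
  by apply: ub_le_sup; [exists (a 0%N + e 0%N); exact: ub|exists k].
exact: sup_le_ub.
Qed.

Lemma matrix_limit m n (G : nat -> 'M[C]_(m, n)) (d : R) :
  (forall k, nrm (G k.+1 - G k) <= d / 2 ^+ k) ->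
  exists L : 'M[C]_(m, n), forall k, nrm (L - G k) <= msqK R m n * (2 * d) / 2 ^+ k.
Proof.
move=> h.
have H e i j : exists l, forall k, `|l - ri e (G k i j)| <= 2 * d / 2 ^+ k.
  apply: halves_limit => k; apply: le_trans (h k).
  by apply: le_trans (ri_le_nrm _ e i j); rewrite !mxE riD riN.
pose l e i j := sval (cid (H e i j)).
have lP e i j k : `|l e i j - ri e (G k i j)| <= 2 * d / 2 ^+ k.
  by rewrite /l; case: cid => /=.
exists (\matrix_(i, j) Complex (l false i j) (l true i j)) => k.
rewrite nrm_flat; apply: (@le_trans _ _ (\sum_(q : 'I_m * 'I_n * bool) (2 * d / 2 ^+ k))).
  apply: ler_sum => q _; apply: le_trans (lP q.2 q.1.1 q.1.2 k).
  by rewrite !mxE riD riN; case: q.2.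
by rewrite sumr_const -[_ *+ #|_|]mulr_natl -[leRHS]mulrA.
Qed.

Section FixedPoint.
Variables (dd : measure_display) (X : measurableType dd) (m n : nat).
Variables (w : X -> R) (Phi : (X -> 'M[C]_(m, n)) -> (X -> 'M[C]_(m, n))).
Hypothesis w0 : forall x, 0 <= w x.

Definition wbm (g : X -> 'M[C]_(m, n)) :=
  mxmeas setT g /\ exists d, forall x, nrm (g x) <= d * w x.

Hypothesis PhiS : forall g, wbm g -> wbm (Phi g).
Hypothesis Phi_contract : forall g h d, wbm g -> wbm h ->
  (forall x, nrm (g x - h x) <= d * w x) ->
  forall x, nrm (Phi g x - Phi h x) <= d / 2 * w x.

Lemma mxmeas_limit (G : nat -> X -> 'M[C]_(m, n)) (g : X -> 'M[C]_(m, n)) (d : X -> R) :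
  (forall k, mxmeas setT (G k)) ->
  (forall x k, nrm (g x - G k x) <= d x / 2 ^+ k) -> mxmeas setT g.
Proof.
move=> mG hG e i j.
apply/measurable_EFinP; apply: (emeasurable_fun_cvg (fun k x => (ri e (G k x i j))%:E)).
  by move=> k; apply/measurable_EFinP; exact: mG.
move=> x _; apply: cvg_EFin; first exact: nearW.
apply/cvgrPdist_le => eps eps0.
have [k hk] : exists k : nat, d x / eps < k%:R.
  exists (Num.truncn (`|d x / eps|)).+1.
  by rewrite (le_lt_trans (ler_norm _))// truncnS_gt.
exists k => // j' /= kj.
apply: (@le_trans _ _ (d x / 2 ^+ j')).
  by apply: le_trans (hG x j'); apply: le_trans (ri_le_nrm _ e i j); rewrite !mxE riD riN.
rewrite ler_pdivrMr ?exprn_gt0//; move: hk; rewrite ltr_pdivrMr// mulrC => /ltW/le_trans; apply.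
rewrite ler_pM2l//; apply: (@le_trans _ _ j'%:R); first by rewrite ler_nat.
by have := ltn_expl j' (ltnSn 1); rewrite -(ltr_nat R) natrX => /ltW.
Qed.

(** Banach's fixed point argument for a weighted sup norm, with the limit taken pointwise. The
    factor [msqK] is inherited from [matrix_limit], which takes limits coordinate by coordinate. *)
Lemma picard g0 c : wbm g0 -> (forall x, nrm (Phi g0 x - g0 x) <= c * w x) ->
  exists g, [/\ wbm g, forall x, Phi g x = g x &
    forall x, nrm (g x - g0 x) <= msqK R m n * (2 * c) * w x].
Proof.
move=> Sg0 hc.
pose G k := iter k Phi g0.
have SG k : wbm (G k) by elim: k => //= k; exact: PhiS.
have GG k : forall x, nrm (G k.+1 x - G k x) <= c / 2 ^+ k * w x.
  elim: k => [|k IH] x; first by rewrite expr0 divr1; exact: hc.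
  have := Phi_contract (SG k.+1) (SG k) IH x.
  by rewrite exprSr invfM mulrA.
have L x : exists L, forall k, nrm (L - G k x) <= msqK R m n * (2 * (c * w x)) / 2 ^+ k.
  by apply: matrix_limit => k; rewrite mulrAC; exact: GG.
pose g x := sval (cid (L x)).
have gP x k : nrm (g x - G k x) <= msqK R m n * (2 * c) / 2 ^+ k * w x.
  have -> : msqK R m n * (2 * c) / 2 ^+ k * w x = msqK R m n * (2 * (c * w x)) / 2 ^+ k.
    by rewrite mulrAC -!mulrA.
  by rewrite /g; case: cid => /= M.
have mg : mxmeas setT g.
  apply: (@mxmeas_limit G g (fun x => msqK R m n * (2 * c) * w x)).
    by move=> k; case: (SG k).
  by move=> x k; rewrite mulrAC; exact: gP.
have gP0 x : nrm (g x - g0 x) <= msqK R m n * (2 * c) * w x.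
  by have := gP x 0%N; rewrite expr0 divr1.
have Sg : wbm g.
  split=> //; have [_ [d hd]] := Sg0; exists (msqK R m n * (2 * c) + d) => x.
  by rewrite -[g x](subrK (g0 x)) (le_trans (nrmD _ _))// mulrDl lerD.
exists g; split=> // x.
apply/eqP; rewrite -subr_eq0; apply/eqP; apply: nrm0_eq0.
(* With B the constant below, [Phi g] and [g] are both within B / 2^(k+1) of the iterate k + 1, for
   every k. *)
apply: (@le_halves_eq0 _ (msqK R m n * (2 * c) * w x)) => k.
have h1 := Phi_contract Sg (SG k) (gP^~ k) x.
have h2 := gP x k.+1; rewrite nrmB in h2.
rewrite -[Phi g x](subrK (G k.+1 x)) -addrA (le_trans (nrmD _ _))//.
apply: (le_trans (lerD h1 h2)).
have k2 : (2 : R) ^+ k != 0 by rewrite expf_neq0.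
rewrite le_eqVlt; apply/orP; left; apply/eqP; rewrite exprS; field.
by rewrite k2.
Qed.

End FixedPoint.
End Picard.

(** * Volterra equations of the second kind with bounded kernel *)

Section Volterra.
Variable R : realType.
Local Notation C := (R[i]).
Local Notation mu := (@lebesgue_measure R).
Local Notation ig a b f := (mu.-integrable (Icc a b) (EFin \o f)).
Local Notation Ig a b f := (Rintegral mu (Icc a b) f).
Hint Resolve measurable_Icc : core.
Local Opaque cint cintegrable.

Lemma mxmeas_slice m n (K : R * R -> 'M[C]_(m, n)) x D :
  mxmeas setT K -> mxmeas D (fun t => K (x, t)).
Proof.
move=> mK; apply: (mxmeas_sub measurableT (@subsetT _ D)).
by apply: (mxmeas_comp _ mK); apply: measurable_fun_pair.
Qed.

Lemma mxmeas_col k l (H : R * R -> 'M[C]_(k, l)) (y : R) D :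
  mxmeas setT H -> mxmeas D (fun t => H (t, y)).
Proof.
move=> mH; apply: (mxmeas_sub measurableT (@subsetT _ D)).
by apply: (mxmeas_comp _ mH); apply: measurable_fun_pair.
Qed.

(** The rate 2 c + 1 is chosen so that c / (2 c + 1) <= 1/2, the contraction factor of the
    iteration, and so that it stays positive for c = 0. *)
Lemma Ig_weight_le m n a x (f : R -> 'M[C]_(m, n)) (c d : R) : 0 <= c ->
  mxmeas (Icc a x) f -> 0 <= d ->
  (forall t, Icc a x t -> nrm (f t) <= d * expR ((2 * c + 1) * t)) ->
  cintegrable a x f /\
  c * Ig a x (fun t => nrm (f t)) <= d / 2 * expR ((2 * c + 1) * x).
Proof.
move=> c0 mf d0 hf.
have la0 : 0 < 2 * c + 1 by lra.
have [ie le_e] := Ig_exp_le a x la0.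
have hi : cintegrable a x f by apply: (cintegrable_dom mf hf); exact: igZ.
split=> //.
have h1 : Ig a x (fun t => nrm (f t)) <= d * (expR ((2 * c + 1) * x) / (2 * c + 1)).
  apply: le_trans (ler_wpM2l d0 le_e); rewrite -RintegralZl//.
  by apply: Ig_le => //; [exact: cintegrable_nrm|exact: igZ].
apply: (le_trans (ler_wpM2l c0 h1)).
set W := expR _; set la := 2 * c + 1 in la0 *.
have -> : c * (d * (W / la)) = (c / la) * (d * W) by ring.
have -> : d / 2 * W = 2^-1 * (d * W) by ring.
apply: ler_wpM2r; first by rewrite mulr_ge0// expR_ge0.
by rewrite ler_pdivrMr// /la; lra.
Qed.

Variables (r : R) (p q : nat) (K : R * R -> 'M[C]_p) (c : R).
Hypothesis r0 : 0 <= r.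
Hypothesis mK : mxmeas setT K.
Hypothesis bK : forall z, nrm (K z) <= c.

Let c0 : 0 <= c. Proof. exact: le_trans (nrm_ge0 _) (bK (0, 0)). Qed.
Let la : R := 2 * c + 1.
Let la0 : 0 < la. Proof. by rewrite /la; have := c0; lra. Qed.
Let w (x : R) : R := expR (la * x).

Let w0 x : 0 <= w x. Proof. exact: expR_ge0. Qed.

Lemma volterra_integrable a b x (f : R -> 'M[C]_(p, q)) : cintegrable a b f ->
  cintegrable a b (fun t => K (x, t) *m f t).
Proof.
by move=> hf; apply: (cintegrableMl (c := c)) => //; exact: mxmeas_slice.
Qed.

Lemma nrm_volterra a b x (f : R -> 'M[C]_(p, q)) : cintegrable a b f ->
  nrm (cint a b (fun t => K (x, t) *m f t)) <= c * Ig a b (fun t => nrm (f t)).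
Proof.
move=> hf; have hKf := volterra_integrable x hf.
have i1 := cintegrable_nrm hf.
apply: (le_trans (nrm_cint hKf)); rewrite -RintegralZl//.
apply: Ig_le => [||t _]; [exact: cintegrable_nrm|exact: igZ|].
by rewrite (le_trans (nrmM _ _))// ler_wpM2r ?nrm_ge0.
Qed.

(** [F] is only integrable, so the iteration runs on the difference f - F, which is bounded by a
    multiple of the weight. The constant depends on the kernel and on r but not on [F]; this
    uniformity makes E^-1 a bounded operator. *)
Lemma volterra_solve : exists c' : R, forall F : R -> 'M[C]_(p, q), cintegrable 0 r F ->
  exists f, [/\ cintegrable 0 r f,
    forall x, Icc 0 r x -> f x = F x + cint 0 x (fun t => K (x, t) *m f t) &
    forall x, Icc 0 r x -> nrm (f x - F x) <= c' * Ig 0 r (fun t => nrm (F t))].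
Proof.
exists (msqK R p q * (2 * c) * expR (la * r)) => F hF.
pose F' := patch0 0 r F.
have eF t : Icc 0 r t -> F' t = F t by exact: patch0E.
have mF' : mxmeas setT F' by exact: mxmeas_patch (cintegrable_meas hF).
have hF' : cintegrable 0 r F' by apply: cintegrable_eq hF => t /eF.
pose Phi (h : R -> 'M[C]_(p, q)) (x : R) :=
  if 0 <= x <= r then cint 0 x (fun t => K (x, t) *m (F' t + h t)) else 0.
pose L1 := Ig 0 r (fun t => nrm (F t)).
have L1E : Ig 0 r (fun t => nrm (F' t)) = L1 by apply: Ig_eq => t /eF ->.
have L10 : 0 <= L1 by apply: Ig_ge0 => t _; exact: nrm_ge0.
have wbm_int (g : R -> 'M[C]_(p, q)) : wbm w g -> forall x, cintegrable 0 x g.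
  move=> [mg [d hd]] x; have [ie _] := Ig_exp_le 0 x la0.
  apply: (@cintegrable_dom _ _ _ _ _ _ (fun t => d * w t)) => //; last exact: igZ.
  exact: mxmeas_sub measurableT (@subsetT _ _) mg.
have wge1 x : 0 <= x -> 1 <= w x.
  by move=> x0; rewrite -expR0 ler_expR mulr_ge0// ltW.
have L1x x : Icc 0 r x -> cintegrable 0 x F' /\ Ig 0 x (fun t => nrm (F' t)) <= L1.
  move=> /andP[x0 xr]; split; first exact: cintegrable_sub hF'.
  rewrite -L1E; apply: Ig_subset_le => //; first exact: cintegrable_nrm.
  by move=> t _; exact: nrm_ge0.
have PhiS g : wbm w g -> wbm w (Phi g).
  move=> Sg; have [mg [d hd]] := Sg; split.
    apply: mxmeas_if; [| |exact: mxmeas_cst].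
      by apply: measurable_and; apply: measurable_fun_ler.
    apply: (@mxmeas_cint _ _ _ _ _ (fun z => K z *m (F' z.2 + g z.2))) => //.
    apply: mxmeasM => //; apply: mxmeasD; apply: (mxmeas_comp (g := snd)) => //.
  have d0 : 0 <= d.
    have := le_trans (nrm_ge0 (g 0)) (hd 0).
    by rewrite pmulr_lge0// expR_gt0.
  exists (c * L1 + d / 2) => x; rewrite /Phi; case: ifPn => [xr|_]; last first.
    by rewrite nrm0 mulr_ge0// addr_ge0// ?mulr_ge0// ?divr_ge0.
  have [hFx hL] := L1x x xr; have hgx := wbm_int g Sg x.
  apply: (le_trans (nrm_volterra x (cintegrableD hFx hgx))).
  have [_ hb] := Ig_weight_le c0 (mxmeas_sub measurableT (@subsetT _ (Icc 0 x)) mg) d0 (fun t _ => hd t).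
  have i1 := cintegrable_nrm hFx; have i2 := cintegrable_nrm hgx.
  apply: (@le_trans _ _ (c * Ig 0 x (fun t => nrm (F' t)) + c * Ig 0 x (fun t => nrm (g t)))).
    rewrite -mulrDr ler_wpM2l// -RintegralD//.
    apply: Ig_le => [||t _]; [exact: cintegrable_nrm (cintegrableD hFx hgx)|exact: igD|].
    exact: nrmD.
  rewrite mulrDl lerD//; apply: (le_trans (ler_wpM2l c0 hL)).
  by rewrite ler_peMr ?mulr_ge0// wge1//; case/andP: xr.
have Phi_c g h d : wbm w g -> wbm w h -> (forall x, nrm (g x - h x) <= d * w x) ->
    forall x, nrm (Phi g x - Phi h x) <= d / 2 * w x.
  move=> Sg Sh hd x.
  have d0 : 0 <= d.
    have := le_trans (nrm_ge0 (g 0 - h 0)) (hd 0).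
    by rewrite pmulr_lge0// expR_gt0.
  rewrite /Phi; have [xr|xr] := boolP (0 <= x <= r); last first.
    by rewrite subrr nrm0; apply: mulr_ge0; [apply: divr_ge0|exact: w0].
  have [hFx hL] := L1x x xr; have hgx := wbm_int g Sg x; have hhx := wbm_int h Sh x.
  rewrite -(cintB (volterra_integrable x (cintegrableD hFx hgx))
                  (volterra_integrable x (cintegrableD hFx hhx))).
  have -> : cint 0 x (fun t => K (x, t) *m (F' t + g t) - K (x, t) *m (F' t + h t)) =
      cint 0 x (fun t => K (x, t) *m (g t - h t)).
    by apply: cint_eq => t _; rewrite -mulmxBr opprD addrACA subrr add0r.
  have hgh := cintegrableB hgx hhx.
  have [_ hb] := Ig_weight_le c0 (cintegrable_meas hgh) d0 (fun t _ => hd t).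
  exact: le_trans (nrm_volterra x hgh) hb.
have S0 : wbm w (fun=> 0 : 'M[C]_(p, q)).
  by split; [exact: mxmeas_cst|exists 0 => x; rewrite nrm0 mul0r].
have [|h [[mh [d hd]] hPhi hb]] := @picard R _ _ p q w Phi PhiS Phi_c (fun=> 0) (c * L1) S0.
  move=> x; rewrite subr0 /Phi; case: ifPn => [xr|_]; last by rewrite nrm0 !mulr_ge0.
  have [hFx hL] := L1x x xr.
  have -> : cint 0 x (fun t => K (x, t) *m (F' t + 0)) = cint 0 x (fun t => K (x, t) *m F' t).
    by apply: cint_eq => t _; rewrite addr0.
  apply: (le_trans (nrm_volterra x hFx)).
  apply: (le_trans (ler_wpM2l c0 hL)).
  by rewrite ler_peMr ?mulr_ge0// wge1//; case/andP: xr.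
have hh : cintegrable 0 r h by apply: wbm_int; split=> //; exists d.
exists (fun x => F' x + h x); split.
- exact: cintegrableD.
- by move=> x xr; rewrite (eF x xr) -[in LHS](hPhi x) /Phi; move: (xr); rewrite /Icc/= => ->.
- move=> x xr; rewrite (eF x xr) addrC addKr.
  have := hb x; rewrite subr0 => /le_trans; apply.
  have -> : msqK R p q * (2 * (c * L1)) * w x = (msqK R p q * (2 * c) * L1) * w x by ring.
  rewrite -/L1 [leRHS]mulrAC; apply: ler_wpM2l.
    by rewrite !mulr_ge0// ler0n.
  rewrite /w ler_expR; apply: ler_wpM2l; [exact: ltW|by case/andP: xr].
Qed.

(** One application of the equation makes d bounded; every further one halves the bound in the
    weighted norm. *)
Lemma volterra_unique (d : R -> 'M[C]_(p, q)) : cintegrable 0 r d ->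
  (forall x, Icc 0 r x -> d x = cint 0 x (fun t => K (x, t) *m d t)) ->
  forall x, Icc 0 r x -> d x = 0.
Proof.
move=> hd eqd.
pose B := c * Ig 0 r (fun t => nrm (d t)).
have B0 : 0 <= B by rewrite mulr_ge0//; apply: Ig_ge0 => t _; exact: nrm_ge0.
have hk k : forall x, Icc 0 r x -> nrm (d x) <= B / 2 ^+ k * w x.
  elim: k => [|k IH] x xr; have /andP[x0 xr'] := xr;
    have hdx : cintegrable 0 x d by exact: cintegrable_sub hd.
    rewrite expr0 divr1 (eqd x xr) (le_trans (nrm_volterra x hdx))//.
    apply: (@le_trans _ _ B).
      apply: ler_wpM2l => //; apply: Ig_subset_le => //; first exact: cintegrable_nrm.
      by move=> t _; exact: nrm_ge0.
    by rewrite ler_peMr// -expR0 ler_expR mulr_ge0// ltW.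
  rewrite (eqd x xr) (le_trans (nrm_volterra x hdx))//.
  have Bk : 0 <= B / 2 ^+ k by rewrite divr_ge0// exprn_ge0.
  have [|_ hb] := @Ig_weight_le _ _ 0 x d c (B / 2 ^+ k) c0 (cintegrable_meas hdx) Bk.
    by move=> t /andP[t0 tx]; apply: IH; rewrite /Icc/= t0 (le_trans tx xr').
  apply: (le_trans hb); rewrite exprSr invfM mulrA//.
move=> x xr; apply: nrm0_eq0; apply: (@le_halves_eq0 _ _ (B * w x)) => k.
by rewrite mulrAC; exact: hk.
Qed.

End Volterra.

(** * Functions integrable over the whole line, and a Leibniz rule *)

Section TotallyIntegrable.
Variable R : realType.
Local Notation C := (R[i]).
Local Notation mu := (@lebesgue_measure R).
Local Notation ig a b f := (mu.-integrable (Icc a b) (EFin \o f)).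
Local Notation Ig a b f := (Rintegral mu (Icc a b) f).
Hint Resolve measurable_Icc : core.
Local Opaque cint cintegrable.

(** Integrability over the whole line survives affine changes of the argument with a bound
    independent of the shift, so folded arguments such as |x - 2m| need no bookkeeping of
    intervals. *)
Definition tint m n (f : R -> 'M[C]_(m, n)) : Prop :=
  mxmeas setT f /\ mu.-integrable setT (EFin \o (fun t => nrm (f t))).

Definition N1 m n (f : R -> 'M[C]_(m, n)) : R := Rintegral mu setT (fun t => nrm (f t)).

Lemma tint_cintegrable m n (f : R -> 'M[C]_(m, n)) a b : tint f -> cintegrable a b f.
Proof.
move=> [mf hf]; apply: (@cintegrable_dom _ _ _ _ _ _ (fun t => nrm (f t))) => //.
  exact: mxmeas_sub measurableT (@subsetT _ _) mf.
exact: integrableS hf.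
Qed.

Lemma tint_Ig_le m n (f : R -> 'M[C]_(m, n)) a b : tint f ->
  Ig a b (fun t => nrm (f t)) <= N1 f.
Proof.
move=> [mf hf]; have hab : ig a b (fun t => nrm (f t)) by exact: integrableS hf.
rewrite /N1 /Rintegral; apply: fine_le.
- exact: integrable_fin_num.
- exact: integrable_fin_num.
- apply: ge0_subset_integral => //; first by apply: (measurable_int mu hf).
  by move=> t _; rewrite lee_fin nrm_ge0.
Qed.

Lemma tint_dom m n k l (f : R -> 'M[C]_(m, n)) (g : R -> 'M[C]_(k, l)) : tint f ->
  mxmeas setT g -> (forall t, nrm (g t) <= nrm (f t)) -> tint g.
Proof.
move=> [mf hf] mg h; split=> //; apply: le_integrable hf => //.
  by apply/measurable_EFinP; exact: mxmeas_nrm.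
by move=> t _ /=; rewrite lee_fin !ger0_norm ?nrm_ge0.
Qed.

Lemma tint_patch m n r (f : R -> 'M[C]_(m, n)) : cintegrable 0 r f -> tint (patch0 0 r f).
Proof.
move=> hf; split; first exact: mxmeas_patch (cintegrable_meas hf).
have /(@integrable_mkcond _ _ _ mu (Icc 0 r) _ (measurable_Icc 0 r)) := cintegrable_nrm hf.
apply: eq_integrable => // t _; rewrite patchE /patch0.
case: ifPn => [|]; first by rewrite inE => h /=; move: h; rewrite /Icc/= => ->.
by rewrite notin_setE /Icc/= => /negP/negbTE ->; rewrite nrm0.
Qed.

Lemma tint_affine m n (f : R -> 'M[C]_(m, n)) s c0 : s != 0 -> tint f ->
  tint (fun t => f (c0 + s * t)).
Proof.
move=> s0 [mf hf].
have maff : measurable_fun setT (fun t : R => c0 + s * t).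
  by apply: measurable_funD => //; apply: measurable_funM.
split; first exact: (mxmeas_comp maff mf).
have mn : measurable_fun setT (fun t : R => (nrm (f (c0 + s * t)))%:E).
  by apply/measurable_EFinP; apply: mxmeas_nrm; exact: (mxmeas_comp maff mf).
have /integrableP[_] := hf.
rewrite (@ge0_integral_affine R s c0 s0 setT (fun t => `|(nrm (f t))%:E|)%E)//; last first.
  by apply: measurableT_comp => //; apply/measurable_EFinP; exact: mxmeas_nrm.
rewrite preimage_setT => h; apply/integrableP; split=> //.
rewrite ltNge leye_eq; apply/negP => /eqP e.
move: h; rewrite (_ : (\int[mu]_(t in setT) _)%E = +oo%E).
  by rewrite gt0_muley ?ltxx ?lte_fin ?normr_gt0.
exact: e.
Qed.

Lemma tint_add m n k l k' l' (f : R -> 'M[C]_(m, n)) (g : R -> 'M[C]_(k, l))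
    (h : R -> 'M[C]_(k', l')) : tint f -> tint g -> mxmeas setT h ->
  (forall t, nrm (h t) <= nrm (f t) + nrm (g t)) -> tint h.
Proof.
move=> [mf hf] [mg hg] mh H; split=> //.
have := integrableD measurableT hf hg; apply: le_integrable => //.
  by apply/measurable_EFinP; exact: mxmeas_nrm.
by move=> t _ /=; rewrite lee_fin !ger0_norm ?nrm_ge0// addr_ge0// nrm_ge0.
Qed.

(* A Leibniz rule in integrated form: both factors are primitives in the first
   variable, started on the diagonal. *)
Lemma leibniz_triangle (X : R) p s q (nu w : R * R -> 'M[C]_(p, s)) (G e : R * R -> 'M[C]_(s, q))
    (cn cw cG ce : R) :
  0 <= X ->
  mxmeas setT nu -> mxmeas setT w -> mxmeas setT G -> mxmeas setT e ->
  (forall y m, 0 <= m <= y -> y <= X ->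
     [/\ nrm (nu (y, m)) <= cn, nrm (w (y, m)) <= cw & nrm (G (y, m)) <= cG]) ->
  (forall m, Icc 0 X m -> cintegrable m X (fun y => e (y, m)) /\
     Ig m X (fun y => nrm (e (y, m))) <= ce) ->
  (forall y, Icc 0 X y -> cintegrable 0 y (fun m => e (y, m))) ->
  (forall m x, 0 <= m <= x -> x <= X -> nu (x, m) = nu (m, m) + cint m x (fun y => w (y, m))) ->
  (forall m x, 0 <= m <= x -> x <= X -> G (x, m) = G (m, m) + cint m x (fun y => e (y, m))) ->
  let D y := nu (y, y) *m G (y, y) + (cint 0 y (fun m => w (y, m) *m G (y, m)) +
     cint 0 y (fun m => nu (y, m) *m e (y, m))) in
  cintegrable 0 X D /\ cint 0 X (fun m => nu (X, m) *m G (X, m)) = cint 0 X D.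
Proof.
move=> X0 mnu mw mG me hb he1 he2 hnu hG D.
have cn0 : 0 <= cn.
  by have [|//|h _ _] := hb 0 0; [rewrite lexx|exact: le_trans (nrm_ge0 _) h].
have cw0 : 0 <= cw.
  by have [|//|_ h _] := hb 0 0; [rewrite lexx|exact: le_trans (nrm_ge0 _) h].
have cG0 : 0 <= cG.
  by have [|//|_ _ h] := hb 0 0; [rewrite lexx|exact: le_trans (nrm_ge0 _) h].
have swap k l (H : R * R -> 'M[C]_(k, l)) (y : R) Dm : mxmeas setT H -> mxmeas Dm (fun t => H (t, y)).
  move=> mH; apply: (mxmeas_sub measurableT (@subsetT _ Dm)).
  by apply: (mxmeas_comp _ mH); apply: measurable_fun_pair.
(* For fixed m this is the density of the product nu G in the first variable. *)
pose H (z : R * R) := w z *m G z + nu z *m e z.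
have mH : mxmeas setT H by apply: mxmeasD; apply: mxmeasM.
have bwG y m : 0 <= m <= y -> y <= X -> nrm (w (y, m) *m G (y, m)) <= cw * cG.
  move=> my yX; have [h1 h2 h3] := hb y m my yX.
  by apply: (le_trans (nrmM _ _)); apply: ler_pM; rewrite ?nrm_ge0.
have row m : Icc 0 X m -> [/\ cintegrable m X (fun y => w (y, m)),
    cintegrable m X (fun y => H (y, m)) &
    Ig m X (fun y => nrm (H (y, m))) <= cw * cG * X + cn * ce].
  move=> /andP[m0 mX].
  have [hi hc] := he1 m (introT andP (conj m0 mX)).
  have iw : cintegrable m X (fun y => w (y, m)).
    apply: (@cintegrable_bdd _ _ _ _ _ _ cw); first exact: swap.
    by move=> t /andP[mt tX]; have [] := hb t m; rewrite ?m0.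
  have iwG : cintegrable m X (fun y => w (y, m) *m G (y, m)).
    apply: (@cintegrable_bdd _ _ _ _ _ _ (cw * cG)).
      exact: (mxmeasM (swap _ _ w m _ mw) (swap _ _ G m _ mG)).
    by move=> t /andP[mt tX]; apply: bwG => //; rewrite m0.
  have ine : cintegrable m X (fun y => nu (y, m) *m e (y, m)).
    apply: (@cintegrableMl _ _ _ _ _ _ _ _ cn) => //; first exact: swap.
    by move=> t /andP[mt tX]; have [] := hb t m; rewrite ?m0.
  split=> //; first exact: cintegrableD.
  have i1 := cintegrable_nrm iwG; have i2 := cintegrable_nrm ine.
  have i3 := cintegrable_nrm hi.
  apply: (@le_trans _ _ (Ig m X (fun y => nrm (w (y, m) *m G (y, m)) + nrm (nu (y, m) *m e (y, m))))).
    apply: Ig_le => [||t _]; [exact: (cintegrable_nrm (cintegrableD iwG ine))|exact: igD|].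
    exact: nrmD.
  rewrite RintegralD//; apply: lerD.
    apply: (@le_trans _ _ (Ig m X (fun=> cw * cG))).
      apply: Ig_le => // [|t /andP[mt tX]]; first exact: ig_cst.
      by apply: bwG => //; rewrite m0.
    by rewrite Ig_cst// ler_wpM2l ?mulr_ge0// gerBl.
  apply: le_trans (ler_wpM2l cn0 hc); rewrite -RintegralZl//.
  apply: Ig_le => // [|t /andP[mt tX]]; first exact: igZ.
  have [h1 _ _] := hb t m (introT andP (conj m0 mt)) tX.
  by apply: (le_trans (nrmM _ _)); rewrite ler_wpM2r// nrm_ge0.
have col y : Icc 0 X y -> [/\ cintegrable 0 y (fun m => H (y, m)),
    cintegrable 0 y (fun m => w (y, m) *m G (y, m)) &
    cintegrable 0 y (fun m => nu (y, m) *m e (y, m))].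
  move=> yX; have /andP[y0 yX'] := yX.
  have iwG : cintegrable 0 y (fun m => w (y, m) *m G (y, m)).
    apply: (@cintegrable_bdd _ _ _ _ _ _ (cw * cG)).
      by apply: mxmeasM; exact: mxmeas_slice.
    by move=> t ty; apply: bwG.
  have ine : cintegrable 0 y (fun m => nu (y, m) *m e (y, m)).
    apply: (@cintegrableMl _ _ _ _ _ _ _ _ cn) => //; [exact: mxmeas_slice| |exact: he2].
    by move=> t ty; have [] := hb y t ty yX'.
  by split=> //; exact: cintegrableD.
(* Writing nu G at (X, m) as its diagonal value plus the integral of [H] over y in [m, X], then
   integrating over m and exchanging the order, produces the three terms of [D]. *)
have [] := @cint_Fubini R p q H 0 X (fun=> cw * cG * X + cn * ce) mH.
- exact: ig_cst.
- by move=> m /row[].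
- by move=> y /col[].
move=> i1 i2 eF.
pose A (y : R) := nu (y, y) *m G (y, y).
have mdiag k l (K : R * R -> 'M[C]_(k, l)) Dm : mxmeas setT K -> mxmeas Dm (fun t => K (t, t)).
  move=> mK; apply: (mxmeas_sub measurableT (@subsetT _ Dm)).
  by apply: (mxmeas_comp _ mK); apply: measurable_fun_pair.
have iA : cintegrable 0 X A.
  apply: (@cintegrable_bdd _ _ _ _ _ _ (cn * cG)).
    by apply: mxmeasM; exact: mdiag.
  move=> t /andP[t0 tX]; have [h1 _ h3] := hb t t (introT andP (conj t0 (lexx t))) tX.
  by apply: (le_trans (nrmM _ _)); apply: ler_pM; rewrite ?nrm_ge0.
have eD y : Icc 0 X y -> A y + cint 0 y (fun m => H (y, m)) = D y.
  by move=> /col[_ h1 h2]; rewrite /D -(cintD h1 h2).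
have iAH := cintegrableD iA i2.
split; first exact: (cintegrable_eq eD iAH).
rewrite -(cint_eq eD) (cintD iA i2) -eF -(cintD iA i1).
apply: cint_eq => m mX; have [iw _ _] := row m mX; have [ie _] := he1 m mX.
have /andP[m0 mX'] := mX.
have [] := @product_rule R p s q m X (fun x => nu (x, m)) (fun x => w (x, m))
  (fun x => G (x, m)) (fun x => e (x, m)) mX' iw ie.
- by move=> x /andP[mx xX]; apply: hnu => //; rewrite m0.
- by move=> x /andP[mx xX]; apply: hG => //; rewrite m0.
by move=> _ ->.
Qed.

End TotallyIntegrable.

(** * The common kernel of the two transmutation operators *)

Section Kernel.
Variable R : realType.
Local Notation C := (R[i]).
Local Notation mu := (@lebesgue_measure R).
Local Notation ig a b f := (mu.-integrable (Icc a b) (EFin \o f)).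
Local Notation Ig a b f := (Rintegral mu (Icc a b) f).
Hint Resolve measurable_Icc : core.
Local Opaque cint cintegrable.

Variables (r : R) (p : nat) (v psi : R -> 'M[C]_p) (b : 'M[C]_p) (c : R).
Hypothesis mv : mxmeas setT v.
Hypothesis mpsi : mxmeas setT psi.
Hypothesis bv : forall x, nrm (v x) <= c.
Hypothesis bpsi : forall x, nrm (psi x) <= c.

(* For [T1 f x = b f(x) + int_0^x n(x,m) f(|x - 2m|) dm + int_0^x psi(s) f(x - s) ds]
   and [T2] with the extra factor [sgn (x - 2m)] in the first integral, the
   intertwining relations amount to [n] being a fixed point of [kernel_map]. *)
Definition phik (z : R * R) : 'M[C]_p :=
  if z.1 < 2 * z.2 then Complex 2 0 *: psi (2 * (z.1 - z.2)) else 0.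

(** The density of n(., m) in its first variable. Integrated over m against a fold of f, the
    reflected term n(x, x - m) gives v times the n-integral of f and [phik] gives v times the
    convolution with [psi], with the sign + for the even fold and - for the odd one. *)
Definition wk (n : R * R -> 'M[C]_p) (z : R * R) : 'M[C]_p :=
  v z.1 *m (n (z.1, z.1 - z.2) + phik z).

Definition tri (z : R * R) : bool := (0 <= z.2) && (z.2 <= z.1 <= r).

(** The diagonal value v b is what the moving upper limit of the n-integral has to contribute to
    complete v T1 f. The value 0 outside the triangle lets bounds be stated on the whole plane. *)
Definition kernel_map (n : R * R -> 'M[C]_p) (z : R * R) : 'M[C]_p :=
  if tri z then v z.2 *m b + cint z.2 z.1 (fun y => wk n (y, z.2)) else 0.

Let c0 : 0 <= c. Proof. exact: le_trans (nrm_ge0 _) (bv 0). Qed.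
Let la : R := 2 * c + 1.
Let la0 : 0 < la. Proof. by rewrite /la; have := c0; lra. Qed.
Let W (z : R * R) : R := expR (la * z.1).

Lemma mxmeas_phik : mxmeas setT phik.
Proof.
apply: mxmeas_if; [|apply: mxmeas_rlin; first exact: rlin_scale|exact: mxmeas_cst].
  by apply: measurable_fun_ltr => //; apply: measurable_funM.
apply: (mxmeas_comp _ mpsi); apply: measurable_funM => //.
by apply: measurable_funB.
Qed.

Lemma mxmeas_refl n : mxmeas setT n -> mxmeas setT (fun z : R * R => n (z.1, z.1 - z.2) : 'M[C]_p).
Proof.
move=> mn; apply: (mxmeas_comp _ mn); apply: measurable_fun_pair => //.
by apply: measurable_funB.
Qed.

Lemma mxmeas_wk n : mxmeas setT n -> mxmeas setT (wk n).
Proof.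
move=> mn; apply: mxmeasM; first exact: (mxmeas_comp _ mv).
by apply: mxmeasD; [exact: mxmeas_refl|exact: mxmeas_phik].
Qed.

Lemma nrm_phik z : nrm (phik z) <= 2 * c.
Proof.
rewrite /phik; case: ifP => _; last by rewrite nrm0 mulr_ge0.
by rewrite nrmZ ger0_norm// ler_wpM2l.
Qed.

Let mv2 : mxmeas setT (fun z : R * R => v z.2).
Proof. exact: (mxmeas_comp _ mv). Qed.

Let nrm_vint a x (f : R -> 'M[C]_p) d : mxmeas (Icc a x) f -> 0 <= d ->
  (forall t, Icc a x t -> nrm (f t) <= d * expR (la * t)) ->
  [/\ cintegrable a x f, cintegrable a x (fun y => v y *m f y) &
      nrm (cint a x (fun y => v y *m f y)) <= d / 2 * expR (la * x)].
Proof.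
move=> mf d0 hf; have [hi hle] := Ig_weight_le c0 mf d0 hf.
have bv2 : forall z : R * R, nrm (v z.2) <= c by move=> z.
split=> //; first exact: (volterra_integrable mv2 bv2 0 hi).
exact: le_trans (nrm_volterra mv2 bv2 0 hi) hle.
Qed.

(** Picard iteration with a weight in the first variable alone: the reflected argument (y, y - m)
    has the same first coordinate as (y, m), so the non-local term does not spoil the
    contraction. *)
Lemma kernel_exists : exists (n : R * R -> 'M[C]_p) (cn : R),
  [/\ mxmeas setT n, forall z, nrm (n z) <= cn & forall z, n z = kernel_map n z].
Proof.
have dpos k l (d : R) (M : 'M[C]_(k, l)) z : nrm M <= d * W z -> 0 <= d.
  by move=> h; have := le_trans (nrm_ge0 M) h; rewrite pmulr_lge0// expR_gt0.
have PhiS n : wbm W n -> wbm W (kernel_map n).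
  move=> [mn [d hd]]; have d0 : 0 <= d by exact: dpos (hd (0, 0)).
  split.
    apply: mxmeas_if; [| |exact: mxmeas_cst].
      apply: measurable_and; first exact: measurable_fun_ler.
      by apply: measurable_and; apply: measurable_fun_ler.
    apply: mxmeasD.
      by apply: mxmeasM; [exact: (mxmeas_comp _ mv)|exact: mxmeas_cst].
    apply: (@mxmeas_cint _ _ _ _ _ (fun zt : (R * R) * R => wk n (zt.2, zt.1.2))) => //.
    apply: (mxmeas_comp _ (mxmeas_wk mn)); apply: measurable_fun_pair => //.
    by apply: measurableT_comp.
  (* c |b| bounds the diagonal term; the integral sees n + phik, of size d + 2 c relative to the
     weight, and integration against v halves it. *)
  exists (c * nrm b + (d + 2 * c) / 2) => z; rewrite /kernel_map.
  case: ifP => [/and3P[m0 mx xr]|_]; last first.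
    by rewrite nrm0; apply: mulr_ge0; [rewrite !addr_ge0// ?mulr_ge0 ?divr_ge0 ?addr_ge0 ?nrm_ge0// mulr_ge0|exact: expR_ge0].
  have w1 t : 0 <= t -> 1 <= expR (la * t).
    by move=> t0; rewrite -expR0 ler_expR mulr_ge0// ltW.
  apply: (le_trans (nrmD _ _)); rewrite mulrDl; apply: lerD.
    apply: (le_trans (nrmM _ _)).
    apply: (@le_trans _ _ (c * nrm b)); first by rewrite ler_wpM2r ?nrm_ge0.
    by rewrite ler_peMr ?mulr_ge0 ?nrm_ge0// w1// (le_trans m0).
  have [] := @nrm_vint z.2 z.1 (fun y => n (y, y - z.2) + phik (y, z.2)) (d + 2 * c); last by [].
  - apply: (@mxmeas_col _ _ _ (fun w => n (w.1, w.1 - w.2) + phik w)).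
    by apply: mxmeasD; [exact: mxmeas_refl|exact: mxmeas_phik].
  - by rewrite addr_ge0// mulr_ge0.
  - move=> t /andP[mt tx]; apply: (le_trans (nrmD _ _)); rewrite mulrDl; apply: lerD.
      exact: hd.
    apply: (le_trans (nrm_phik _)); rewrite ler_peMr ?mulr_ge0// w1//.
    exact: le_trans m0 mt.
have Phi_c g h d : wbm W g -> wbm W h -> (forall x, nrm (g x - h x) <= d * W x) ->
    forall x, nrm (kernel_map g x - kernel_map h x) <= d / 2 * W x.
  move=> [mg [dg hg]] [mh [dh hh]] hd z.
  have d0 : 0 <= d by exact: dpos (hd (0, 0)).
  rewrite /kernel_map; have [/and3P[m0 mx xr]|_] := boolP (tri z); last first.
    by rewrite subrr nrm0; apply: mulr_ge0; [apply: divr_ge0|exact: expR_ge0].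
  have w1 t : 0 <= t -> 1 <= expR (la * t).
    by move=> t0; rewrite -expR0 ler_expR mulr_ge0// ltW.
  have aux k dk : mxmeas setT k -> (forall x, nrm (k x) <= dk * W x) ->
      cintegrable z.2 z.1 (fun y => wk k (y, z.2)).
    move=> mk hk; have dk0 : 0 <= dk by exact: dpos (hk (0, 0)).
    have [] := @nrm_vint z.2 z.1 (fun y => k (y, y - z.2) + phik (y, z.2)) (dk + 2 * c); last by [].
    - apply: (@mxmeas_col _ _ _ (fun w => k (w.1, w.1 - w.2) + phik w)).
      by apply: mxmeasD; [exact: mxmeas_refl|exact: mxmeas_phik].
    - by rewrite addr_ge0// mulr_ge0.
    - move=> t /andP[mt tx]; apply: (le_trans (nrmD _ _)); rewrite mulrDl; apply: lerD.
        exact: hk.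
      apply: (le_trans (nrm_phik _)); rewrite ler_peMr ?mulr_ge0// w1//.
      exact: le_trans m0 mt.
  have ig1 := aux g dg mg hg; have ih1 := aux h dh mh hh.
  have -> : v z.2 *m b + cint z.2 z.1 (fun y => wk g (y, z.2)) -
      (v z.2 *m b + cint z.2 z.1 (fun y => wk h (y, z.2))) =
      cint z.2 z.1 (fun y => v y *m (g (y, y - z.2) - h (y, y - z.2))).
    rewrite opprD addrACA subrr add0r -(cintB ig1 ih1); apply: cint_eq => t _.
    by rewrite /wk /= -mulmxBr opprD addrACA subrr addr0.
  have [] := @nrm_vint z.2 z.1 (fun y => g (y, y - z.2) - h (y, y - z.2)) d; last by [].
  - apply: (@mxmeas_col _ _ _ (fun w => g (w.1, w.1 - w.2) - h (w.1, w.1 - w.2))).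
    apply: mxmeasD; first exact: mxmeas_refl.
    by apply: (mxmeas_rlin (@rlin_opp R p p)); exact: mxmeas_refl.
  - exact: d0.
  - by move=> t _; exact: hd.
have S0 : wbm W (fun=> 0 : 'M[C]_p).
  by split; [exact: mxmeas_cst|exists 0 => x; rewrite nrm0 mul0r].
have [_ [d hd]] := PhiS _ S0.
have [|n [[mn [dn hn]] hPhi _]] := @picard R _ _ p p W kernel_map PhiS Phi_c (fun=> 0) d S0.
  by move=> x; rewrite subr0; exact: hd.
have dn0 : 0 <= dn by exact: dpos (hn (0, 0)).
exists n, (dn * expR (la * r)); split=> // z.
have := hPhi z; rewrite {1}/kernel_map.
have [/and3P[m0 mx xr] _|_ <-] := boolP (tri z).
  apply: (le_trans (hn z)); apply: ler_wpM2l => //.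
  by rewrite /W ler_expR; apply: ler_wpM2l => //; exact: ltW.
by rewrite nrm0; apply: mulr_ge0 => //; exact: expR_ge0.
Qed.

End Kernel.

(** * Even and odd folding of a function about the origin *)

Section Transmutation.
Variable R : realType.
Local Notation C := (R[i]).
Local Notation mu := (@lebesgue_measure R).
Local Notation ig a b f := (mu.-integrable (Icc a b) (EFin \o f)).
Local Notation Ig a b f := (Rintegral mu (Icc a b) f).
Hint Resolve measurable_Icc : core.
Local Opaque cint cintegrable.

Lemma N1_affine m n (f : R -> 'M[C]_(m, n)) s c0 : s != 0 -> tint f ->
  N1 (fun t => f (c0 + s * t)) = N1 f / `|s|.
Proof.
move=> s0 tf; have [mf hf] := tf; have [mfs hfs] := tint_affine c0 s0 tf.
apply/eqP; rewrite eq_sym; apply/eqP; apply: (canLR (mulfK _)); first by rewrite normr_eq0.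
rewrite /N1 /Rintegral (@ge0_integral_affine R s c0 s0 setT (fun t => (nrm (f t))%:E))//.
- rewrite preimage_setT fineM// 1?mulrC//.
  exact: (integrable_fin_num measurableT hfs).
- by apply/measurable_EFinP; exact: mxmeas_nrm.
- by move=> t; rewrite lee_fin nrm_ge0.
Qed.

(** With the value -1 at 0 the sign in [od] is constant for y in the closed interval [m, 2m]; only
    the interval to the right of 2m needs an exception at its left end. *)
Definition sg (s : R) : C := if s <= 0 then -1 else 1.

Lemma nrm_sg k l s (M : 'M[C]_(k, l)) : nrm (sg s *: M) = nrm M.
Proof. by rewrite /sg; case: ifP => _; rewrite ?scaleN1r ?nrmN ?scale1r. Qed.

Section Folding.
Variables (p q : nat).
Implicit Types (f g : R -> 'M[C]_(p, q)).

(** The even extension of f evaluated at x - 2m; [od] does the same for the odd extension.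
    Differentiation in x takes [ev g] to [od] of g', and [od g] to [ev] of g' when g(0) = 0. *)
Definition ev f (z : R * R) : 'M[C]_(p, q) := f `|z.1 - 2 * z.2|.
Definition od f (z : R * R) : 'M[C]_(p, q) := sg (z.1 - 2 * z.2) *: f `|z.1 - 2 * z.2|.

Let mfold : measurable_fun setT (fun z : R * R => z.1 - 2 * z.2).
Proof. by apply: measurable_funB => //; apply: measurable_funM. Qed.

Lemma mxmeas_ev f : mxmeas setT f -> mxmeas setT (ev f).
Proof. by move=> mf; apply: (mxmeas_comp _ mf); apply: measurableT_comp. Qed.

Lemma mxmeas_od f : mxmeas setT f -> mxmeas setT (od f).
Proof.
move=> mf.
have -> : od f = (fun z => if z.1 - 2 * z.2 <= 0 then - ev f z else ev f z).
  by apply/funext => z; rewrite /od /sg; case: ifP; rewrite ?scaleN1r ?scale1r.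
apply: mxmeas_if; [by apply: measurable_fun_ler| |exact: mxmeas_ev].
by apply: (mxmeas_rlin (@rlin_opp R p q)); exact: mxmeas_ev.
Qed.

(** The absolute value selects one of two affine branches, each contributing at most the norm of f
    divided by |s|; hence the factor 2. *)
Lemma tint_abs_affine f s c0 : s != 0 -> tint f ->
  tint (fun t => f `|c0 + s * t|) /\
  forall a b, Ig a b (fun t => nrm (f `|c0 + s * t|)) <= 2 * N1 f / `|s|.
Proof.
move=> s0 tf.
have t1 := tint_affine c0 s0 tf.
have sN0 : - s != 0 by rewrite oppr_eq0.
have t2 := tint_affine (- c0) sN0 tf.
have h t : nrm (f `|c0 + s * t|) <= nrm (f (c0 + s * t)) + nrm (f (- c0 + - s * t)).
  rewrite mulNr -opprD; case: (ger0P (c0 + s * t)) => _; rewrite ?lerDl ?lerDr; exact: nrm_ge0.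
have ht : tint (fun t => f `|c0 + s * t|).
  apply: (tint_add t1 t2) => //; apply: (mxmeas_comp _ tf.1).
  have maff : measurable_fun setT (fun t : R => c0 + s * t).
    by apply: measurable_funD => //; apply: measurable_funM.
  exact: measurableT_comp.
split=> // a b.
have i1 := cintegrable_nrm (tint_cintegrable a b t1).
have i2 := cintegrable_nrm (tint_cintegrable a b t2).
apply: (le_trans (Ig_le (cintegrable_nrm (tint_cintegrable a b ht)) (igD i1 i2) (fun t _ => h t))).
rewrite RintegralD// -mulrA mulrDl !mul1r; apply: lerD.
  by rewrite -(N1_affine c0 s0 tf); exact: tint_Ig_le.
by rewrite -(normrN s) -(N1_affine (- c0) sN0 tf); exact: tint_Ig_le.
Qed.

Lemma fold_col f m : tint f -> tint (fun y => ev f (y, m)) /\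
  forall a b, Ig a b (fun y => nrm (ev f (y, m))) <= 2 * N1 f.
Proof.
move=> tf; have [h1 h2] := tint_abs_affine (- (2 * m)) (oner_neq0 R) tf.
have e : (fun t => f `|- (2 * m) + 1 * t|) = (fun y => ev f (y, m)).
  by apply/funext => t; rewrite /ev/= mul1r addrC.
rewrite -e; split=> // a b; have := h2 a b; rewrite normr1 divr1.
have -> // : (fun t => nrm (f `|- (2 * m) + 1 * t|)) = (fun y => nrm (ev f (y, m))).
by apply/funext => t; rewrite /ev/= mul1r addrC.
Qed.

Lemma fold_row f y : tint f -> tint (fun m => ev f (y, m)).
Proof.
move=> tf; have n2 : (- 2 : R) != 0 by rewrite oppr_eq0.
have [h1 _] := tint_abs_affine y n2 tf.
have e : (fun t => f `|y + - 2 * t|) = (fun m => ev f (y, m)).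
  by apply/funext => t; rewrite /ev/= mulNr.
by rewrite -e.
Qed.

Lemma nrm_od f z : nrm (od f z) = nrm (ev f z).
Proof. exact: nrm_sg. Qed.

Lemma tint_od_col f m : tint f -> tint (fun y => od f (y, m)) /\
  forall a b, Ig a b (fun y => nrm (od f (y, m))) <= 2 * N1 f.
Proof.
move=> tf; have [h1 h2] := fold_col m tf; split.
  apply: (tint_dom h1) => [|t]; last by rewrite nrm_od.
  by apply: (mxmeas_comp _ (mxmeas_od tf.1)); apply: measurable_fun_pair.
by move=> a b; rewrite (@Ig_eq _ _ _ _ (fun y => nrm (ev f (y, m))))// => t _; rewrite nrm_od.
Qed.

Lemma tint_od_row f y : tint f -> tint (fun m => od f (y, m)).
Proof.
move=> tf; have h1 := fold_row y tf; apply: (tint_dom h1) => [|t]; last by rewrite nrm_od.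
by apply: (mxmeas_comp _ (mxmeas_od tf.1)); apply: measurable_fun_pair.
Qed.

Lemma cint_fold_left f m x : tint f -> 0 <= m <= x -> x <= 2 * m ->
  cint m x (fun y => ev f (y, m)) = cint 0 m f - cint 0 (2 * m - x) f.
Proof.
move=> tf /andP[m0 mx] x2m.
have hN : (- 1 : R) != 0 by rewrite oppr_eq0.
have ht t : Icc m x t <-> Icc (2 * m - x) m (2 * m + - 1 * t).
  by rewrite /Icc/=; split=> /andP[h1 h2]; apply/andP; split; lra.
have [_] := cint_affine hN tf.1 ht (tint_cintegrable _ _ tf).
rewrite normrN normr1 [Complex 1 0](_ : _ = 1)// scale1r => e.
have -> : cint m x (fun y => ev f (y, m)) = cint m x (fun t => f (2 * m + - 1 * t)).
  apply: cint_eq => t /andP[mt tx]; rewrite /ev/=; congr f.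
  by rewrite ler0_norm; lra.
have h0 : 0 <= 2 * m - x by lra.
have hm : 2 * m - x <= m by lra.
by rewrite -e (cint_chasles h0 hm (tint_cintegrable _ _ tf)) addrAC subrr add0r.
Qed.

Lemma cint_fold_right f m x : tint f -> 2 * m <= x ->
  cint (2 * m) x (fun y => ev f (y, m)) = cint 0 (x - 2 * m) f.
Proof.
move=> tf x2m.
have ht t : Icc (2 * m) x t <-> Icc 0 (x - 2 * m) (- (2 * m) + 1 * t).
  by rewrite /Icc/=; split=> /andP[h1 h2]; apply/andP; split; lra.
have [_] := cint_affine (oner_neq0 R) tf.1 ht (tint_cintegrable _ _ tf).
rewrite normr1 [Complex 1 0](_ : _ = 1)// scale1r => ->.
apply: cint_eq => t /andP[mt tx]; rewrite /ev/=; congr f.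
by rewrite ger0_norm; lra.
Qed.

(** The fold y -> |y - 2m| has a corner at 2m: to its left g is traversed backwards, which the sign
    in [od] records, and to its right forwards. *)
Lemma ev_prim r f g : tint f -> (forall x, Icc 0 r x -> g x = g 0 + cint 0 x f) ->
  forall m x, 0 <= m <= x -> x <= r ->
  ev g (x, m) = ev g (m, m) + cint m x (fun y => od f (y, m)).
Proof.
move=> tf hg m x mx xr; have /andP[m0 mx'] := mx.
have em : ev g (m, m) = g 0 + cint 0 m f.
  rewrite /ev/= (_ : `|m - 2 * m| = m); last by rewrite ler0_norm; lra.
  by apply: hg; rewrite /Icc/= m0 (le_trans mx' xr).
have tod := (tint_od_col m tf).1.
have tev := (fold_col m tf).1.
have left z : m <= z -> z <= 2 * m -> cint m z (fun y => od f (y, m)) = - cint m z (fun y => ev f (y, m)).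
  move=> mz z2; rewrite -(cintN (tint_cintegrable m z tev)); apply: cint_eq => t /andP[_ tz].
  by rewrite /od /sg/= (_ : t - 2 * m <= 0) ?scaleN1r//; lra.
rewrite em; have [x2|x2] := leP x (2 * m).
  rewrite (left x mx' x2) (cint_fold_left tf mx x2) opprB [_ - cint 0 m f]addrC addrA addrK.
  rewrite /ev/= (_ : `|x - 2 * m| = 2 * m - x); last by rewrite ler0_norm; lra.
  by rewrite hg//; apply/andP; split; lra.
have m2 : m <= 2 * m by lra.
rewrite (cint_chasles m2 (ltW x2) (tint_cintegrable _ _ tod)) (left _ m2 (lexx _)).
have mm : 0 <= m <= 2 * m by rewrite m0.
rewrite (cint_fold_left tf mm (lexx _)) subrr cint_pt subr0.
have -> : cint (2 * m) x (fun y => od f (y, m)) = cint (2 * m) x (fun y => ev f (y, m)).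
  apply: cint_eq_oc; [exact: tint_cintegrable tod|exact: tint_cintegrable tev|].
  move=> t /andP[t1 t2]; rewrite /od /sg/= ifF ?scale1r//.
  by apply/negbTE; rewrite -ltNge subr_gt0.
rewrite (cint_fold_right tf (ltW x2)) addrA addrK.
rewrite /ev/= (_ : `|x - 2 * m| = x - 2 * m); last by rewrite gtr0_norm; lra.
by rewrite hg//; apply/andP; split; lra.
Qed.

(** Here g is a primitive vanishing at 0, so its odd extension has no jump at y = 2m. *)
Lemma od_prim r f g : tint f -> (forall x, Icc 0 r x -> g x = cint 0 x f) ->
  forall m x, 0 <= m <= x -> x <= r ->
  od g (x, m) = od g (m, m) + cint m x (fun y => ev f (y, m)).
Proof.
move=> tf hg m x mx xr; have /andP[m0 mx'] := mx.
have em : od g (m, m) = - cint 0 m f.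
  rewrite /od/= (_ : `|m - 2 * m| = m); last by rewrite ler0_norm; lra.
  rewrite /sg (_ : m - 2 * m <= 0) ?scaleN1r; last by lra.
  by congr (- _); apply: hg; rewrite /Icc/= m0 (le_trans mx' xr).
have tev := (fold_col m tf).1.
rewrite em; have [x2|x2] := leP x (2 * m).
  rewrite (cint_fold_left tf mx x2) addrA addNr sub0r.
  rewrite /od/= (_ : `|x - 2 * m| = 2 * m - x); last by rewrite ler0_norm; lra.
  rewrite /sg (_ : x - 2 * m <= 0) ?scaleN1r; last by lra.
  by rewrite hg//; apply/andP; split; lra.
have m2 : m <= 2 * m by lra.
have mm : 0 <= m <= 2 * m by rewrite m0.
rewrite (cint_chasles m2 (ltW x2) (tint_cintegrable _ _ tev)).
rewrite (cint_fold_left tf mm (lexx _)) subrr cint_pt subr0 addrA addNr add0r.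
rewrite (cint_fold_right tf (ltW x2)).
rewrite /od/= (_ : `|x - 2 * m| = x - 2 * m); last by rewrite gtr0_norm; lra.
rewrite /sg ifF ?scale1r; last by apply/negbTE; rewrite -ltNge subr_gt0.
by rewrite hg//; apply/andP; split; lra.
Qed.

End Folding.
End Transmutation.

(** * The transmutation operators and their intertwining relations *)

Section TransmutationOperators.
Variable R : realType.
Local Notation C := (R[i]).
Local Notation mu := (@lebesgue_measure R).
Local Notation ig a b f := (mu.-integrable (Icc a b) (EFin \o f)).
Local Notation Ig a b f := (Rintegral mu (Icc a b) f).
Hint Resolve measurable_Icc : core.
Local Opaque cint cintegrable.

Variables (r : R) (p : nat) (v psi : R -> 'M[C]_p) (b : 'M[C]_p) (c : R).
Hypothesis r0 : 0 <= r.
Hypothesis mv : mxmeas setT v.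
Hypothesis mpsi : mxmeas setT psi.
Hypothesis bv : forall x, nrm (v x) <= c.
Hypothesis bpsi : forall x, nrm (psi x) <= c.
Variables (n : R * R -> 'M[C]_p) (cn : R).
Hypothesis mn : mxmeas setT n.
Hypothesis bn : forall z, nrm (n z) <= cn.
Hypothesis hn : forall z, n z = kernel_map r v psi b n z.

Let c0 : 0 <= c. Proof. exact: le_trans (nrm_ge0 _) (bv 0). Qed.
Let cn0 : 0 <= cn. Proof. exact: le_trans (nrm_ge0 _) (bn (0, 0)). Qed.
Let w := wk v psi n.

Let mw : mxmeas setT w. Proof. exact: mxmeas_wk. Qed.

Let bw z : nrm (w z) <= c * (cn + 2 * c).
Proof.
apply: (le_trans (nrmM _ _)); apply: ler_pM; rewrite ?nrm_ge0//.
by apply: (le_trans (nrmD _ _)); apply: lerD => //; exact: nrm_phik.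
Qed.

Lemma kernel_diag y : Icc 0 r y -> n (y, y) = v y *m b.
Proof.
move=> /andP[y0 yr]; rewrite hn /kernel_map /tri/= y0 lexx yr /=.
by rewrite cint_pt addr0.
Qed.

Lemma kernel_prim m x : 0 <= m <= x -> x <= r ->
  n (x, m) = n (m, m) + cint m x (fun y => w (y, m)).
Proof.
move=> /andP[m0 mx] xr; rewrite kernel_diag; last by rewrite /Icc/= m0 (le_trans mx xr).
by rewrite hn /kernel_map /tri/= m0 mx xr.
Qed.

Section Operators.
Variable q : nat.
Implicit Types (f g : R -> 'M[C]_(p, q)) (G e : R * R -> 'M[C]_(p, q)).

Definition Tn G (x : R) : 'M[C]_(p, q) := cint 0 x (fun m => n (x, m) *m G (x, m)).
Definition Tpsi f (x : R) : 'M[C]_(p, q) := cint 0 x (fun s => psi s *m f (x - s)).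
Definition T1 f (x : R) : 'M[C]_(p, q) := b *m f x + Tn (ev f) x + Tpsi f x.
Definition T2 f (x : R) : 'M[C]_(p, q) := b *m f x + Tn (od f) x + Tpsi f x.

Lemma Tn_prim G e cG ce X : Icc 0 r X ->
  mxmeas setT G -> mxmeas setT e ->
  (forall y m, 0 <= m <= y -> y <= r -> nrm (G (y, m)) <= cG) ->
  (forall m, tint (fun y => e (y, m)) /\
     forall s t, Ig s t (fun y => nrm (e (y, m))) <= ce) ->
  (forall y, tint (fun m => e (y, m))) ->
  (forall m x, 0 <= m <= x -> x <= r -> G (x, m) = G (m, m) + cint m x (fun y => e (y, m))) ->
  let D y := n (y, y) *m G (y, y) + (cint 0 y (fun m => w (y, m) *m G (y, m)) + Tn e y) in
  cintegrable 0 X D /\ Tn G X = cint 0 X D.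
Proof.
move=> /andP[X0 Xr] mG me hG he1 he2 hp.
apply: (@leibniz_triangle R X p p q n w G e cn (c * (cn + 2 * c)) cG ce) => //.
- by move=> y m my yX; split=> //; apply: hG => //; exact: le_trans Xr.
- by move=> m _; have [t1 t2] := he1 m; split; [exact: tint_cintegrable|exact: t2].
- by move=> y _; exact: tint_cintegrable (he2 y).
- by move=> m x mx xX; apply: kernel_prim => //; exact: le_trans Xr.
- by move=> m x mx xX; apply: hp => //; exact: le_trans Xr.
Qed.

Lemma cint_reflect y (F : R -> 'M[C]_(p, q)) : 0 <= y -> mxmeas setT F -> cintegrable 0 y F ->
  cint 0 y F = cint 0 y (fun t => F (y - t)).
Proof.
move=> y0 mF hF.
have hN : (- 1 : R) != 0 by rewrite oppr_eq0.
have ht t : Icc 0 y t <-> Icc 0 y (y + - 1 * t).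
  by rewrite /Icc/=; split=> /andP[h1 h2]; apply/andP; split; lra.
have [_] := cint_affine hN mF ht hF.
rewrite normrN normr1 [Complex 1 0](_ : _ = 1)// scale1r => ->.
by apply: cint_eq => t _; rewrite mulN1r.
Qed.

Section Bounded.
Variables (g : R -> 'M[C]_(p, q)) (cg : R).
Hypothesis mg : mxmeas setT g.
Hypothesis bg : forall x, nrm (g x) <= cg.

Let cg0 : 0 <= cg. Proof. exact: le_trans (nrm_ge0 _) (bg 0). Qed.

Lemma Tpsi_integrable a x y : cintegrable a x (fun s => psi s *m g (y - s)).
Proof.
apply: (@cintegrable_bdd _ _ _ _ _ _ (c * cg)).
  apply: (mxmeas_sub measurableT (@subsetT _ _)).
  by apply: mxmeasM => //; apply: (mxmeas_comp _ mg); apply: measurable_funB.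
by move=> t _; apply: (le_trans (nrmM _ _)); apply: ler_pM; rewrite ?nrm_ge0.
Qed.

(** The substitution s = 2 (y - m) maps the upper half of [0, y] onto the whole; the 2 in [phik] is
    its Jacobian. At the midpoint m = y / 2 the value of [G] is not prescribed, hence the comparison
    on a half-open interval. *)
Lemma cint_phik y (G : R * R -> 'M[C]_(p, q)) : 0 <= y ->
  mxmeas setT G -> (forall z, nrm (G z) <= cg) ->
  (forall m, y < 2 * m <= 2 * y -> G (y, m) = g (2 * m - y)) ->
  cintegrable 0 y (fun m => phik psi (y, m) *m G (y, m)) /\
  cint 0 y (fun m => phik psi (y, m) *m G (y, m)) = Tpsi g y.
Proof.
move=> y0 mG bG hG.
have hi : cintegrable 0 y (fun m => phik psi (y, m) *m G (y, m)).
  apply: (@cintegrable_bdd _ _ _ _ _ _ (2 * c * cg)).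
    by apply: mxmeasM; apply: mxmeas_slice => //; exact: mxmeas_phik.
  move=> t _; apply: (le_trans (nrmM _ _)); apply: ler_pM; rewrite ?nrm_ge0//.
  exact: nrm_phik.
split=> //.
have y2 : 0 <= y / 2 by lra.
have y2' : y / 2 <= y by lra.
rewrite (cint_chasles y2 y2' hi).
have -> : cint 0 (y / 2) (fun m => phik psi (y, m) *m G (y, m)) = 0.
  rewrite (@cint_eq _ _ _ _ _ _ (fun=> 0)); first by rewrite cint_cst// scaler0.
  move=> t /andP[_ ty]; rewrite /phik/= ifF ?mul0mx//.
  by apply/negbTE; rewrite -leNgt; lra.
rewrite add0r.
have hN : (- 2 : R) != 0 by rewrite oppr_eq0.
have ht t : Icc (y / 2) y t <-> Icc 0 y (2 * y + - 2 * t).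
  by rewrite /Icc/=; split=> /andP[h1 h2]; apply/andP; split; lra.
have mF : mxmeas setT (fun s => psi s *m g (y - s)).
  by apply: mxmeasM => //; apply: (mxmeas_comp _ mg); apply: measurable_funB.
have [hi2] := cint_affine hN mF ht (Tpsi_integrable 0 y y).
rewrite -/(Tpsi g y) => ->; rewrite normrN ger0_norm//.
rewrite -(cint_rlin (@rlin_scale R p q _) hi2).
apply: cint_eq_oc; [exact: cintegrable_sub hi|exact: (cintegrable_rlin (@rlin_scale R p q _) hi2)|].
move=> t /andP[t1 t2]; rewrite hG; last by apply/andP; split; lra.
rewrite /phik/= ifT; last by lra.
rewrite -scalemxAl (_ : 2 * (y - t) = 2 * y + - 2 * t); last by lra.
by rewrite (_ : y - (2 * y + - 2 * t) = 2 * t - y)//; lra.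
Qed.

(** The change m -> y - m moves the reflection from [n] to [G], so that the parity of [G] decides
    what remains. *)
Lemma cint_wk y (G : R * R -> 'M[C]_(p, q)) : 0 <= y ->
  mxmeas setT G -> (forall z, nrm (G z) <= cg) ->
  (forall m, y < 2 * m <= 2 * y -> G (y, m) = g (2 * m - y)) ->
  cint 0 y (fun m => w (y, m) *m G (y, m)) =
  v y *m (cint 0 y (fun m => n (y, m) *m G (y, y - m)) + Tpsi g y).
Proof.
move=> y0 mG bG hG.
have [hi1 e1] := cint_phik y0 mG bG hG.
have hi2 : cintegrable 0 y (fun m => n (y, y - m) *m G (y, m)).
  apply: (@cintegrable_bdd _ _ _ _ _ _ (cn * cg)).
    by apply: mxmeasM; [apply: (mxmeas_slice (K := fun z => n (z.1, z.1 - z.2)));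
      exact: mxmeas_refl|exact: mxmeas_slice].
  by move=> t _; apply: (le_trans (nrmM _ _)); apply: ler_pM; rewrite ?nrm_ge0.
have -> : cint 0 y (fun m => n (y, m) *m G (y, y - m)) = cint 0 y (fun m => n (y, y - m) *m G (y, m)).
  have mF : mxmeas setT (fun m => n (y, m) *m G (y, y - m)).
    apply: mxmeasM; first exact: mxmeas_slice.
    apply: (mxmeas_comp _ mG); apply: measurable_fun_pair => //.
    by apply: measurable_funB.
  have hF : cintegrable 0 y (fun m => n (y, m) *m G (y, y - m)).
    apply: (@cintegrable_bdd _ _ _ _ _ _ (cn * cg)).
      exact: (mxmeas_sub measurableT (@subsetT _ _) mF).
    by move=> t _; apply: (le_trans (nrmM _ _)); apply: ler_pM; rewrite ?nrm_ge0.
  by rewrite (cint_reflect y0 mF hF); apply: cint_eq => t _; rewrite subKr.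
rewrite -e1 -(cintD hi2 hi1) -(cint_mulmxl _ (cintegrableD hi2 hi1)).
by apply: cint_eq => t _; rewrite /w /wk/= -mulmxA -mulmxDl.
Qed.

Lemma cint_wk_ev y : 0 <= y ->
  cint 0 y (fun m => w (y, m) *m ev g (y, m)) = v y *m (Tn (ev g) y + Tpsi g y).
Proof.
move=> y0.
have hG m : y < 2 * m <= 2 * y -> ev g (y, m) = g (2 * m - y).
  by move=> /andP[m1 m2]; rewrite /ev/= ltr0_norm ?opprB//; lra.
have bG z : nrm (ev g z) <= cg by exact: bg.
rewrite (cint_wk y0 (mxmeas_ev mg) bG hG).
have e t : ev g (y, y - t) = ev g (y, t).
  by rewrite /ev/= -normrN (_ : - (y - 2 * (y - t)) = y - 2 * t)//; lra.
have -> // : cint 0 y (fun m => n (y, m) *m ev g (y, y - m)) = Tn (ev g) y.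
by apply: cint_eq => t _; rewrite e.
Qed.

Lemma cint_wk_od y : 0 <= y -> g 0 = 0 ->
  cint 0 y (fun m => w (y, m) *m od g (y, m)) = - (v y *m (Tn (od g) y + Tpsi g y)).
Proof.
move=> y0 g00.
(* On the upper half the odd fold equals -g(2m - y), so [cint_wk] is applied to its negative. *)
have -> : cint 0 y (fun m => w (y, m) *m od g (y, m)) =
    - cint 0 y (fun m => w (y, m) *m (- od g (y, m))).
  rewrite -cintN; first by apply: cint_eq => t _; rewrite mulmxN opprK.
  apply: (@cintegrable_bdd _ _ _ _ _ _ (c * (cn + 2 * c) * cg)).
    apply: mxmeasM; first exact: mxmeas_slice.
    apply: (mxmeas_slice (K := fun z => - od g z)).
    exact: (mxmeas_rlin (@rlin_opp R p q) (mxmeas_od mg)).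
  move=> t _; apply: (le_trans (nrmM _ _)); apply: ler_pM; rewrite ?nrm_ge0//.
  by rewrite nrmN nrm_od; exact: bg.
have hG m : y < 2 * m <= 2 * y -> - od g (y, m) = g (2 * m - y).
  move=> /andP[m1 m2]; rewrite /od/= /sg ifT; last by lra.
  by rewrite scaleN1r opprK ltr0_norm ?opprB//; lra.
have bG z : nrm (- od g z) <= cg by rewrite nrmN nrm_od; exact: bg.
have mG := mxmeas_rlin (@rlin_opp R p q) (mxmeas_od mg).
rewrite (cint_wk (G := fun z => - od g z) y0 mG bG hG).
(* [sg] is odd except at 0; there y = 2t, and g(0) = 0 makes both sides vanish. *)
have e t : - od g (y, y - t) = od g (y, t).
  rewrite /od/= (_ : y - 2 * (y - t) = - (y - 2 * t)); last by lra.
  rewrite normrN; have [->|ne] := eqVneq (y - 2 * t) 0.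
    by rewrite normr0 g00 !scaler0 oppr0.
  rewrite -scaleNr /sg; have [h|h] := leP (y - 2 * t) 0.
    by rewrite ifF//; apply/negbTE; rewrite -ltNge oppr_gt0 lt_neqAle ne.
  by rewrite ifT ?opprK// oppr_le0 ltW.
have -> // : cint 0 y (fun m => n (y, m) *m (- od g (y, y - m))) = Tn (od g) y.
by apply: cint_eq => t _; rewrite e.
Qed.

End Bounded.

(** The Leibniz rule for psi(m), constant in y and so of density 0, and the shifted function g(y -
    m); the diagonal contributes the boundary term psi g(0). *)
Lemma Tpsi_prim f g cg X : tint f -> mxmeas setT g -> (forall x, nrm (g x) <= cg) ->
  (forall x, Icc 0 r x -> g x = g 0 + cint 0 x f) -> Icc 0 r X ->
  let D y := psi y *m g 0 + Tpsi f y in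
  cintegrable 0 X D /\ Tpsi g X = cint 0 X D.
Proof.
move=> tf mg bg hg /andP[X0 Xr] D.
have cg0 : 0 <= cg by exact: le_trans (nrm_ge0 _) (bg 0).
have mdiff : measurable_fun setT (fun z : R * R => z.1 - z.2) by apply: measurable_funB.
have tcol m : tint (fun y => f (y - m)) /\ forall s t, Ig s t (fun y => nrm (f (y - m))) <= N1 f.
  have e : (fun y => f (y - m)) = (fun y => f (- m + 1 * y)).
    by apply/funext => y; rewrite mul1r addrC.
  have tt := tint_affine (- m) (oner_neq0 R) tf; rewrite -e in tt.
  have eN := N1_affine (- m) (oner_neq0 R) tf; rewrite -e normr1 divr1 in eN.
  by split=> // s t; rewrite -eN; exact: tint_Ig_le.
have trow y : tint (fun m => f (y - m)).
  have hN : (- 1 : R) != 0 by rewrite oppr_eq0.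
  have := tint_affine y hN tf.
  by rewrite (_ : (fun t => f (y + -1 * t)) = (fun m => f (y - m)))//; apply/funext => t; rewrite mulN1r.
have [] := @leibniz_triangle R X p p q (fun z => psi z.2) (fun=> 0) (fun z => g (z.1 - z.2))
   (fun z => f (z.1 - z.2)) c 0 cg (N1 f) X0.
- exact: (mxmeas_comp _ mpsi).
- exact: mxmeas_cst.
- exact: (mxmeas_comp mdiff mg).
- exact: (mxmeas_comp mdiff tf.1).
- by move=> y m _ _; rewrite nrm0; split.
- by move=> m _; have [t1 t2] := tcol m; split; [exact: tint_cintegrable t1|exact: t2].
- by move=> y _; exact: tint_cintegrable (trow y).
- by move=> m x /andP[_ mx] _; rewrite cint_cst// scaler0 addr0.
- move=> m x /andP[m0 mx] xX /=; rewrite subrr hg; last by apply/andP; split; lra.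
  have ht t : Icc m x t <-> Icc 0 (x - m) (- m + 1 * t).
    by rewrite /Icc/=; split=> /andP[h1 h2]; apply/andP; split; lra.
  have [_] := cint_affine (oner_neq0 R) tf.1 ht (tint_cintegrable _ _ tf).
  rewrite normr1 [Complex 1 0](_ : _ = 1)// scale1r => ->.
  have -> // : cint m x (fun t => f (- m + 1 * t)) = cint m x (fun y => f (y - m)).
  by apply: cint_eq => t _; rewrite mul1r addrC.
have eD y : Icc 0 X y -> psi y *m g (y - y) + (cint 0 y (fun m => 0 *m g (y - m)) +
    cint 0 y (fun m => psi m *m f (y - m))) = D y.
  move=> /andP[y0 _]; rewrite subrr (@cint_eq _ _ _ _ _ (fun m => 0 *m g (y - m)) (fun=> 0)).
    by rewrite cint_cst// scaler0 add0r.
  by move=> t _; rewrite mul0mx.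
move=> /= hi e; split; first exact: (cintegrable_eq eD hi).
by rewrite /Tpsi e; exact: (cint_eq eD).
Qed.

(** The diagonal value v b g and the integral of [wk] complete v T1 g, while b f, the odd fold of f
    and the convolution with f make up T2 f. *)
Lemma T1_prim f g cg X : tint f -> mxmeas setT g -> (forall x, nrm (g x) <= cg) ->
  (forall x, Icc 0 r x -> g x = g 0 + cint 0 x f) -> Icc 0 r X ->
  let D y := v y *m T1 g y + T2 f y + psi y *m g 0 in
  cintegrable 0 X D /\ T1 g X = b *m g 0 + cint 0 X D.
Proof.
move=> tf mg bg hg Xr D; have /andP[X0 Xr'] := Xr.
have [i1 e1] := Tpsi_prim tf mg bg hg Xr.
have [i2 e2] : let D' y := n (y, y) *m ev g (y, y) +
    (cint 0 y (fun m => w (y, m) *m ev g (y, m)) + Tn (od f) y) in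
    cintegrable 0 X D' /\ Tn (ev g) X = cint 0 X D'.
  apply: (@Tn_prim (ev g) (od f) cg (2 * N1 f)) => //.
  - exact: mxmeas_ev.
  - exact: mxmeas_od tf.1.
  - by move=> y m _ _; exact: bg.
  - by move=> m; exact: tint_od_col.
  - by move=> y; exact: tint_od_row.
  - exact: (ev_prim tf hg).
have hfX := tint_cintegrable 0 X tf.
have i3 := cintegrable_mulmxl b hfX.
have i12 := cintegrableD i2 i1; have i123 := cintegrableD i3 i12.
have eD y : Icc 0 X y -> b *m f y + (n (y, y) *m ev g (y, y) +
   (cint 0 y (fun m => w (y, m) *m ev g (y, m)) + Tn (od f) y) +
   (psi y *m g 0 + Tpsi f y)) = D y.
  move=> /andP[y0 yX].
  rewrite kernel_diag; last by rewrite /Icc/= y0 (le_trans yX Xr').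
  rewrite (cint_wk_ev mg bg y0).
  have -> : ev g (y, y) = g y.
    by rewrite /ev/= (_ : y - 2 * y = - y) ?normrN ?ger0_norm//; lra.
  rewrite /D /T1 /T2.
  move: (Tn (ev g) y) (Tpsi g y) (Tn (od f) y) (Tpsi f y) => A1 A2 A3 A4.
  rewrite !mulmxDr !mulmxA.
  by rewrite [LHS](AC (1*(1*((1*1)*1)*(1*1))) ((2*3*4)*(1*5*7)*6)).
split; first exact: (cintegrable_eq eD i123).
rewrite -(cint_eq eD) (cintD i3 i12) (cintD i2 i1) -e1 -e2 (cint_mulmxl _ hfX).
by rewrite /T1 (hg X Xr) mulmxDr !addrA.
Qed.

(** As for [T1_prim], but the odd fold equals -g on the diagonal and is reversed by the reflection,
    so every term with v changes sign; g(0) = 0 removes the boundary term. *)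
Lemma T2_prim f g cg X : tint f -> mxmeas setT g -> (forall x, nrm (g x) <= cg) ->
  (forall x, Icc 0 r x -> g x = cint 0 x f) -> Icc 0 r X ->
  let D y := - (v y *m T2 g y) + T1 f y in
  cintegrable 0 X D /\ T2 g X = cint 0 X D.
Proof.
move=> tf mg bg hg Xr D; have /andP[X0 Xr'] := Xr.
have g00 : g 0 = 0 by rewrite hg ?cint_pt// /Icc/= lexx.
have hg' x : Icc 0 r x -> g x = g 0 + cint 0 x f by move=> /hg ->; rewrite g00 add0r.
have [i1 e1] := Tpsi_prim tf mg bg hg' Xr.
have [i2 e2] : let D' y := n (y, y) *m od g (y, y) +
    (cint 0 y (fun m => w (y, m) *m od g (y, m)) + Tn (ev f) y) in
    cintegrable 0 X D' /\ Tn (od g) X = cint 0 X D'.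
  apply: (@Tn_prim (od g) (ev f) cg (2 * N1 f)) => //.
  - exact: mxmeas_od.
  - exact: mxmeas_ev tf.1.
  - by move=> y m _ _; rewrite nrm_od; exact: bg.
  - by move=> m; exact: fold_col.
  - by move=> y; exact: fold_row.
  - exact: (od_prim tf hg).
have hfX := tint_cintegrable 0 X tf.
have i3 := cintegrable_mulmxl b hfX.
have i12 := cintegrableD i2 i1; have i123 := cintegrableD i3 i12.
have eD y : Icc 0 X y -> b *m f y + (n (y, y) *m od g (y, y) +
   (cint 0 y (fun m => w (y, m) *m od g (y, m)) + Tn (ev f) y) +
   (psi y *m g 0 + Tpsi f y)) = D y.
  move=> /andP[y0 yX].
  rewrite kernel_diag; last by rewrite /Icc/= y0 (le_trans yX Xr').
  rewrite (cint_wk_od mg bg y0 g00).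
  have -> : od g (y, y) = - g y.
    rewrite /od/= (_ : y - 2 * y = - y); last by lra.
    by rewrite normrN ger0_norm// /sg ifT ?scaleN1r// oppr_le0.
  rewrite g00 mulmx0 add0r /D /T1 /T2.
  move: (Tn (od g) y) (Tpsi g y) (Tn (ev f) y) (Tpsi f y) => A1 A2 A3 A4.
  rewrite mulmxN !mulmxDr !mulmxA !opprD.
  by rewrite [LHS](AC (1*(1*((1*1)*1)*1)) ((2*3*4)*(1*5*6))).
split; first exact: (cintegrable_eq eD i123).
rewrite -(cint_eq eD) (cintD i3 i12) (cintD i2 i1) -e1 -e2 (cint_mulmxl _ hfX).
by rewrite /T2 (hg X Xr) !addrA.
Qed.

(** Both operators are causal: |x - 2t| <= x for 0 <= t <= x, so only values on [0, x] enter. *)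
Lemma T_ext f g x : (forall t, Icc 0 r t -> f t = g t) -> Icc 0 r x ->
  T1 f x = T1 g x /\ T2 f x = T2 g x.
Proof.
move=> fg xr; have /andP[x0 xr'] := xr.
have eP : Tpsi f x = Tpsi g x.
  by apply: cint_eq => t /andP[t0 tx]; rewrite fg//; apply/andP; split; lra.
have ee t : Icc 0 x t -> f `|x - 2 * t| = g `|x - 2 * t|.
  move=> /andP[t0 tx]; apply: fg; apply/andP; split=> //.
  by rewrite ler_norml; apply/andP; split; lra.
have eE : Tn (ev f) x = Tn (ev g) x by apply: cint_eq => t /ee h; rewrite /ev/= h.
have eO : Tn (od f) x = Tn (od g) x by apply: cint_eq => t /ee h; rewrite /od/= h.
by rewrite /T1 /T2 (fg x xr) eP eE eO.
Qed.

(** Extending g and its density by zero gives the bounds on the whole line that [T1_prim] asks for;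
    causality leads back to g. *)
Lemma T1_ac f g : ac r g f ->
  T1 g 0 = b *m g 0 /\ ac r (T1 g) (fun y => v y *m T1 g y + T2 f y + psi y *m g 0).
Proof.
move=> ag; have [hf hg] := ag.
have [cg bg] := ac_bdd ag.
pose f' := patch0 0 r f; pose g' := patch0 0 r g.
have ef t : Icc 0 r t -> f' t = f t by exact: patch0E.
have eg t : Icc 0 r t -> g' t = g t by exact: patch0E.
have r00 : Icc 0 r 0 by rewrite /Icc/= lexx.
have bg' x : nrm (g' x) <= cg.
  rewrite /g' /patch0; case: ifP => [xr|_]; first exact: bg.
  by rewrite nrm0 (le_trans (nrm_ge0 _) (bg 0 r00)).
have hg' x : Icc 0 r x -> g' x = g' 0 + cint 0 x f'.
  move=> xr; have /andP[x0 xr'] := xr; rewrite (eg _ xr) (eg _ r00) (hg _ xr).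
  have -> // : cint 0 x f' = cint 0 x f.
  by apply: cint_eq => t /andP[t0 tx]; rewrite (ef t (introT andP (conj t0 (le_trans tx xr')))).
have H x : Icc 0 r x ->
    cintegrable 0 x (fun y => v y *m T1 g' y + T2 f' y + psi y *m g' 0) /\
    T1 g' x = b *m g' 0 + cint 0 x (fun y => v y *m T1 g' y + T2 f' y + psi y *m g' 0).
  exact: (T1_prim (tint_patch hf) (mxmeas_patch (ac_meas ag)) bg' hg').
have eD y : Icc 0 r y -> v y *m T1 g' y + T2 f' y + psi y *m g' 0 =
    v y *m T1 g y + T2 f y + psi y *m g 0.
  by move=> yr; rewrite (T_ext eg yr).1 (T_ext ef yr).2 (eg 0 r00).
have e0 : T1 g 0 = b *m g 0.
  by rewrite -(T_ext eg r00).1 (H 0 r00).2 cint_pt addr0 (eg 0 r00).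
have rr : Icc 0 r r by rewrite /Icc/= lexx andbT.
split=> //; split; first exact: (cintegrable_eq eD (H r rr).1).
move=> x xr; have /andP[x0 xr'] := xr.
have eC : cint 0 x (fun y => v y *m T1 g' y + T2 f' y + psi y *m g' 0) =
    cint 0 x (fun y => v y *m T1 g y + T2 f y + psi y *m g 0).
  by apply: cint_eq => t /andP[t0 tx]; exact: (eD t (introT andP (conj t0 (le_trans tx xr')))).
by rewrite e0 -(T_ext eg xr).1 (H x xr).2 eC (eg 0 r00).
Qed.

Lemma T2_ac f g : ac r g f -> g 0 = 0 ->
  T2 g 0 = 0 /\ ac r (T2 g) (fun y => - (v y *m T2 g y) + T1 f y).
Proof.
move=> ag g00; have [hf hg] := ag.
have [cg bg] := ac_bdd ag.
pose f' := patch0 0 r f; pose g' := patch0 0 r g.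
have ef t : Icc 0 r t -> f' t = f t by exact: patch0E.
have eg t : Icc 0 r t -> g' t = g t by exact: patch0E.
have r00 : Icc 0 r 0 by rewrite /Icc/= lexx.
have bg' x : nrm (g' x) <= cg.
  rewrite /g' /patch0; case: ifP => [xr|_]; first exact: bg.
  by rewrite nrm0 (le_trans (nrm_ge0 _) (bg 0 r00)).
have hg' x : Icc 0 r x -> g' x = cint 0 x f'.
  move=> xr; have /andP[x0 xr'] := xr; rewrite (eg _ xr) (hg _ xr) g00 add0r.
  by apply: cint_eq => t /andP[t0 tx]; rewrite (ef t (introT andP (conj t0 (le_trans tx xr')))).
have H x : Icc 0 r x ->
    cintegrable 0 x (fun y => - (v y *m T2 g' y) + T1 f' y) /\
    T2 g' x = cint 0 x (fun y => - (v y *m T2 g' y) + T1 f' y).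
  exact: (T2_prim (tint_patch hf) (mxmeas_patch (ac_meas ag)) bg' hg').
have eD y : Icc 0 r y -> - (v y *m T2 g' y) + T1 f' y = - (v y *m T2 g y) + T1 f y.
  by move=> yr; rewrite (T_ext eg yr).2 (T_ext ef yr).1.
have e0 : T2 g 0 = 0 by rewrite -(T_ext eg r00).2 (H 0 r00).2 cint_pt.
have rr : Icc 0 r r by rewrite /Icc/= lexx andbT.
split=> //; split; first exact: (cintegrable_eq eD (H r rr).1).
move=> x xr; have /andP[x0 xr'] := xr.
rewrite e0 -(T_ext eg xr).2 (H x xr).2 add0r.
by apply: cint_eq => t /andP[t0 tx]; exact: (eD t (introT andP (conj t0 (le_trans tx xr')))).
Qed.

(** The Leibniz rule against a constant; the resulting density is bounded, hence in L_2. *)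
Lemma triangle_h1 (nu w' : R * R -> 'M[C]_p) (cw : R) (A : 'M[C]_(p, q)) :
  mxmeas setT nu -> mxmeas setT w' -> (forall z, nrm (nu z) <= cn) ->
  (forall z, nrm (w' z) <= cw) ->
  (forall m x, 0 <= m <= x -> x <= r -> nu (x, m) = nu (m, m) + cint m x (fun y => w' (y, m))) ->
  h1 r (fun x => cint 0 x (fun m => nu (x, m) *m A)).
Proof.
move=> mnu mw' bnu bw' hnu.
have cw0 : 0 <= cw by exact: le_trans (nrm_ge0 _) (bw' (0, 0)).
pose D y := nu (y, y) *m A + (cint 0 y (fun m => w' (y, m) *m A) +
   cint 0 y (fun m => nu (y, m) *m (0 : 'M[C]_(p, q)))).
have H X : Icc 0 r X -> cintegrable 0 X D /\ cint 0 X (fun m => nu (X, m) *m A) = cint 0 X D.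
  move=> /andP[X0 Xr].
  have mA : mxmeas setT (fun _ : R * R => A) by exact: mxmeas_cst.
  have m0 : mxmeas setT (fun _ : R * R => 0 : 'M[C]_(p, q)) by exact: mxmeas_cst.
  apply: (@leibniz_triangle R X p p q nu w' (fun=> A) (fun=> 0) cn cw (nrm A) 0 X0 mnu mw' mA m0).
  - by move=> y m _ _; split.
  - move=> m /andP[m1 mX]; split; first exact: cintegrable_cst.
    by rewrite nrm0 Ig_cst// mul0r.
  - by move=> y _; exact: cintegrable_cst.
  - by move=> m x mx xX; apply: hnu => //; exact: le_trans Xr.
  - by move=> m x /andP[_ mx] _; rewrite cint_cst// scaler0 addr0.
have rr : Icc 0 r r by rewrite /Icc/= lexx andbT.
have r00 : Icc 0 r 0 by rewrite /Icc/= lexx.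
exists D; last first.
  split; first exact: (H r rr).1.
  by move=> x xr; rewrite (H x xr).2 cint_pt add0r.
apply: (@L2_bdd _ _ _ _ _ (cn * nrm A + cw * nrm A * r)).
  exact: (cintegrable_meas (H r rr).1).
move=> y /andP[y0 yr]; apply: (le_trans (nrmD _ _)); apply: lerD.
  by apply: (le_trans (nrmM _ _)); rewrite ler_wpM2r ?nrm_ge0.
have -> : cint 0 y (fun m => nu (y, m) *m (0 : 'M[C]_(p, q))) = 0.
  rewrite (@cint_eq _ _ _ _ _ _ (fun=> 0)); first by rewrite cint_cst// scaler0.
  by move=> t _; rewrite mulmx0.
have bwA t : nrm (w' (y, t) *m A) <= cw * nrm A.
  by apply: (le_trans (nrmM _ _)); rewrite ler_wpM2r ?nrm_ge0.
have iwA : cintegrable 0 y (fun m => w' (y, m) *m A).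
  apply: (@cintegrable_bdd _ _ _ _ _ _ (cw * nrm A)) => //.
  by apply: mxmeasM; [exact: mxmeas_slice|exact: mxmeas_cst].
rewrite addr0; apply: (le_trans (nrm_cint iwA)).
apply: (@le_trans _ _ (Ig 0 y (fun=> cw * nrm A))).
  by apply: Ig_le => //; [exact: cintegrable_nrm|exact: ig_cst].
by rewrite Ig_cst// subr0 ler_wpM2l// mulr_ge0// nrm_ge0.
Qed.

(** [T2_ac] does not reach constants, whose odd extension jumps. On a constant the n-integral is the
    integral over [0, x/2] minus the one over [x/2, x], that is twice the first minus the full one.
    With m = s / 2 the doubled half becomes a full triangle integral of n(x, s/2), to which
    [triangle_h1] applies. *)
Lemma T2_cst (A : 'M[C]_(p, q)) :
  h1 r (T2 (fun=> A)) /\ T2 (fun=> A) 0 = b *m A.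
Proof.
have mn2 : mxmeas setT (fun z : R * R => n (z.1, z.2 / 2)).
  by apply: (mxmeas_comp _ mn); apply: measurable_fun_pair => //; apply: measurable_funM.
have mw2 : mxmeas setT (fun z : R * R => w (z.1, z.2 / 2)).
  by apply: (mxmeas_comp _ mw); apply: measurable_fun_pair => //; apply: measurable_funM.
have h1a : h1 r (fun x => cint 0 x (fun m => n (x, m) *m A)).
  by apply: (@triangle_h1 n w (c * (cn + 2 * c))) => // m x; exact: kernel_prim.
have h1b : h1 r (fun x => cint 0 x (fun s => n (x, s / 2) *m A)).
  have bn2 (z : R * R) : nrm (n (z.1, z.2 / 2)) <= cn by exact: bn.
  have bw2 (z : R * R) : nrm (w (z.1, z.2 / 2)) <= c * (cn + 2 * c) by exact: bw.
  apply: (triangle_h1 A mn2 mw2 bn2 bw2) => s x /andP[s0 sx] xr /=.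
  (* The primitive of n(., s/2) starts at s/2, while the new kernel has its diagonal at x = s, so
     the integral is cut at s. *)
  have s1 : 0 <= s / 2 <= x by apply/andP; split; lra.
  have s2 : 0 <= s / 2 <= s by apply/andP; split; lra.
  rewrite (kernel_prim s1 xr) (kernel_prim s2 (le_trans sx xr)) -addrA.
  have /andP[_ s2'] := s2.
  have iw : cintegrable (s / 2) x (fun y => w (y, s / 2)).
    apply: (@cintegrable_bdd _ _ _ _ _ _ (c * (cn + 2 * c))); first exact: mxmeas_col.
    by move=> t _; exact: bw.
  by rewrite (cint_chasles s2' sx iw).
have h1c : h1 r (fun x => b *m A + cint 0 x (fun s => psi s *m A)).
  have Lp : L2 r (fun s => psi s *m A).
    apply: (@L2_bdd _ _ _ _ _ (c * nrm A)).
      apply: mxmeasM; last exact: mxmeas_cst.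
      exact: (mxmeas_sub measurableT (@subsetT _ _) mpsi).
    by move=> t _; apply: (le_trans (nrmM _ _)); rewrite ler_wpM2r ?nrm_ge0.
  by exists (fun s => psi s *m A) => //; apply: ac_prim; exact: L2_cintegrable.
have h1a' : h1 r (fun x => (- 1)%:M *m cint 0 x (fun m => n (x, m) *m A)).
  by apply: h1M => //; exact: h1_cst.
split; last by rewrite /T2 /Tn /Tpsi !cint_pt !addr0.
apply: h1_ext (h1D (h1D h1b h1a') h1c) => x /andP[x0 xr].
rewrite /T2 /Tpsi.
suff -> : Tn (od (fun=> A)) x = cint 0 x (fun s => n (x, s / 2) *m A) +
    (- 1)%:M *m cint 0 x (fun m => n (x, m) *m A).
  by rewrite [LHS](AC (2*2) ((3*(1*2))*4)).
pose F m := n (x, m) *m A.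
have mF : mxmeas setT F by apply: mxmeasM; [exact: mxmeas_slice|exact: mxmeas_cst].
have bF m : nrm (F m) <= cn * nrm A by apply: (le_trans (nrmM _ _)); rewrite ler_wpM2r ?nrm_ge0.
have iF s t : cintegrable s t F.
  by apply: (cintegrable_bdd (c := cn * nrm A)) => //; exact: (mxmeas_sub measurableT (@subsetT _ _) mF).
have iG s t : cintegrable s t (fun m => n (x, m) *m od (fun=> A) (x, m)).
  apply: (cintegrable_bdd (c := cn * nrm A)).
    apply: mxmeasM; apply: mxmeas_slice => //.
    by apply: mxmeas_od; exact: mxmeas_cst.
  by move=> m _; apply: (le_trans (nrmM _ _)); rewrite nrm_od ler_wpM2r ?nrm_ge0.
have x1 : 0 <= x / 2 by lra.
have x2 : x / 2 <= x by lra.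
rewrite /Tn (cint_chasles x1 x2 (iG _ _)).
have -> : cint 0 (x / 2) (fun m => n (x, m) *m od (fun=> A) (x, m)) = cint 0 (x / 2) F.
  apply: (cint_eq_co (iG _ _) (iF _ _)) => t /andP[t0 tx].
  by rewrite /od/= /sg ifF ?scale1r//; apply/negbTE; rewrite -ltNge; lra.
have -> : cint (x / 2) x (fun m => n (x, m) *m od (fun=> A) (x, m)) = - cint (x / 2) x F.
  rewrite -(cintN (iF _ _)); apply: cint_eq => t /andP[t0 tx].
  rewrite /od/= /sg ifT; last by lra.
  by rewrite scaleN1r mulmxN.
have h2 : (2^-1 : R) != 0 by rewrite invr_eq0.
have ht t : Icc 0 x t <-> Icc 0 (x / 2) (0 + 2^-1 * t).
  by rewrite /Icc/=; split=> /andP[k1 k2]; apply/andP; split; lra.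
have [_ eF] := cint_affine h2 mF ht (iF _ _).
have e2 : cint 0 x (fun s => n (x, s / 2) *m A) = cint 0 (x / 2) F + cint 0 (x / 2) F.
  have -> : cint 0 x (fun s => n (x, s / 2) *m A) = cint 0 x (fun t => F (0 + 2^-1 * t)).
    by apply: cint_eq => t _; rewrite /F add0r mulrC.
  rewrite eF -scalerDl -[LHS]scale1r; apply: congr2 => //.
  by apply: ri_inj => e; rewrite riD; case: e => /=; rewrite ?addr0// ger0_norm//; lra.
rewrite e2 mul_scalar_mx scaleN1r (cint_chasles x1 x2 (iF _ _)) opprD.
by rewrite addrACA subrr add0r.
Qed.

Lemma T2D_bounded f g cf x : mxmeas setT f -> mxmeas setT g ->
  (forall t, nrm (f t) <= cf) -> (forall t, nrm (g t) <= cf) ->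
  T2 (fun t => f t + g t) x = T2 f x + T2 g x.
Proof.
move=> mf mg bf bg.
have iO (h : R -> 'M[C]_(p, q)) : mxmeas setT h -> (forall t, nrm (h t) <= cf) ->
    cintegrable 0 x (fun m => n (x, m) *m od h (x, m)).
  move=> mh bh; apply: (@cintegrable_bdd _ _ _ _ _ _ (cn * cf)).
    by apply: mxmeasM; apply: mxmeas_slice => //; exact: mxmeas_od.
  move=> t _; apply: (le_trans (nrmM _ _)); apply: ler_pM; rewrite ?nrm_ge0//.
  by rewrite nrm_od; exact: bh.
have e1 : Tn (od (fun t => f t + g t)) x = Tn (od f) x + Tn (od g) x.
  rewrite /Tn -(cintD (iO f mf bf) (iO g mg bg)); apply: cint_eq => t _.
  by rewrite /od/= scalerDr mulmxDr.
have e2 : Tpsi (fun t => f t + g t) x = Tpsi f x + Tpsi g x.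
  rewrite /Tpsi -(cintD (Tpsi_integrable mf bf 0 x x) (Tpsi_integrable mg bg 0 x x)).
  by apply: cint_eq => t _; rewrite mulmxDr.
rewrite /T2 e1 e2; move: (Tn _ _) (Tn _ _) (Tpsi _ _) (Tpsi _ _) => A1 A2 A3 A4.
by rewrite mulmxDr [LHS](AC (2*2*2) ((1*3*5)*(2*4*6))).
Qed.

Lemma T2_cstD f g (A : 'M[C]_(p, q)) x : ac r g f -> Icc 0 r x ->
  T2 (fun t => A + g t) x = T2 (fun=> A) x + T2 g x.
Proof.
move=> ag xr; have [cg bg] := ac_bdd ag.
pose g' := patch0 0 r g.
have eg t : Icc 0 r t -> g' t = g t by exact: patch0E.
have eA t : Icc 0 r t -> A + g' t = A + g t by move=> /eg ->.
have r00 : Icc 0 r 0 by rewrite /Icc/= lexx.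
have cg0 : 0 <= cg by exact: le_trans (nrm_ge0 _) (bg 0 r00).
have bg' t : nrm (g' t) <= cg + nrm A.
  rewrite /g' /patch0; case: ifP => [tr|_]; last by rewrite nrm0 addr_ge0 ?nrm_ge0.
  by apply: (le_trans (bg t tr)); rewrite lerDl nrm_ge0.
have bA (t : R) : nrm A <= cg + nrm A by rewrite lerDr.
rewrite -(T_ext eA xr).2 -(T_ext eg xr).2.
have mA : mxmeas setT (fun _ : R => A) by exact: mxmeas_cst.
exact: (T2D_bounded (f := fun=> A) (g := g') x mA (mxmeas_patch (ac_meas ag)) bA bg').
Qed.

(** The kernel of T1 in the variable t = |x - 2m|: the branches are m = (x - t)/2 and m = (x + t)/2,
    each with Jacobian 1/2, and the convolution contributes psi(x - t). *)
Definition kernel1 (z : R * R) : 'M[C]_p :=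
  Complex 2^-1 0 *: (n (z.1, (z.1 - z.2) / 2) + n (z.1, (z.1 + z.2) / 2)) + psi (z.1 - z.2).

Lemma T1_kernel f x : cintegrable 0 r f -> Icc 0 r x ->
  T1 f x = b *m f x + cint 0 x (fun t => kernel1 (x, t) *m f t).
Proof.
move=> hf xr; have /andP[x0 xr'] := xr.
pose f' := patch0 0 r f.
have ef t : Icc 0 r t -> f' t = f t by exact: patch0E.
have tf : tint f' by exact: tint_patch.
have mf := tf.1.
have -> : cint 0 x (fun t => kernel1 (x, t) *m f t) = cint 0 x (fun t => kernel1 (x, t) *m f' t).
  by apply: cint_eq => t /andP[t0 tx]; rewrite (ef t (introT andP (conj t0 (le_trans tx xr')))).
rewrite -(T_ext ef xr).1 -(ef x xr) /T1 -addrA; apply: congr1.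
pose F m := n (x, m) *m ev f' (x, m).
have mF : mxmeas setT F by apply: mxmeasM; apply: mxmeas_slice => //; exact: mxmeas_ev.
have iF s t : cintegrable s t F.
  apply: (cintegrableMl (c := cn)) => //; first exact: mxmeas_slice.
  exact: tint_cintegrable (fold_row x tf).
have x1 : 0 <= x / 2 by lra.
have x2 : x / 2 <= x by lra.
have ha : (- 2^-1 : R) != 0 by rewrite oppr_eq0 invr_eq0.
have hb : (2^-1 : R) != 0 by rewrite invr_eq0.
have ht1 t : Icc 0 x t <-> Icc 0 (x / 2) (x / 2 + - 2^-1 * t).
  by rewrite /Icc/=; split=> /andP[k1 k2]; apply/andP; split; lra.
have ht2 t : Icc 0 x t <-> Icc (x / 2) x (x / 2 + 2^-1 * t).
  by rewrite /Icc/=; split=> /andP[k1 k2]; apply/andP; split; lra.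
have [i1 e1] := cint_affine ha mF ht1 (iF _ _).
have [i2 e2] := cint_affine hb mF ht2 (iF _ _).
rewrite normrN in e1; rewrite ger0_norm ?invr_ge0// in e1 e2.
have mpf : mxmeas setT (fun s => psi s *m f' (x - s)).
  by apply: mxmeasM => //; apply: (mxmeas_comp _ mf); apply: measurable_funB.
have ipf : cintegrable 0 x (fun s => psi s *m f' (x - s)).
  apply: (cintegrableMl (c := c)) => //.
    exact: (mxmeas_sub measurableT (@subsetT _ _) mpsi).
  have hN : (- 1 : R) != 0 by rewrite oppr_eq0.
  have := tint_cintegrable 0 x (tint_affine x hN tf).
  by apply: cintegrable_eq => t _; rewrite mulN1r.
have epf : Tpsi f' x = cint 0 x (fun t => psi (x - t) *m f' t).
  by rewrite /Tpsi (cint_reflect x0 mpf ipf); apply: cint_eq => t _; rewrite subKr.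
have ipf' : cintegrable 0 x (fun t => psi (x - t) *m f' t).
  apply: (cintegrableMl (c := c)) => //; last exact: tint_cintegrable tf.
  apply: (mxmeas_sub measurableT (@subsetT _ _)).
  by apply: (mxmeas_comp _ mpsi); apply: measurable_funB.
have sc := @rlin_scale R p q (Complex 2^-1 0).
have e1' := etrans e1 (esym (cint_rlin sc i1)).
have e2' := etrans e2 (esym (cint_rlin sc i2)).
rewrite /Tn (cint_chasles x1 x2 (iF _ _)) e1' e2' epf.
have j1 := cintegrable_rlin sc i1; have j2 := cintegrable_rlin sc i2.
rewrite -(cintD j1 j2) -(cintD (cintegrableD j1 j2) ipf').
apply: cint_eq => t /andP[t0 tx]; rewrite /kernel1/= mulmxDl -scalemxAl mulmxDl scalerDr /F /ev/=.
have -> : x - 2 * (x / 2 + - 2^-1 * t) = t by lra.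
have -> : x - 2 * (x / 2 + 2^-1 * t) = - t by lra.
have -> : x / 2 + - 2^-1 * t = (x - t) / 2 by lra.
have -> : x / 2 + 2^-1 * t = (x + t) / 2 by lra.
by rewrite normrN ger0_norm.
Qed.

End Operators.

Lemma mxmeas_kernel1 : mxmeas setT kernel1.
Proof.
apply: mxmeasD; last by apply: (mxmeas_comp _ mpsi); apply: measurable_funB.
apply: (mxmeas_rlin (@rlin_scale R p p _)); apply: mxmeasD;
  apply: (mxmeas_comp _ mn); apply: measurable_fun_pair => //; apply: measurable_funM => //.
  by apply: measurable_funB.
by apply: measurable_funD.
Qed.

Lemma nrm_kernel1 z : nrm (kernel1 z) <= cn + c.
Proof.
apply: (le_trans (nrmD _ _)); apply: lerD => //.
rewrite nrmZ ger0_norm ?invr_ge0//.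
have := le_trans (nrmD _ _) (lerD (bn (z.1, (z.1 - z.2) / 2)) (bn (z.1, (z.1 + z.2) / 2))).
by move: (nrm _) => a; lra.
Qed.

End TransmutationOperators.

Section TransmutationExistence.
Variable R : realType.
Local Notation C := (R[i]).

(* [T1] and [T2] intertwine [d/dx] with [d/dx - v] and [d/dx + v]; the boundary
   term [psi] prescribes [T1] on the constants. *)
Lemma transmutation_exists (r : R) p (v psi : R -> 'M[C]_p) (b : 'M[C]_p) (c : R) :
  0 <= r -> mxmeas (Icc 0 r) v -> mxmeas (Icc 0 r) psi ->
  (forall x, Icc 0 r x -> nrm (v x) <= c) ->
  (forall x, Icc 0 r x -> nrm (psi x) <= c) ->
  exists (k : R * R -> 'M[C]_p) (ck : R)
         (T1 T2 : (R -> 'cV[C]_p) -> (R -> 'cV[C]_p)),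
  [/\ mxmeas setT k /\ (forall z, nrm (k z) <= ck),
      forall f x, cintegrable 0 r f -> Icc 0 r x ->
        T1 f x = b *m f x + cint 0 x (fun t => k (x, t) *m f t),
      forall f g x, (forall t, Icc 0 r t -> f t = g t) -> Icc 0 r x ->
        T1 f x = T1 g x /\ T2 f x = T2 g x,
      forall f g, ac r g f ->
        T1 g 0 = b *m g 0 /\ ac r (T1 g) (fun y => v y *m T1 g y + T2 f y + psi y *m g 0) &
      [/\ forall f g, ac r g f -> g 0 = 0 ->
             T2 g 0 = 0 /\ ac r (T2 g) (fun y => - (v y *m T2 g y) + T1 f y),
          forall A, h1 r (T2 (fun=> A)) /\ T2 (fun=> A) 0 = b *m A &
          forall f g A x, ac r g f -> Icc 0 r x ->
            T2 (fun t => A + g t) x = T2 (fun=> A) x + T2 g x]].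
Proof.
move=> r0 mv mpsi bv bpsi.
have r00 : Icc 0 r 0 by rewrite /Icc/= lexx.
have c0 : 0 <= c by exact: le_trans (nrm_ge0 _) (bv 0 r00).
pose v' := patch0 0 r v; pose psi' := patch0 0 r psi.
have ev' t : Icc 0 r t -> v' t = v t by exact: patch0E.
have ep' t : Icc 0 r t -> psi' t = psi t by exact: patch0E.
have mv' : mxmeas setT v' by exact: mxmeas_patch.
have mp' : mxmeas setT psi' by exact: mxmeas_patch.
have bv' x : nrm (v' x) <= c.
  by rewrite /v' /patch0; case: ifP => [xr|_]; [exact: bv|rewrite nrm0].
have bp' x : nrm (psi' x) <= c.
  by rewrite /psi' /patch0; case: ifP => [xr|_]; [exact: bpsi|rewrite nrm0].
have [n [cn [mn bn hn]]] := kernel_exists r b mv' mp' bv' bp'.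
exists (kernel1 psi' n), (cn + c), (@T1 R p psi' b n 1), (@T2 R p psi' b n 1); split.
- by split; [exact: mxmeas_kernel1|move=> z; exact: nrm_kernel1].
- by move=> f x hf xr; exact: (T1_kernel b mp' bp' mn bn hf xr).
- by move=> f g x fg xr; exact: T_ext fg xr.
- move=> f g ag; have [h2 h3] := T1_ac r0 mv' mp' bv' bp' mn bn hn ag.
  split; first exact: h2.
  by apply: ac_ext h3 => x xr; last rewrite (ev' x xr) (ep' x xr).
- split.
  + move=> f g ag g0; have [h2 h3] := T2_ac r0 mv' mp' bv' bp' mn bn hn ag g0.
    split; first exact: h2.
    by apply: ac_ext h3 => x xr; last rewrite (ev' x xr).
  + by move=> A; exact: (T2_cst r0 mv' mp' bv' bp' mn bn hn A).
  + by move=> f g A x ag xr; exact: (T2_cstD b r0 mp' bp' mn bn A ag xr).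
Qed.

End TransmutationExistence.

(** * Absolute continuity of the inverse of a matrix function *)

Section InverseFunction.
Variable R : realType.
Local Notation C := (R[i]).
Local Notation mu := (@lebesgue_measure R).
Local Notation ig a b f := (mu.-integrable (Icc a b) (EFin \o f)).
Local Notation Ig a b f := (Rintegral mu (Icc a b) f).
Hint Resolve measurable_Icc : core.
Local Opaque cint cintegrable.

Lemma rlin_trmx m n : rlin (fun M : 'M[C]_(m, n) => M^T).
Proof. by split=> [*|*]; apply/matrixP => i j; rewrite !mxE. Qed.

(** Transposition turns the right coefficient into the Volterra kernel A(t)^T, constant in x. *)
Lemma volterra_unique_right r m p (A : R -> 'M[C]_p) (d : R -> 'M[C]_(m, p)) c :
  0 <= r -> mxmeas (Icc 0 r) A -> (forall x, Icc 0 r x -> nrm (A x) <= c) ->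
  cintegrable 0 r d -> (forall x, Icc 0 r x -> d x = cint 0 x (fun t => d t *m A t)) ->
  forall x, Icc 0 r x -> d x = 0.
Proof.
move=> r0 mA bA hd eqd x xr; rewrite -[d x]trmxK.
have r00 : Icc 0 r 0 by rewrite /Icc/= lexx.
have nT k l (M : 'M[C]_(k, l)) : nrm M^T = nrm M.
  by rewrite /nrm exchange_big; apply: eq_bigr => i _; apply: eq_bigr => j _; rewrite mxE.
pose A' := patch0 0 r (fun t => (A t)^T).
have mA' : mxmeas setT (fun z : R * R => A' z.2).
  apply: (mxmeas_comp (g := snd)) => //; apply: mxmeas_patch.
  exact: (mxmeas_rlin (@rlin_trmx _ _) mA).
have bA' (z : R * R) : nrm (A' z.2) <= c.
  rewrite /A' /patch0; case: ifP => [h|_]; first by rewrite nT bA.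
  by rewrite nrm0 (le_trans (nrm_ge0 _) (bA 0 r00)).
have hdT := cintegrable_rlin (@rlin_trmx m p) hd.
suff -> : (d x)^T = 0 by rewrite trmx0.
apply: (volterra_unique mA' bA' hdT _ xr) => {xr}x xr; have /andP[x0 xr'] := xr.
have i1 : cintegrable 0 x (fun t => d t *m A t).
  apply: (cintegrableMr (c := c)).
  - exact: (mxmeas_sub (measurable_Icc 0 r) (sub_Icc (lexx 0) xr') mA).
  - by move=> t /andP[t0 tx]; apply: bA; rewrite /Icc/= t0 (le_trans tx).
  - exact: cintegrable_sub hd.
rewrite (eqd x xr) -(cint_rlin (@rlin_trmx m p) i1); apply: cint_eq => t /andP[t0 tx].
by rewrite trmx_mul /A' patch0E// /Icc/= t0 (le_trans tx).
Qed.

Section Inverse.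
Variables (r : R) (p : nat) (Y dY : R -> 'M[C]_p) (K : R).
Hypothesis r0 : 0 <= r.
Hypothesis aY : ac r Y dY.
Hypothesis hdY : h1 r dY.
Hypothesis uY : forall x, Icc 0 r x -> Y x \in unitmx.
Hypothesis bZ : forall x, Icc 0 r x -> nrm (invmx (Y x)) <= K.

(** The identity Y(x)^-1 - Y(y)^-1 = Y(x)^-1 (Y(y) - Y(x)) Y(y)^-1 and the uniform bound on the
    inverses make the inverse Lipschitz, hence continuous and measurable. *)
Lemma invmx_meas : mxmeas (Icc 0 r) (fun x => invmx (Y x)).
Proof.
have [d Ld ad] := hdY; have [cd bd] := ac_bdd ad.
have r00 : Icc 0 r 0 by rewrite /Icc/= lexx.
have K0 : 0 <= K by exact: le_trans (nrm_ge0 _) (bZ r00).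
have cd0 : 0 <= cd by exact: le_trans (nrm_ge0 _) (bd 0 r00).
have [hY eY] := aY.
have lip x y : Icc 0 r x -> Icc 0 r y -> x <= y -> nrm (Y y - Y x) <= cd * (y - x).
  move=> xr yr xy; have /andP[x0 xr'] := xr; have /andP[y0 yr'] := yr.
  have i1 := cintegrable_sub (lexx 0) yr' hY; have i2 := cintegrable_sub x0 yr' hY.
  rewrite (eY x xr) (eY y yr) (cint_chasles x0 xy i1).
  rewrite opprD addrACA subrr add0r addrAC subrr add0r.
  apply: (le_trans (nrm_cint i2)); rewrite -(Ig_cst cd xy).
  apply: Ig_le; [exact: cintegrable_nrm|exact: ig_cst|].
  by move=> t /andP[xt ty]; apply: bd; apply/andP; split; [exact: le_trans xt|exact: le_trans yr'].
have lip' x y : Icc 0 r x -> Icc 0 r y -> nrm (Y y - Y x) <= cd * `|y - x|.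
  move=> xr yr; have [xy|yx] := leP x y; first by rewrite ger0_norm ?subr_ge0//; exact: lip.
  by rewrite nrmB distrC ger0_norm ?subr_ge0 ?(ltW yx)//; apply: lip => //; exact: ltW.
have lipZ x y : Icc 0 r x -> Icc 0 r y ->
    nrm (invmx (Y x) - invmx (Y y)) <= K * K * cd * `|y - x|.
  move=> xr yr.
  have -> : invmx (Y x) - invmx (Y y) = invmx (Y x) *m (Y y - Y x) *m invmx (Y y).
    rewrite mulmxBr mulmxBl -[invmx _ *m _ *m _]mulmxA (mulmxV (uY yr)) mulmx1.
    by rewrite (mulVmx (uY xr)) mul1mx.
  apply: (le_trans (nrmM _ _)); apply: (@le_trans _ _ (K * (cd * `|y - x|) * K)).
    apply: ler_pM; rewrite ?nrm_ge0//; last exact: bZ.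
    apply: (le_trans (nrmM _ _)); apply: ler_pM; rewrite ?nrm_ge0//; first exact: bZ.
    exact: lip'.
  by rewrite le_eqVlt; apply/orP; left; apply/eqP; ring.
move=> e i j; rewrite IccE; apply: subspace_continuous_measurable_fun => //.
apply/subspace_continuousP; rewrite -IccE => x xr.
apply/cvgrPdist_le => eps eps0; apply/nbhs_ballP.
have L0 : 0 < K * K * cd + 1 by rewrite ltr_wpDl// !mulr_ge0.
exists (eps / (K * K * cd + 1)) => /=; first by rewrite divr_gt0.
move=> y xy yr.
have h : `|ri e (invmx (Y x) i j) - ri e (invmx (Y y) i j)| <= K * K * cd * `|y - x|.
  apply: le_trans (lipZ x y xr yr); apply: le_trans (ri_le_nrm _ e i j).
  have -> // : (invmx (Y x) - invmx (Y y)) i j = invmx (Y x) i j - invmx (Y y) i j.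
    by rewrite mxE [X in _ + X]mxE.
  by rewrite riD riN.
apply: (le_trans h); move: xy; rewrite /ball/= distrC ltr_pdivlMr// => /ltW; apply: le_trans.
by rewrite mulrDr mulr1 mulrC lerDl.
Qed.

(** The primitive P of the expected derivative, started at Y(0)^-1, is compared with the inverse: S
    = P Y - 1 satisfies S' = S Y^-1 Y' and S(0) = 0, so it vanishes. *)
Lemma invmx_ac : ac r (fun x => invmx (Y x)) (fun x => - (invmx (Y x) *m dY x *m invmx (Y x))).
Proof.
pose Z x := invmx (Y x).
have mZ : mxmeas (Icc 0 r) Z by exact: invmx_meas.
have [d Ld ad] := hdY; have [cd bd] := ac_bdd ad; have md := ac_meas ad.
have r00 : Icc 0 r 0 by rewrite /Icc/= lexx.
have K0 : 0 <= K by exact: le_trans (nrm_ge0 _) (bZ r00).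
pose z x := - (Z x *m dY x *m Z x).
have iz : cintegrable 0 r z.
  apply: cintegrableN; apply: (cintegrableMr mZ bZ); apply: (cintegrableMl mZ bZ).
  by case: aY.
pose P x := Z 0 + cint 0 x z.
have aP : ac r P z by exact: ac_prim.
pose S x := P x *m Y x - 1%:M.
have aPY := acM aP aY.
have e x : Icc 0 r x -> z x *m Y x + P x *m dY x = S x *m (Z x *m dY x).
  move=> xr; rewrite /S /z mulmxBl mul1mx mulNmx -[Z x *m dY x *m _ *m _]mulmxA.
  by rewrite (mulVmx (uY xr)) mulmx1 !mulmxA (mulmxK (uY xr)) addrC.
have P0 : P 0 *m Y 0 = 1%:M by rewrite /P cint_pt addr0 (mulVmx (uY r00)).
have aS : ac r S (fun x => S x *m (Z x *m dY x)).
  have := acD aPY (ac_cst r (- (1%:M : 'M[C]_p))).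
  by apply: ac_ext => x xr //; rewrite addr0 e.
have mA : mxmeas (Icc 0 r) (fun x => Z x *m dY x) by apply: mxmeasM.
have bA x : Icc 0 r x -> nrm (Z x *m dY x) <= K * cd.
  by move=> xr; apply: (le_trans (nrmM _ _)); apply: ler_pM; rewrite ?nrm_ge0 ?bZ ?bd.
have S0 x : Icc 0 r x -> S x = 0.
  apply: (volterra_unique_right r0 mA bA (L2_cintegrable (ac_L2 aS))).
  by move=> y yr; have [_ h] := aS; rewrite {1}(h y yr) {1}/S P0 subrr add0r.
apply: ac_ext aP => // x xr.
have /eqP := S0 x xr; rewrite subr_eq0 => /eqP h.
by rewrite -[P x](mulmxK (uY xr)) h mul1mx.
Qed.

Lemma invmx_h1 : h1 r (fun x => invmx (Y x)).
Proof.
have [d Ld ad] := hdY; have [cd bd] := ac_bdd ad.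
apply: (ac_h1 invmx_ac).
apply: (@L2_ext _ _ _ _ (fun x => - 1 *: (invmx (Y x) *m dY x *m invmx (Y x)))).
  by move=> t _; rewrite scaleN1r.
by apply: L2Z; apply: (L2Mr invmx_meas bZ); apply: (L2Ml invmx_meas bZ); exact: (ac_L2 ad).
Qed.

End Inverse.
End InverseFunction.

(** * Algebra of the blocks: invertibility of Y and X with uniform bounds *)

Section BlockAlgebra.
Variable R : realType.
Local Notation C := (R[i]).

Local Notation im := (Complex 0 1 : C).

Lemma mxstarM m n k (A : 'M[C]_(m, n)) (B : 'M[C]_(n, k)) :
  mxstar (A *m B) = mxstar B *m mxstar A.
Proof. by rewrite /mxstar map_mxM trmx_mul. Qed.

Lemma mxstarD m n (A B : 'M[C]_(m, n)) : mxstar (A + B) = mxstar A + mxstar B.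
Proof. by case: (@rlin_star R m n). Qed.

Lemma mxstarN m n (A : 'M[C]_(m, n)) : mxstar (- A) = - mxstar A.
Proof. by apply/matrixP => i j; rewrite !mxE rmorphN. Qed.

Lemma mxstarB m n (A B : 'M[C]_(m, n)) : mxstar (A - B) = mxstar A - mxstar B.
Proof. by rewrite mxstarD mxstarN. Qed.

Lemma mxstarK m n (A : 'M[C]_(m, n)) : mxstar (mxstar A) = A.
Proof. by apply/matrixP => i j; rewrite !mxE conjCK. Qed.

Lemma mxstar_scalar n (z : C) : mxstar (z%:M : 'M[C]_n) = (Num.conj z)%:M.
Proof. by rewrite /mxstar map_scalar_mx tr_scalar_mx. Qed.

Lemma mxstar1 n : mxstar (1%:M : 'M[C]_n) = 1%:M.
Proof. by rewrite mxstar_scalar rmorph1. Qed.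

Lemma unitmx_star n (A : 'M[C]_n) : A \in unitmx -> mxstar A \in unitmx.
Proof.
move=> uA; have h : mxstar A *m mxstar (invmx A) = 1%:M by rewrite -mxstarM mulVmx// mxstar1.
by have [] := mulmx1_unit h.
Qed.

Lemma nrm_star m n (M : 'M[C]_(m, n)) : nrm (mxstar M) = nrm M.
Proof.
rewrite /nrm exchange_big; apply: eq_bigr => i _; apply: eq_bigr => j _.
by rewrite !mxE /nc /ri; case: (M i j) => a b /=; rewrite normrN.
Qed.

Lemma conj_im : Num.conj im = - im.
Proof. by apply/eqP; rewrite eq_complex /= oppr0 !eqxx. Qed.

Lemma JmxE p (B D : 'M[C]_(p, p + p)) :
  B *m Jmx p *m mxstar D = rsubmx B *m mxstar (lsubmx D) + lsubmx B *m mxstar (rsubmx D).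
Proof.
have -> : mxstar D = col_mx (mxstar (lsubmx D)) (mxstar (rsubmx D)).
  by rewrite -{1}[D]hsubmxK /mxstar map_row_mx tr_row_mx.
rewrite -{1}[B]hsubmxK /Jmx mul_row_block !mulmx0 !mulmx1 add0r addr0.
by rewrite mul_row_col.
Qed.

Lemma msq_row n (M : 'rV[C]_n) : ri false ((M *m mxstar M) 0 0) = msq M.
Proof.
rewrite mxE ri_sum /msq big_ord1; apply: eq_bigr => j _.
by rewrite !mxE; case: (M 0 j) => a b /=; rewrite mulrN opprK -!expr2.
Qed.

Let sum_le (s t k : R) : t <= (1 + k) * s -> s + t <= (2 + k) * s.
Proof. lra. Qed.

Section Blocks.
Variables (p : nat) (B1 B2 D1 D2 : 'M[C]_p).
Hypothesis hB : B2 *m mxstar B1 + B1 *m mxstar B2 = 0.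
Hypothesis hD : D2 *m mxstar B1 + D1 *m mxstar B2 = im%:M.
Let Y := B1 + B2.
Let X := B2 - B1.

Lemma YYstar : Y *m mxstar Y = X *m mxstar X.
Proof.
apply/eqP; rewrite -subr_eq0 /Y /X mxstarD mxstarB !mulmxDl !mulmxDr !mulNmx !mulmxN opprK.
have h : B1 *m mxstar B2 = - (B2 *m mxstar B1) by apply/eqP; rewrite -addr_eq0 addrC hB.
rewrite h; move: (B1 *m _) (B2 *m mxstar B1) (B2 *m mxstar B2) => a b c.
by apply/eqP/matrixP => i j; rewrite !mxE; ring.
Qed.

Lemma dYYstar : (D1 + D2) *m mxstar Y - (D2 - D1) *m mxstar X = (2 * im)%:M.
Proof.
rewrite /Y /X mxstarD mxstarB !mulmxDl !mulmxDr !mulNmx !mulmxN opprK.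
have -> : (2 * im)%:M = im%:M + im%:M :> 'M[C]_p.
  by rewrite -raddfD /= mulr_natl mulr2n.
rewrite -{1}hD -hD; move: (D1 *m mxstar B1) (D1 *m _) (D2 *m mxstar B1) (D2 *m _) => a b c d.
by apply/matrixP => i j; rewrite !mxE; ring.
Qed.

(** The adjoint of [hD]; it recovers a row c from c B1 and c B2. *)
Lemma dual_pairing : B1 *m mxstar D2 + B2 *m mxstar D1 = (- im)%:M.
Proof.
have := congr1 (@mxstar R p p) hD.
by rewrite mxstarD !mxstarM !mxstarK mxstar_scalar conj_im.
Qed.

Variable cd : R.
Hypothesis bD1 : nrm D1 <= cd.
Hypothesis bD2 : nrm D2 <= cd.

(** 2 cd comes from [dual_pairing] with the derivative blocks, and 2 + msqK from bounding |cX| +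
    |cY| by a multiple of either one. *)
Definition binv : R := 2 * cd * (2 + msqK R 1 p).

(** Equal Gram matrices give c P and c Q the same Euclidean norm. The factor 1 + k is a crude bound
    for the square root of k, the cost of passing to [nrm]. *)
Let row_le (P Q : 'M[C]_p) (c : 'rV[C]_p) : P *m mxstar P = Q *m mxstar Q ->
  nrm (c *m Q) <= (1 + msqK R 1 p) * nrm (c *m P).
Proof.
move=> PQ.
have e : msq (c *m P) = msq (c *m Q).
  rewrite -!msq_row !mxstarM; congr (ri false (_ 0 0)).
  by rewrite !mulmxA -(mulmxA c P) -(mulmxA c Q) PQ.
have k0 : 0 <= msqK R 1 p by exact: ler0n.
have h : nrm (c *m Q) ^+ 2 <= msqK R 1 p * nrm (c *m P) ^+ 2.
  apply: (le_trans (nrm_sqr_le _)); rewrite -e ler_wpM2l//; exact: msq_le.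
have g0 := nrm_ge0 (c *m P).
rewrite -(ler_pXn2r (ltn0Sn 1)) ?nnegrE ?nrm_ge0 ?mulr_ge0 ?addr_ge0//.
apply: (le_trans h); rewrite exprMn ler_wpM2r ?sqr_ge0//.
by move: k0; move: (msqK R 1 p) => k k0; nra.
Qed.

(** If c Y is small then so is c X, by [YYstar]; then so are c B1 and c B2, and by [dual_pairing] so
    is c. This one estimate yields both invertibility and a bound on the inverse in terms of [cd]
    and p only. *)
Lemma row_le_Y (c : 'rV[C]_p) : nrm c <= binv * nrm (c *m Y) /\ nrm c <= binv * nrm (c *m X).
Proof.
have cd0 : 0 <= cd by exact: le_trans (nrm_ge0 _) bD1.
have h1 : nrm (c *m B1) <= nrm (c *m Y) + nrm (c *m X).
  have e : c *m B1 = Complex 2^-1 0 *: (c *m Y - c *m X).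
    rewrite -mulmxBr /Y /X opprB addrACA addrA addrC addrA addrAC addNr add0r.
    rewrite mulmxDr scalerDr -scalerDl -[LHS]scale1r; congr (_ *: _).
    by apply: ri_inj => -[]; rewrite riD /= ?addr0//; lra.
  rewrite e nrmZ ger0_norm ?invr_ge0//.
  have := nrmD (c *m Y) (- (c *m X)); rewrite nrmN.
  have := nrm_ge0 (c *m Y); have := nrm_ge0 (c *m X).
  by move: (nrm (_ - _)) (nrm (c *m Y)) (nrm (c *m X)) => a b d; lra.
have h2 : nrm (c *m B2) <= nrm (c *m Y) + nrm (c *m X).
  have e : c *m B2 = Complex 2^-1 0 *: (c *m Y + c *m X).
    rewrite -mulmxDr /Y /X addrC addrA subrK.
    rewrite mulmxDr scalerDr -scalerDl -[LHS]scale1r; congr (_ *: _).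
    by apply: ri_inj => -[]; rewrite riD /= ?addr0//; lra.
  rewrite e nrmZ ger0_norm ?invr_ge0//.
  have := nrmD (c *m Y) (c *m X).
  have := nrm_ge0 (c *m Y); have := nrm_ge0 (c *m X).
  by move: (nrm (_ + _)) (nrm (c *m Y)) (nrm (c *m X)) => a b d; lra.
have h3 : nrm c <= 2 * cd * (nrm (c *m Y) + nrm (c *m X)).
  have e : nrm c = nrm (c *m (- im)%:M).
    rewrite mul_mx_scalar /nrm; apply: eq_bigr => i _; apply: eq_bigr => j _.
    rewrite mxE /nc /ri; case: (c i j) => a b /=.
    by rewrite oppr0 !mul0r mulN1r mulN1r add0r sub0r opprK normrN addrC.
  rewrite e -dual_pairing mulmxDr !mulmxA.
  apply: (le_trans (nrmD _ _)).
  have k1 := le_trans (nrmM (c *m B1) (mxstar D2)) (ler_pM (nrm_ge0 _) (nrm_ge0 _) h1 (lexx _)).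
  have k2 := le_trans (nrmM (c *m B2) (mxstar D1)) (ler_pM (nrm_ge0 _) (nrm_ge0 _) h2 (lexx _)).
  rewrite !nrm_star in k1 k2.
  apply: (le_trans (lerD k1 k2)); rewrite -mulrDr mulrC ler_wpM2r ?addr_ge0 ?nrm_ge0//.
  by rewrite mulr_natl mulr2n; exact: lerD.
have y := nrm_ge0 (c *m Y); have x := nrm_ge0 (c *m X).
have hX := row_le c YYstar; have hY := row_le c (esym YYstar).
have cd2 : 0 <= 2 * cd by rewrite mulr_ge0.
split; apply: (le_trans h3); rewrite -(mulrA (2 * cd)); apply: (ler_wpM2l cd2).
  exact: sum_le.
by rewrite addrC; exact: sum_le.
Qed.

Let inv_bound (M : 'M[C]_p) : (forall c : 'rV[C]_p, nrm c <= binv * nrm (c *m M)) ->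
  M \in unitmx /\ nrm (invmx M) <= binv * nrm (1%:M : 'M[C]_p).
Proof.
move=> h.
have uM : M \in unitmx.
  rewrite -row_free_unit; apply: inj_row_free => c cM; apply: nrm0_eq0.
  by apply: (le_trans (h c)); rewrite cM nrm0 mulr0.
have nrow (N : 'M[C]_p) : nrm N = \sum_i nrm (row i N).
  by apply: eq_bigr => i _; rewrite /nrm big_ord1; apply: eq_bigr => j _; rewrite mxE.
split=> //; rewrite (nrow (invmx M)) (nrow 1%:M) mulr_sumr; apply: ler_sum => i _.
by apply: (le_trans (h _)); rewrite -row_mul mulVmx.
Qed.

Lemma unit_Y : Y \in unitmx /\ nrm (invmx Y) <= binv * nrm (1%:M : 'M[C]_p).
Proof. by apply: inv_bound => c; case: (row_le_Y c). Qed.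

Lemma unit_X : X \in unitmx /\ nrm (invmx X) <= binv * nrm (1%:M : 'M[C]_p).
Proof. by apply: inv_bound => c; case: (row_le_Y c). Qed.

End Blocks.
End BlockAlgebra.

(** * The unitary normalisation and the pair E, E_2 *)

Section IntertwiningPair.
Variable R : realType.
Local Notation C := (R[i]).
Local Notation im := (Complex 0 1 : C).
Hint Resolve measurable_Icc : core.
Local Opaque cint cintegrable.

Lemma h1_meas r m n (F : R -> 'M[C]_(m, n)) : h1 r F -> mxmeas (Icc 0 r) F.
Proof. by move=> [f _ aF]; exact: ac_meas aF. Qed.

Lemma h1_bdd r m n (F : R -> 'M[C]_(m, n)) : h1 r F ->
  exists c, forall x, Icc 0 r x -> nrm (F x) <= c.
Proof. by move=> [f _ aF]; exact: ac_bdd aF. Qed.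

Lemma h1Z r m n (z : C) (F : R -> 'M[C]_(m, n)) : h1 r F -> h1 r (fun x => z *: F x).
Proof.
move=> hF; apply: h1_ext (h1M (h1_cst r (z%:M)) hF) => x _.
by rewrite mul_scalar_mx.
Qed.

Lemma h1B r m n (F G : R -> 'M[C]_(m, n)) : h1 r F -> h1 r G -> h1 r (fun x => F x - G x).
Proof.
move=> hF hG; apply: h1_ext (h1D hF (h1Z (-1) hG)) => x _.
by rewrite scaleN1r.
Qed.

Lemma h1_lsubmx r m n k (F : R -> 'M[C]_(m, n + k)) : h1 r F -> h1 r (fun x => lsubmx (F x)).
Proof.
move=> hF; apply: h1_ext (h1M hF (h1_cst r (col_mx 1%:M 0))) => x _.
by rewrite -{1}[F x]hsubmxK mul_row_col mulmx1 mulmx0 addr0.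
Qed.

Lemma h1_rsubmx r m n k (F : R -> 'M[C]_(m, n + k)) : h1 r F -> h1 r (fun x => rsubmx (F x)).
Proof.
move=> hF; apply: h1_ext (h1M hF (h1_cst r (col_mx 0 1%:M))) => x _.
by rewrite -{1}[F x]hsubmxK mul_row_col mulmx1 mulmx0 add0r.
Qed.

Variables (r : R) (p : nat) (Y dY X dX B dB : R -> 'M[C]_p) (K : R).
Hypothesis r0 : 0 <= r.
Hypotheses (aY : ac r Y dY) (hdY : h1 r dY) (aX : ac r X dX) (hdX : h1 r dX).
Hypotheses (aB : ac r B dB) (hdB : h1 r dB).
Hypothesis uY : forall x, Icc 0 r x -> Y x \in unitmx.
Hypothesis uX : forall x, Icc 0 r x -> X x \in unitmx.
Hypothesis bYi : forall x, Icc 0 r x -> nrm (invmx (Y x)) <= K.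
Hypothesis bXi : forall x, Icc 0 r x -> nrm (invmx (X x)) <= K.
Hypothesis YX : forall x, Icc 0 r x -> Y x *m mxstar (Y x) = X x *m mxstar (X x).
Hypothesis dYX : forall x, Icc 0 r x ->
  dY x *m mxstar (Y x) - dX x *m mxstar (X x) = (2 * im)%:M.

Definition lcoef x := dY x *m invmx (Y x).
Definition rcoef x := mxstar (dX x *m invmx (X x)).
Local Notation a := lcoef.
Local Notation a' := rcoef.

Let r00 : Icc 0 r 0. Proof. by rewrite /Icc/= lexx. Qed.

Lemma lcoef_h1 : h1 r a.
Proof. exact: h1M hdY (invmx_h1 r0 aY hdY uY bYi). Qed.

Lemma rcoef_h1 : h1 r a'.
Proof. by apply: h1_star; exact: h1M hdX (invmx_h1 r0 aX hdX uX bXi). Qed.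

(** Let P be the common inverse of Y Y^* and X X^*. The derivative relation reads a - a'^* = 2 i P.
    As P is self-adjoint, taking adjoints gives a^* - a' = - 2 i P, and adding the two eliminates
    P. *)
Let coef_skew x : Icc 0 r x -> mxstar (a x - a' x) = - (a x - a' x).
Proof.
move=> xr; have y := uY xr; have z := uX xr.
pose P := mxstar (invmx (Y x)) *m invmx (Y x).
have ys := unitmx_star y; have zs := unitmx_star z.
have PE : P = mxstar (invmx (X x)) *m invmx (X x).
  have pu : Y x *m mxstar (Y x) \in unitmx by rewrite unitmx_mul y ys.
  have e1 : P *m (Y x *m mxstar (Y x)) = 1%:M.
    by rewrite /P -mulmxA (mulKmx y) -mxstarM mulmxV// mxstar1.
  have e2 : mxstar (invmx (X x)) *m invmx (X x) *m (Y x *m mxstar (Y x)) = 1%:M.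
    by rewrite YX// -mulmxA (mulKmx z) -mxstarM mulmxV// mxstar1.
  by rewrite -[LHS](mulmxK pu) e1 -e2 (mulmxK pu).
have e : a x - mxstar (a' x) = (2 * im) *: P.
  have e1 : a x = dY x *m mxstar (Y x) *m P.
    by rewrite /P -mulmxA (mulmxA (mxstar (Y x))) -mxstarM mulVmx// mxstar1 mul1mx.
  have e2 : mxstar (a' x) = dX x *m mxstar (X x) *m P.
    by rewrite /rcoef mxstarK PE -mulmxA (mulmxA (mxstar (X x))) -mxstarM mulVmx// mxstar1 mul1mx.
  by rewrite e1 e2 -mulmxBl dYX// mul_scalar_mx.
have Ps : mxstar P = P by rewrite /P mxstarM mxstarK.
have e' : mxstar (a x) - a' x = - ((2 * im) *: P).
  have := congr1 (@mxstar R p p) e.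
  rewrite mxstarB mxstarK => ->; rewrite -[_ *: P]mul_scalar_mx mxstarM Ps mxstar_scalar.
  rewrite mul_mx_scalar mul_scalar_mx -scaleNr; congr (_ *: _).
  by rewrite mulr_natl rmorphMn -mulNrn; congr (_ *+ _); exact: conj_im.
rewrite mxstarB opprB.
have -> : mxstar (a x) = a' x - (2 * im) *: P by rewrite -e' addrC subrK.
have -> : mxstar (a' x) = a x - (2 * im) *: P by rewrite -e opprB addrC subrK.
by rewrite opprB addrA subrK.
Qed.

Local Notation hf := (Complex 2^-1 0 : C).
Let hh x : 'M[C]_p := hf *: (a x - a' x).

Let hh_h1 : h1 r hh.
Proof. by apply: h1Z; apply: h1B; [exact: lcoef_h1|exact: rcoef_h1]. Qed.

Let hh_skew x : Icc 0 r x -> mxstar (hh x) = - hh x.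
Proof.
move=> xr; rewrite /hh; have [_ ->] := @rlin_star R p p.
by rewrite coef_skew// scalerN.
Qed.

(** u' = h u with h skew-adjoint is solved as a Volterra equation whose kernel depends on t alone;
    then u^* u has density u^* h^* u + u^* h u = 0. *)
Let unitary_exists : exists u : R -> 'M[C]_p,
  [/\ u 0 = 1%:M, ac r u (fun x => hh x *m u x) &
      forall x, Icc 0 r x -> mxstar (u x) *m u x = 1%:M].
Proof.
have mh := h1_meas hh_h1; have [c bh] := h1_bdd hh_h1.
have c0 : 0 <= c by exact: le_trans (nrm_ge0 _) (bh 0 r00).
pose H (z : R * R) := patch0 0 r hh z.2.
have mH : mxmeas setT H by apply: (mxmeas_comp (g := snd)) => //; exact: mxmeas_patch.
have bH z : nrm (H z) <= c.
  by rewrite /H /patch0; case: ifP => [h|_]; [exact: bh|rewrite nrm0].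
have [c' sol] := volterra_solve r p mH bH.
have [u [iu eu _]] := sol (fun=> 1%:M) (cintegrable_cst 0 r 1%:M).
have u0 : u 0 = 1%:M by rewrite (eu 0 r00) cint_pt addr0.
have au : ac r u (fun x => hh x *m u x).
  split; first exact: (cintegrableMl mh bh iu).
  move=> x xr; have /andP[x0 xr'] := xr.
  rewrite u0 {1}(eu x xr); apply: (congr1 (+%R 1%:M)); apply: cint_eq => t /andP[t0 tx].
  by rewrite /H /= patch0E//; exact: (introT andP (conj t0 (le_trans tx xr'))).
exists u; split=> // x xr.
have aus := ac_rlin (@rlin_star R p p) au.
have := ac_zero (acM aus au) _ xr; rewrite u0 mxstar1 mulmx1; apply=> t tr.
by rewrite mxstarM hh_skew// mulmxN mulNmx mulmxA addNr.
Qed.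

Lemma half_add (A A' : 'M[C]_p) : hf *: (A - A') + hf *: (A + A') = A.
Proof.
rewrite -scalerDr addrACA addNr addr0 scalerDr -scalerDl -[RHS]scale1r; congr (_ *: _).
by apply: ri_inj => -[]; rewrite riD /= ?addr0//; lra.
Qed.

Lemma half_sub (A A' : 'M[C]_p) : hf *: (A - A') - hf *: (A + A') = - A'.
Proof. by rewrite -[in RHS](half_add A' A) opprD -[- (hf *: (A' - A))]scalerN opprB (addrC A'). Qed.

(** The pair is u T1 and u T2. Since u' = (a - a') u / 2 and u v = (a + a') u / 2, the coefficients
    become (a - a')/2 + (a + a')/2 = a and (a - a')/2 - (a + a')/2 = - a'. *)
Lemma intertwining_pair : exists (u : R -> 'M[C]_p) (k : R * R -> 'M[C]_p) (ck : R)
    (E1 E2 : (R -> 'cV[C]_p) -> (R -> 'cV[C]_p)),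
  [/\ [/\ u 0 = 1%:M, Ucls r u &
       forall x, Icc 0 r x -> mxstar (u x) *m u x = 1%:M],
      mxmeas setT k /\ (forall z, nrm (k z) <= ck),
      forall f x, cintegrable 0 r f -> Icc 0 r x ->
        E1 f x = u x *m (B 0 *m f x + cint 0 x (fun t => k (x, t) *m f t)),
      forall f g, ac r g f -> E1 g 0 = B 0 *m g 0 /\
        ac r (E1 g) (fun y => a y *m E1 g y + E2 f y + (dB y - a y *m B y) *m g 0) &
      [/\ forall f g, ac r g f -> g 0 = 0 ->
            E2 g 0 = 0 /\ ac r (E2 g) (fun y => - (a' y *m E2 g y) + E1 f y),
          forall A, h1 r (E2 (fun=> A)) /\ E2 (fun=> A) 0 = B 0 *m A,
          forall f g A x, ac r g f -> Icc 0 r x ->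
            E2 (fun t => A + g t) x = E2 (fun=> A) x + E2 g x &
          forall f g x, (forall t, Icc 0 r t -> f t = g t) -> Icc 0 r x ->
            E2 f x = E2 g x]].
Proof.
have [u [u0 au uu]] := unitary_exists.
have uu' x : Icc 0 r x -> u x *m mxstar (u x) = 1%:M by move=> xr; apply: mulmx1C; exact: uu.
have hu : h1 r u.
  apply: (ac_h1 au); have mh := h1_meas hh_h1; have [c bh] := h1_bdd hh_h1.
  exact: (L2Ml mh bh (ac_L2 au)).
have hB : h1 r B by exact: (ac_h1 aB (h1_L2 hdB)).
pose s x := hf *: (a x + a' x).
pose v x := mxstar (u x) *m s x *m u x.
(* Chosen so that u psi = B' - a B, which makes E 1 and B solutions of the same equation with the
   same initial value. *)
pose psi x := mxstar (u x) *m (dB x - a x *m B x).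
have hv : h1 r v.
  apply: (h1M _ hu); apply: h1M; first exact: (h1_star hu).
  by apply: h1Z; apply: h1D; [exact: lcoef_h1|exact: rcoef_h1].
have hpsi : h1 r psi.
  apply: h1M; first exact: (h1_star hu).
  by apply: (h1B hdB); apply: (h1M _ hB); exact: lcoef_h1.
have [c1 b1] := h1_bdd hv; have [c2 b2] := h1_bdd hpsi.
have [||k [ck [T1 [T2 [pk kT1 Text aT1 [aT2 T2c T2D]]]]]] :=
  @transmutation_exists R r p v psi (B 0) (Num.max c1 c2) r0 (h1_meas hv) (h1_meas hpsi).
- by move=> x xr; rewrite le_max b1.
- by move=> x xr; rewrite le_max b2 ?orbT.
have uv x : Icc 0 r x -> hh x *m u x + u x *m v x = a x *m u x.
  by move=> xr; rewrite /v !mulmxA uu'// mul1mx -mulmxDl /hh /s half_add.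
have uv' x : Icc 0 r x -> hh x *m u x - u x *m v x = - (a' x *m u x).
  by move=> xr; rewrite /v !mulmxA uu'// mul1mx -mulmxBl /hh /s half_sub mulNmx.
have upsi x : Icc 0 r x -> u x *m psi x = dB x - a x *m B x.
  by move=> xr; rewrite /psi mulmxA uu'// mul1mx.
exists u, k, ck, (fun f x => u x *m T1 f x), (fun f x => u x *m T2 f x); split.
- split; [exact: u0| |exact: uu].
  exists (fun x => hh x *m u x); apply/(U_with_ac _ _ r0); split; [exact: au|exact: h1M].
- exact: pk.
- by move=> f x hf xr; rewrite (kT1 f x hf xr).
- move=> f g ag; have [e1 a1] := aT1 f g ag; split; first by rewrite u0 mul1mx e1.
  apply: ac_ext (acM au a1) => x xr; first by [].
  move: (uv x xr) (upsi x xr); move: (T1 g x) (T2 f x) (hh x) (v x) (psi x) => A A2 h w ps e2 e3.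
  by rewrite -e3 !mulmxDr !mulmxA !addrA -mulmxDl e2.
- split.
  + move=> f g ag g0; have [e1 a1] := aT2 f g ag g0; split; first by rewrite e1 mulmx0.
    apply: ac_ext (acM au a1) => x xr; first by [].
    move: (uv' x xr); move: (T2 g x) (T1 f x) (hh x) (v x) => A A2 h w e2.
    by rewrite mulmxDr mulmxN !mulmxA !addrA -mulmxBl e2 mulNmx.
  + move=> A; have [h e] := T2c A; split; first exact: h1M.
    by rewrite u0 mul1mx e.
  + by move=> f g A x ag xr; rewrite (T2D f g A x ag xr) mulmxDr.
  + by move=> f g x fg xr; have [_ ->] := Text f g x fg xr.
Qed.

End IntertwiningPair.

(** * Similarity of K and A, and the mapping properties of E *)

Section Similarity.
Variable R : realType.
Local Notation C := (R[i]).
Local Notation mu := (@lebesgue_measure R).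
Local Notation Ig a b f := (Rintegral mu (Icc a b) f).
Local Notation im := (Complex 0 1 : C).
Hint Resolve measurable_Icc : core.
Local Opaque cint cintegrable.

Variables (r : R) (p : nat) (Y dY X dX B dB : R -> 'M[C]_p) (K : R).
Hypothesis r0 : 0 <= r.
Hypotheses (aY : ac r Y dY) (hdY : h1 r dY) (aX : ac r X dX) (hdX : h1 r dX).
Hypotheses (aB : ac r B dB) (hdB : h1 r dB).
Hypothesis uY : forall x, Icc 0 r x -> Y x \in unitmx.
Hypothesis uX : forall x, Icc 0 r x -> X x \in unitmx.
Hypothesis bYi : forall x, Icc 0 r x -> nrm (invmx (Y x)) <= K.
Hypothesis bXi : forall x, Icc 0 r x -> nrm (invmx (X x)) <= K.
Hypothesis YX : forall x, Icc 0 r x -> Y x *m mxstar (Y x) = X x *m mxstar (X x).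
Hypothesis dYX : forall x, Icc 0 r x ->
  dY x *m mxstar (Y x) - dX x *m mxstar (X x) = (2 * im)%:M.
Hypothesis uB : B 0 \in unitmx.

Local Notation a := (lcoef Y dY).
Local Notation a' := (rcoef X dX).
Local Notation Yi x := (invmx (Y x)).
Local Notation Xs x := (mxstar (X x)).
Local Notation Xsi x := (mxstar (invmx (X x))).

Variables (u : R -> 'M[C]_p) (k : R * R -> 'M[C]_p) (ck : R).
Variables (E1 E2 : (R -> 'cV[C]_p) -> (R -> 'cV[C]_p)).
Hypothesis hu : h1 r u.
Hypothesis uu : forall x, Icc 0 r x -> mxstar (u x) *m u x = 1%:M.
Hypothesis mk : mxmeas setT k.
Hypothesis bk : forall z, nrm (k z) <= ck.
Hypothesis E1k : forall f x, cintegrable 0 r f -> Icc 0 r x ->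
  E1 f x = u x *m (B 0 *m f x + cint 0 x (fun t => k (x, t) *m f t)).
Hypothesis aE1 : forall f g, ac r g f -> E1 g 0 = B 0 *m g 0 /\
  ac r (E1 g) (fun y => a y *m E1 g y + E2 f y + (dB y - a y *m B y) *m g 0).
Hypothesis aE2 : forall f g, ac r g f -> g 0 = 0 ->
  E2 g 0 = 0 /\ ac r (E2 g) (fun y => - (a' y *m E2 g y) + E1 f y).
Hypothesis E2c : forall A, h1 r (E2 (fun=> A)) /\ E2 (fun=> A) 0 = B 0 *m A.
Hypothesis E2D : forall f g A x, ac r g f -> Icc 0 r x ->
  E2 (fun t => A + g t) x = E2 (fun=> A) x + E2 g x.
Hypothesis E2e : forall f g x, (forall t, Icc 0 r t -> f t = g t) -> Icc 0 r x ->
  E2 f x = E2 g x.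

Let r00 : Icc 0 r 0. Proof. by rewrite /Icc/= lexx. Qed.
Let aYi := invmx_ac r0 aY hdY uY bYi.

Let Yia x : Yi x *m a x = Yi x *m dY x *m Yi x.
Proof. by rewrite /lcoef mulmxA. Qed.

Let Xsa x : Icc 0 r x -> Xs x *m a' x = mxstar (dX x).
Proof. by move=> xr; rewrite /rcoef -mxstarM (mulmxKV (uX xr)). Qed.

Let XsK x (A : 'cV[C]_p) : Icc 0 r x -> Xsi x *m (Xs x *m A) = A.
Proof. by move=> xr; rewrite mulmxA -mxstarM mulmxV ?uX// mxstar1 mul1mx. Qed.

(* Variation of constants for w' = a w + h, with integrating factor Y^-1. *)
Let left_solve (w h : R -> 'cV[C]_p) : ac r w (fun y => a y *m w y + h y) ->
  ac r (fun x => Yi x *m w x) (fun x => Yi x *m h x).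
Proof.
move=> aw; apply: ac_ext (acM aYi aw) => x xr; first by [].
by move: (h x) (w x) => A D; rewrite mulmxDr mulmxA Yia mulNmx addrA addNr add0r.
Qed.

(** The integrating factor is X^*, because X^* a' is the adjoint of X'. *)
Let right_solve (w h : R -> 'cV[C]_p) : ac r w (fun y => - (a' y *m w y) + h y) ->
  ac r (fun x => Xs x *m w x) (fun x => Xs x *m h x).
Proof.
move=> aw; have aXs := ac_rlin (@rlin_star R p p) aX.
apply: ac_ext (acM aXs aw) => x xr; first by [].
by move: (h x) (w x) => A D; rewrite mulmxDr mulmxN mulmxA Xsa// addrA addrN add0r.
Qed.

Let left_unique (w : R -> 'cV[C]_p) : ac r w (fun y => a y *m w y) -> w 0 = 0 ->
  forall x, Icc 0 r x -> w x = 0.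
Proof.
move=> aw w0 x xr.
have aw' : ac r w (fun y => a y *m w y + (0 : 'cV[C]_p)).
  by apply: ac_ext aw => t tr; rewrite ?addr0.
have := ac_zero (left_solve (h := fun=> 0) aw') _ xr.
rewrite w0 mulmx0 => e; rewrite -[w x](mulKVmx (uY xr)) e ?mulmx0//.
by move=> t tr; rewrite mulmx0.
Qed.

Let right_unique (w : R -> 'cV[C]_p) : ac r w (fun y => - (a' y *m w y)) -> w 0 = 0 ->
  forall x, Icc 0 r x -> w x = 0.
Proof.
move=> aw w0 x xr.
have aw' : ac r w (fun y => - (a' y *m w y) + (0 : 'cV[C]_p)).
  by apply: ac_ext aw => t tr; rewrite ?addr0.
have := ac_zero (right_solve (h := fun=> 0) aw') _ xr.
rewrite w0 mulmx0 => e; rewrite -[w x](XsK _ xr) e ?mulmx0//.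
by move=> t tr; rewrite mulmx0.
Qed.

Let V (f : R -> 'cV[C]_p) x := cint 0 x f.
Let aV f : cintegrable 0 r f -> ac r (V f) f.
Proof.
move=> hf; apply: ac_ext (ac_prim 0 hf) => x xr; last by [].
by rewrite add0r.
Qed.
Let V0 f : V f 0 = 0. Proof. exact: cint_pt. Qed.

(** A primitive vanishes at 0, so the boundary term disappears and [left_solve] integrates what is
    left. *)
Let E1V f x : cintegrable 0 r f -> Icc 0 r x ->
  E1 (V f) x = Y x *m cint 0 x (fun t => Yi t *m E2 f t).
Proof.
move=> hf xr; have [e a1] := aE1 (aV hf).
have a2 : ac r (E1 (V f)) (fun y => a y *m E1 (V f) y + E2 f y).
  by apply: ac_ext a1 => t tr; rewrite ?V0 ?mulmx0 ?addr0.
have [_ h] := left_solve a2.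
by rewrite -[LHS](mulKVmx (uY xr)) (h x xr) e V0 !mulmx0 add0r.
Qed.

Let E2V f x : cintegrable 0 r f -> Icc 0 r x ->
  E2 (V f) x = Xsi x *m cint 0 x (fun t => Xs t *m E1 f t).
Proof.
move=> hf xr; have [e a1] := aE2 (aV hf) (V0 f).
have [_ h] := right_solve a1.
by rewrite -[LHS](XsK _ xr) (h x xr) e mulmx0 add0r.
Qed.

(* [K], by [beta(x) J beta(t)^* = (Y(x) Y(t)^* - X(x) X(t)^* ) / 2]. *)
Definition Kdiff (f : R -> 'cV[C]_p) x : 'cV[C]_p :=
  (Complex 0 2^-1 : C) *: (Y x *m cint 0 x (fun t => mxstar (Y t) *m f t) -
                 X x *m cint 0 x (fun t => Xs t *m f t)).

(** With q = V X^* f the product rule is applied to Y^-1 X q. By the two relations between Y and X,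
    the derivative of Y^-1 X is - 2 i Y^-1 X^-*, and Y^-1 X X^* f = Y^* f. Hence X q and Y V Y^* f
    differ by - 2 i times the composite integral, and (i/2) (2 i) = -1. *)
Let K_factor f x : cintegrable 0 r f -> Icc 0 r x ->
  Kdiff f x = - (Y x *m cint 0 x (fun t => Yi t *m (Xsi t *m cint 0 t (fun s => Xs s *m f s)))).
Proof.
move=> hf xr; have /andP[x0 xr'] := xr.
have hX : h1 r X by exact: (ac_h1 aX (h1_L2 hdX)).
have hXs := h1_star hX.
have hYs : h1 r (fun t => mxstar (Y t)) by apply: h1_star; exact: (ac_h1 aY (h1_L2 hdY)).
have [cX bXs] := h1_bdd hXs; have [cY bYs] := h1_bdd hYs.
have iX := cintegrableMl (h1_meas hXs) bXs hf.
have iY := cintegrableMl (h1_meas hYs) bYs hf.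
pose q x := cint 0 x (fun s => Xs s *m f s).
have aq : ac r q (fun s => Xs s *m f s) by exact: aV.
have aM := acM aYi aX.
pose dM t := - (2 * im) *: (Yi t *m Xsi t).
have aM' : ac r (fun t => Yi t *m X t) dM.
  apply: ac_ext aM => t tr; first by [].
  (* Cancelling the invertible factor X^* on the right turns the claim into [dYX]. *)
  have uXs : Xs t \in unitmx by apply: unitmx_star; exact: uX.
  rewrite -[LHS](mulmxK uXs) -[RHS](mulmxK uXs); congr (_ *m _).
  rewrite /dM -scalemxAl -[_ *m Xsi t *m _]mulmxA -mxstarM mulmxV ?uX// mxstar1 mulmx1.
  rewrite mulmxDl !mulNmx -(mulmxA _ (X t)) -YX// mulmxA.
  rewrite (mulmxKV (uY tr)) -!mulmxA -mulmxN -mulmxDr.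
  have -> : - (dY t *m mxstar (Y t)) + dX t *m Xs t = (- (2 * im))%:M.
    by rewrite addrC -opprB dYX// raddfN.
  by rewrite mul_mx_scalar.
have [_ h] := acM aM' aq.
have iq : cintegrable 0 x (fun t => Yi t *m (Xsi t *m q t)).
  have hXsi := h1_star (invmx_h1 r0 aX hdX uX bXi).
  have [c1 b1] := h1_bdd hXsi; have [c2 b2] := ac_bdd aYi.
  apply: (cintegrable_sub (lexx 0) xr').
  apply: (cintegrableMl (ac_meas aYi) b2); apply: (cintegrableMl (h1_meas hXsi) b1).
  exact: L2_cintegrable (ac_L2 aq).
have iz := cintegrable_rlin (@rlin_scale R p 1 (- (2 * im))) iq.
have e : Yi x *m (X x *m q x) = - (2 * im) *: cint 0 x (fun t => Yi t *m (Xsi t *m q t)) +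
    cint 0 x (fun t => mxstar (Y t) *m f t).
  rewrite mulmxA (h x xr) {1}/q cint_pt mulmx0 add0r.
  rewrite -(cint_rlin (@rlin_scale R p 1 (- (2 * im))) iq).
  rewrite -(cintD iz (cintegrable_sub (lexx 0) xr' iY)); apply: cint_eq => t /andP[t0 tx].
  have tr : Icc 0 r t by exact: (introT andP (conj t0 (le_trans tx xr'))).
  rewrite /dM -scalemxAl -mulmxA; apply: (congr1 (+%R _)).
  by rewrite mulmxA -(mulmxA _ (X t)) -YX// (mulKmx (uY tr)).
have e2 : X x *m q x = Y x *m (Yi x *m (X x *m q x)) by rewrite (mulKVmx (uY xr)).
rewrite /Kdiff -/(q x) e2 e; move: (cint _ _ _) (cint _ _ _) => A D.
rewrite mulmxDr opprD addrCA subrr addr0 -scalemxAr -scaleNr opprK scalerA.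
rewrite -[RHS]scaleN1r; congr (_ *: _).
by apply/eqP; rewrite eq_complex /=; apply/andP; split; apply/eqP; lra.
Qed.

Let E1_lin f g (z w : C) x : cintegrable 0 r f -> cintegrable 0 r g -> Icc 0 r x ->
  E1 (fun t => z *: f t + w *: g t) x = z *: E1 f x + w *: E1 g x.
Proof.
move=> hf hg xr; have /andP[x0 xr'] := xr.
have zf := cintegrable_rlin (@rlin_scale R p 1 z) hf.
have wg := cintegrable_rlin (@rlin_scale R p 1 w) hg.
have kf := volterra_integrable mk bk x (cintegrable_sub (lexx 0) xr' hf).
have kg := volterra_integrable mk bk x (cintegrable_sub (lexx 0) xr' hg).
have kzf := cintegrable_rlin (@rlin_scale R p 1 z) kf.
have kwg := cintegrable_rlin (@rlin_scale R p 1 w) kg.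
rewrite (E1k (cintegrableD zf wg) xr) (E1k hf xr) (E1k hg xr).
have -> : cint 0 x (fun t => k (x, t) *m (z *: f t + w *: g t)) =
    z *: cint 0 x (fun t => k (x, t) *m f t) + w *: cint 0 x (fun t => k (x, t) *m g t).
  rewrite -(cint_rlin (@rlin_scale R p 1 z) kf) -(cint_rlin (@rlin_scale R p 1 w) kg).
  rewrite -(cintD kzf kwg); apply: cint_eq => t _.
  by rewrite mulmxDr -!scalemxAr.
move: (cint _ _ _) (cint _ _ _) (f x) (g x) => A D F G.
by rewrite !mulmxDr -!scalemxAr !scalerDr addrACA.
Qed.

Let E1_ext f g x : (forall t, Icc 0 r t -> f t = g t) -> cintegrable 0 r f -> Icc 0 r x ->
  E1 f x = E1 g x.
Proof.
move=> fg hf xr; have /andP[x0 xr'] := xr.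
rewrite (E1k hf xr) (E1k (cintegrable_eq fg hf) xr) (fg x xr).
rewrite (@cint_eq _ _ _ _ _ _ (fun t => k (x, t) *m g t)) => // t /andP[t0 tx].
by rewrite fg//; exact: (introT andP (conj t0 (le_trans tx xr'))).
Qed.

(** Cancelling u(x) and B(0) in E h = f leaves the Volterra equation with kernel [k'] and free term
    F = B(0)^-1 u^* f. *)
Let k' z := - (invmx (B 0) *m k z).

Let mk' : mxmeas setT k'.
Proof.
apply: (mxmeas_rlin (@rlin_opp R p p)).
exact: (mxmeas_rlin (@rlin_mulmxl R p p p (invmx (B 0))) mk).
Qed.

Let bk' z : nrm (k' z) <= nrm (invmx (B 0)) * ck.
Proof.
by rewrite /k' nrmN; apply: (le_trans (nrmM _ _)); rewrite ler_wpM2l ?nrm_ge0.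
Qed.

Let E1_inj h x : cintegrable 0 r h -> (forall t, Icc 0 r t -> E1 h t = 0) -> Icc 0 r x ->
  h x = 0.
Proof.
move=> hh e xr.
apply: (volterra_unique mk' bk' hh _ xr) => {xr}x xr; have /andP[x0 xr'] := xr.
have ik := volterra_integrable mk bk x (cintegrable_sub (lexx 0) xr' hh).
have := e x xr; rewrite (E1k hh xr) => /(congr1 (mulmx (mxstar (u x)))).
rewrite mulmxA uu// mul1mx mulmx0 => /eqP; rewrite addr_eq0 => /eqP eB.
rewrite -[h x](mulKmx uB) eB mulmxN -(cint_mulmxl _ ik).
rewrite -(cintN (cintegrable_mulmxl _ ik)); apply: cint_eq => t _.
by rewrite /k' mulNmx mulmxA.
Qed.

(** The preimage comes with its L_2 bound: |F| <= d |f|, and [volterra_solve] controls h - F by the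
    L^1 norm of F, which is the shape [L2_bounded_by] asks for. *)
Let E1_solve : exists M : R, forall f, L2 r f -> exists h,
  [/\ L2 r h, L2norm r h <= M * L2norm r f & forall x, Icc 0 r x -> E1 h x = f x].
Proof.
have [c' sol] := volterra_solve r 1 mk' bk'.
have hus := h1_star hu; have [cu bus] := h1_bdd hus.
pose d := nrm (invmx (B 0)) * cu.
have cu0 : 0 <= cu by exact: le_trans (nrm_ge0 _) (bus 0 r00).
have d0 : 0 <= d by rewrite mulr_ge0// nrm_ge0.
(* c' carries no sign, so a nonnegative constant replaces it before inequalities are multiplied. *)
pose c'' := Num.max c' 0.
exists (Num.sqrt ((2 * d ^+ 2 + 2 * (c'' * d) ^+ 2 * r ^+ 2) * msqK R p 1)) => f Lf.
have if_ := L2_cintegrable Lf.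
pose F x := invmx (B 0) *m (mxstar (u x) *m f x).
have iF : cintegrable 0 r F.
  by apply: cintegrable_mulmxl; exact: (cintegrableMl (h1_meas hus) bus if_).
have bF x : Icc 0 r x -> nrm (F x) <= d * nrm (f x).
  move=> xr; apply: (le_trans (nrmM _ _)); rewrite /d -mulrA ler_wpM2l ?nrm_ge0//.
  by apply: (le_trans (nrmM _ _)); rewrite ler_wpM2r ?nrm_ge0// bus.
have [h [ih eh bh]] := sol F iF.
have IF : Ig 0 r (fun t => nrm (F t)) <= d * Ig 0 r (fun t => nrm (f t)).
  have i1 := cintegrable_nrm if_; have i2 := cintegrable_nrm iF.
  rewrite -RintegralZl//.
  by apply: Ig_le; [exact: i2|exact: igZ|exact: bF].
have bh' t : Icc 0 r t -> nrm (h t) <= d * nrm (f t) + c'' * d * Ig 0 r (fun s => nrm (f s)).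
  move=> tr; rewrite -[h t](subrK (F t)); apply: (le_trans (nrmD _ _)).
  rewrite addrC; apply: lerD; first exact: bF.
  apply: (le_trans (bh t tr)); rewrite -mulrA.
  apply: (@le_trans _ _ (c'' * Ig 0 r (fun t => nrm (F t)))).
    by rewrite ler_wpM2r ?le_max ?lexx//; apply: Ig_ge0 => s _; exact: nrm_ge0.
  by rewrite ler_wpM2l// le_max lexx orbT.
have [Lh nh] := L2_bounded_by r0 Lf (cintegrable_meas ih) bh'.
exists h; split=> // x xr; have /andP[x0 xr'] := xr.
have ik := volterra_integrable mk bk x (cintegrable_sub (lexx 0) xr' ih).
have e : B 0 *m h x = mxstar (u x) *m f x - cint 0 x (fun t => k (x, t) *m h t).
  rewrite (eh x xr) mulmxDr /F (mulKVmx uB); apply: (congr1 (+%R _)).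
  have -> : cint 0 x (fun t => k' (x, t) *m h t) =
      - (invmx (B 0) *m cint 0 x (fun t => k (x, t) *m h t)).
    rewrite -(cint_mulmxl _ ik) -(cintN (cintegrable_mulmxl _ ik)); apply: cint_eq => t _.
    by rewrite /k' mulNmx mulmxA.
  by rewrite mulmxN (mulKVmx uB).
rewrite (E1k ih xr) e subrK mulmxA.
have -> : u x *m mxstar (u x) = 1%:M by apply: mulmx1C; exact: uu.
by rewrite mul1mx.
Qed.

Let E1_bounded : exists M : R, forall f, L2 r f ->
  L2 r (E1 f) /\ L2norm r (E1 f) <= M * L2norm r f.
Proof.
have [cu bu] := h1_bdd hu.
have cu0 : 0 <= cu by exact: le_trans (nrm_ge0 _) (bu 0 r00).
have ck0 : 0 <= ck by exact: le_trans (nrm_ge0 _) (bk (0, 0)).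
exists (Num.sqrt ((2 * (cu * nrm (B 0)) ^+ 2 + 2 * (cu * ck) ^+ 2 * r ^+ 2) * msqK R p 1)).
move=> f Lf; have if_ := L2_cintegrable Lf.
apply: (L2_bounded_by r0 Lf) => [|x xr]; last first.
  rewrite (E1k if_ xr); apply: (le_trans (nrmM _ _)).
  rewrite -!mulrA -mulrDr; apply: ler_pM; rewrite ?nrm_ge0// ?bu//.
  apply: (le_trans (nrmD _ _)); apply: lerD; first exact: nrmM.
  have /andP[x0 xr'] := xr; have ifx := cintegrable_sub (lexx 0) xr' if_.
  apply: (le_trans (nrm_volterra mk bk x ifx)); rewrite ler_wpM2l//.
  apply: (Ig_subset_le (lexx 0) x0 xr'); first exact: cintegrable_nrm.
  by move=> t _; exact: nrm_ge0.
pose f' := patch0 0 r f.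
have mf' : mxmeas setT f' by apply: mxmeas_patch; exact: cintegrable_meas if_.
apply: (@mxmeas_ext _ _ _ _ _ _
  (fun x => u x *m (B 0 *m f x + cint 0 x (fun t => k (x, t) *m f' t)))).
  move=> x xr; have /andP[x0 xr'] := xr; rewrite (E1k if_ xr).
  rewrite (@cint_eq _ _ _ 0 x _ (fun t => k (x, t) *m f t)) => // t /andP[t0 tx].
  by rewrite /f' patch0E//; exact: (introT andP (conj t0 (le_trans tx xr'))).
apply: mxmeasM; first exact: h1_meas hu.
apply: mxmeasD.
  by apply: mxmeasM; [exact: mxmeas_cst|exact: cintegrable_meas if_].
apply: (mxmeas_sub measurableT (@subsetT _ _)).
apply: (@mxmeas_cint _ _ _ _ _ (fun z : R * R => k z *m f' z.2) (fun=> 0) id).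
- by apply: mxmeasM => //; apply: (mxmeas_comp (g := snd)).
- exact: measurable_cst.
- exact: measurable_id.
Qed.

(** The product rule for (s - t) V h(s) on [0, t], which vanishes at both ends. The left side is -
    V^2 h written in the shape that [E1_lin] takes. *)
Let Aop_VV h t : cintegrable 0 r h -> Icc 0 r t ->
  0 *: V (V h) t + -1 *: V (V h) t = Aop h t.
Proof.
move=> ih tr; have aVh := aV ih; have iVh := L2_cintegrable (ac_L2 aVh).
have /andP[t0 tr'] := tr; rewrite scale0r add0r scaleN1r.
have a1 : ac r (fun s => (Complex (s - t) 0)%:M : 'M[C]_p) (fun=> 1%:M).
  split; first exact: cintegrable_cst.
  move=> s /andP[s0 _]; rewrite (cint_cst _ s0) scalemx1 -raddfD.
  apply: (congr1 (@scalar_mx C p)).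
  by apply/eqP; rewrite eq_complex /= addr0 eqxx andbT; apply/eqP; ring.
have [i2 /(_ t tr)] := acM a1 aVh.
have -> : (Complex (t - t) 0)%:M = 0 :> 'M[C]_p 
  by rewrite subrr; apply/matrixP => i j; rewrite !mxE mul0rn.
rewrite mul0mx V0 mulmx0 add0r => /esym.
have i1 := cintegrable_sub (lexx 0) tr' iVh.
have i3 : cintegrable 0 t (fun s => Complex (s - t) 0 *: h s).
  have := cintegrableB (cintegrable_sub (lexx 0) tr' i2) i1.
  by apply: cintegrable_eq => s _; rewrite mul1mx addrAC subrr add0r mul_scalar_mx.
rewrite (@cint_eq _ _ _ _ _ _ (fun s => V h s + Complex (s - t) 0 *: h s)); last first.
  by move=> s _; rewrite mul1mx mul_scalar_mx.
by rewrite (cintD i1 i3) => /eqP; rewrite addrC addr_eq0 => /eqP e; exact: (esym e).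
Qed.

Let VV_integrable h (z w : C) : cintegrable 0 r h ->
  cintegrable 0 r (fun t => z *: V (V h) t + w *: V (V h) t).
Proof.
move=> ih; have iVh := L2_cintegrable (ac_L2 (aV ih)).
have iVV := L2_cintegrable (ac_L2 (aV iVh)).
by apply: cintegrableD; apply: (cintegrable_rlin (@rlin_scale R p 1 _)); exact: iVV.
Qed.

(** In the factorisation of [K_factor], read from the inside, [E2V] turns X^-* V X^* E h into E_2 V
    h, and [E1V] turns Y V Y^-1 E_2 V h into E V V h. *)
Let intertwine h x : cintegrable 0 r h -> L2 r (E1 h) -> Icc 0 r x ->
  Kdiff (E1 h) x = E1 (Aop h) x.
Proof.
move=> ih LE xr; have /andP[x0 xr'] := xr.
have iVh := L2_cintegrable (ac_L2 (aV ih)); have iVV := L2_cintegrable (ac_L2 (aV iVh)).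
rewrite -(E1_ext (fun t => @Aop_VV h t ih) (VV_integrable _ _ ih) xr).
rewrite (E1_lin _ _ iVV iVV xr) scale0r add0r scaleN1r.
rewrite (K_factor (L2_cintegrable LE) xr) (E1V iVh xr).
apply: (congr1 (fun A => - (Y x *m A))); apply: cint_eq => t /andP[t0 tx].
have tr : Icc 0 r t by exact: (introT andP (conj t0 (le_trans tx xr'))).
by rewrite (E2V ih tr).
Qed.

Let E1_zero x : Icc 0 r x -> E1 (fun=> 0) x = 0.
Proof.
move=> xr; have /andP[x0 _] := xr; rewrite (E1k (cintegrable_cst 0 r 0) xr) mulmx0 add0r.
rewrite (@cint_eq _ _ _ _ _ _ (fun=> 0)) => [|t _]; last by rewrite mulmx0.
by rewrite cint_cst// scaler0 mulmx0.
Qed.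

(** The image w of 0 satisfies w' = - a' w with w(0) = 0, because [E1] sends 0 to 0. *)
Let E2_zero x : Icc 0 r x -> E2 (fun=> 0) x = 0.
Proof.
have [e0 a0] := aE2 (ac_cst r (0 : 'cV[C]_p)) (erefl _).
move=> xr; apply: (right_unique _ e0 xr); apply: ac_ext a0 => t tr //.
by rewrite E1_zero// addr0.
Qed.

(** E A and B A both solve w' = a w + (B' - a B) A with value B(0) A at 0. *)
Let E1_cst (A : 'cV[C]_p) x : Icc 0 r x -> E1 (fun=> A) x = B x *m A.
Proof.
move=> xr; have [e0 a0] := aE1 (ac_cst r A).
have a1 := ac_rlin (@rlin_mulmxr R p p 1 A) aB.
have a2 := acD a0 (ac_rlin (@rlin_opp R p 1) a1).
apply/eqP; rewrite -subr_eq0; apply/eqP.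
apply: (@left_unique (fun x => E1 (fun=> A) x - B x *m A) _ _ x xr); last by rewrite e0 subrr.
apply: ac_ext a2 => t tr //; rewrite E2_zero// addr0.
move: (E1 _ t) => D; rewrite mulmxBl mulmxBr !mulmxA.
by rewrite [_ - a t *m B t *m A]addrC addrA addrK.
Qed.

(** Splitting off the value at 0 leaves a primitive V f_2, for which the equation of [E2] has the
    L_2 term E f_2; the constant part is [E2c]. *)
Let E2_h1 df : h1 r df -> h1 r (E2 df).
Proof.
move=> [f2 Lf2 adf]; have i2 := L2_cintegrable Lf2.
have [hc _] := E2c (df 0); have [e0 a0] := aE2 (aV i2) (V0 f2).
have [M bM] := E1_bounded; have [LE _] := bM f2 Lf2.
have hV : h1 r (E2 (V f2)).
  apply: (ac_h1 a0); apply: L2D LE.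
  have [c bc] := h1_bdd (rcoef_h1 r0 aX hdX uX bXi).
  have := L2Z (-1) (L2Ml (h1_meas (rcoef_h1 r0 aX hdX uX bXi)) bc (ac_L2 a0)).
  by apply: L2_ext => t _; rewrite scaleN1r.
apply: h1_ext (h1D hc hV) => t tr.
rewrite -(E2D _ (aV i2) tr); apply: E2e tr => s sr.
by have [_ e] := adf; exact: (esym (e s sr)).
Qed.

Let lower_h1 : h1 r (fun y => dB y - a y *m B y).
Proof.
apply: (h1B hdB); apply: h1M; first exact: (lcoef_h1 r0 aY hdY uY bYi).
exact: (ac_h1 aB (h1_L2 hdB)).
Qed.

(** The density of E f is a E f + E_2 f' + (B' - a B) f(0), and each term is in [h1] when f' is. *)
Let E1_U f df : U_with r f df -> Ucls r (E1 f).
Proof.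
move=> /(U_with_ac _ _ r0)[af hdf]; have [e0 a0] := aE1 af.
have ha := lcoef_h1 r0 aY hdY uY bYi; have [c bc] := h1_bdd ha.
have hE2 := E2_h1 hdf; have hl := h1M lower_h1 (h1_cst r (f 0)).
eexists; apply/(U_with_ac _ _ r0); split; first exact: a0.
apply: (h1D _ hl); apply: (h1D _ hE2); apply: (h1M ha).
apply: (ac_h1 a0); apply: L2D (h1_L2 hl); apply: L2D (h1_L2 hE2).
exact: (L2Ml (h1_meas ha) bc (ac_L2 a0)).
Qed.

(** The two equations are read backwards: the initial values of f and f' are forced by invertibility
    of B(0), the second derivative is found in L_2 by [E1_solve], and uniqueness confirms that E f =
    g. *)
Let E1_U_surj g dg : U_with r g dg ->
  exists f, Ucls r f /\ forall x, Icc 0 r x -> E1 f x = g x.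
Proof.
move=> /(U_with_ac _ _ r0)[ag hdg].
have ha := lcoef_h1 r0 aY hdY uY bYi; have ha' := rcoef_h1 r0 aX hdX uX bXi.
have hB : h1 r B by exact: (ac_h1 aB (h1_L2 hdB)).
have hg : h1 r g by exact: (ac_h1 ag (h1_L2 hdg)).
pose c0 := invmx (B 0) *m g 0.
have Bc0 : B 0 *m c0 = g 0 by rewrite /c0 (mulKVmx uB).
(* The value that E_2 f' must take if E f = g and f(0) = c0. *)
pose h x := dg x - dB x *m c0 - a x *m (g x - B x *m c0).
have hh : h1 r h.
  apply: h1B; first by apply: (h1B hdg); exact: (h1M hdB (h1_cst r c0)).
  by apply: (h1M ha); apply: (h1B hg); exact: (h1M hB (h1_cst r c0)).
(* This will be f'(0), because E_2 f' starts at B(0) f'(0). *)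
pose c1 := invmx (B 0) *m h 0.
have Bc1 : B 0 *m c1 = h 0 by rewrite /c1 (mulKVmx uB).
have [hE2 e2] := E2c c1.
have [dl Ldl al] := h1B hh hE2.
pose l x := h x - E2 (fun=> c1) x.
have l0 : l 0 = 0 by rewrite /l e2 Bc1 subrr.
(* If E_2 V f_2 = l, then E f_2 must be the density of l plus a' l. *)
have Lf : L2 r (fun x => dl x + a' x *m l x).
  have [c bc] := h1_bdd ha'.
  by apply: (L2D Ldl); exact: (L2Ml (h1_meas ha') bc (ac_L2 al)).
have [M sol] := E1_solve; have [f2 [Lf2 _ ef2]] := sol _ Lf.
have i2 := L2_cintegrable Lf2.
have [s0 s1] := aE2 (aV i2) (V0 f2).
have el x : Icc 0 r x -> l x = E2 (V f2) x.
  move=> xr; apply/eqP; rewrite -subr_eq0; apply/eqP.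
  apply: (@right_unique (fun x => l x - E2 (V f2) x) _ _ x xr); last by rewrite l0 s0 subrr.
  apply: ac_ext (acD al (ac_rlin (@rlin_opp R p 1) s1)) => t tr //.
  rewrite ef2//; move: (dl t) (l t) (E2 _ t) => A D F.
  rewrite mulmxBr; move: (a' t *m D) (a' t *m F) => D' F'.
  by apply/matrixP => i j; rewrite !mxE; ring.
pose df x := c1 + V f2 x.
have adf : ac r df f2 by exact: ac_prim.
have idf := L2_cintegrable (ac_L2 adf).
pose f x := c0 + V df x.
have af : ac r f df by exact: ac_prim.
have f0 : f 0 = c0 by rewrite /f V0 addr0.
exists f; split.
  by exists df; apply/(U_with_ac _ _ r0); split=> //; exact: (ac_h1 adf Lf2).
move=> x xr; have [e0 a0] := aE1 af.
apply/esym/eqP; rewrite -subr_eq0; apply/eqP.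
apply: (@left_unique (fun x => g x - E1 f x) _ _ x xr); last by rewrite e0 f0 Bc0 subrr.
apply: ac_ext (acD ag (ac_rlin (@rlin_opp R p 1) a0)) => t tr //.
have -> : E2 df t = h t.
  rewrite /df (E2D _ (aV i2) tr) -(el t tr) /l; move: (E2 _ t) (h t) => A D.
  by rewrite addrC subrK.
rewrite f0 /h; move: (dg t) (dB t) (a t) (B t) (g t) (E1 f t) => A D F G H S.
rewrite !mulmxBr mulmxBl !mulmxA.
move: (D *m c0) (F *m H) (F *m G *m c0) (F *m S) => d1 d2 d3 d4.
by apply/matrixP => i j; rewrite !mxE; ring.
Qed.

Local Notation E := (Eop u (B 0) (fun x t => u x *m k (x, t))).

Let E1E f x : cintegrable 0 r f -> Icc 0 r x -> E f x = E1 f x.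
Proof.
move=> hf xr; have /andP[x0 xr'] := xr; rewrite (E1k hf xr) mulmxDr mulmxA.
have ik := volterra_integrable mk bk x (cintegrable_sub (lexx 0) xr' hf).
apply: (congr1 (+%R _)); rewrite -(cint_mulmxl _ ik); apply: cint_eq => t _.
by rewrite mulmxA.
Qed.

Let aeq_Icc m n (F G : R -> 'M[C]_(m, n)) : (forall x, Icc 0 r x -> F x = G x) -> aeq r F G.
Proof. by move=> h; apply: aeW => x; exact: h. Qed.

Lemma similarity : exists Einv : (R -> 'cV[C]_p) -> (R -> 'cV[C]_p),
  [/\ (forall f : R -> 'cV[C]_p, L2 r f -> {ae mu, forall x, Icc 0 r x ->
         cintegrable 0 x (fun t => u x *m k (x, t) *m f t)}) /\
      (forall f : R -> 'cV[C]_p, L2 r f -> L2 r (E f)) /\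
      (exists M : R, forall f : R -> 'cV[C]_p, L2 r f -> L2norm r (E f) <= M * L2norm r f),
      [/\ forall f : R -> 'cV[C]_p, L2 r f -> L2 r (Einv f),
          forall (f g : R -> 'cV[C]_p) (z w : C), L2 r f -> L2 r g ->
            aeq r (Einv (fun x => z *: f x + w *: g x))
                  (fun x => z *: Einv f x + w *: Einv g x),
          exists M : R, forall f : R -> 'cV[C]_p, L2 r f -> L2norm r (Einv f) <= M * L2norm r f,
          forall f : R -> 'cV[C]_p, L2 r f -> aeq r (E (Einv f)) f &
          forall f : R -> 'cV[C]_p, L2 r f -> aeq r (Einv (E f)) f] &
      [/\ forall (f : R -> 'cV[C]_p) x, L2 r f -> Icc 0 r x -> Kdiff f x = E (Aop (Einv f)) x,
          forall A : 'cV[C]_p, aeq r (Einv (fun x => B x *m A)) (fun=> A) &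
          forall f : R -> 'cV[C]_p, Ucls r f -> (exists g, Ucls r g /\ aeq r (E f) g) /\
            (exists g, Ucls r g /\ aeq r (Einv f) g)]].
Proof.
have [M bM] := E1_bounded; have [M' sol] := E1_solve.
(* On an L_2 function the chosen preimage is exact at every point of [0, r]; outside L_2 the value
   is arbitrary. *)
have ex f : exists h, L2 r f ->
    [/\ L2 r h, L2norm r h <= M' * L2norm r f & forall x, Icc 0 r x -> E1 h x = f x].
  have [Lf|nLf] := pselect (L2 r f); last by exists (fun=> 0).
  by have [h hh] := sol f Lf; exists h.
have [Einv hE] := choice ex.
have LE f : L2 r f -> L2 r (E f) /\ L2norm r (E f) <= M * L2norm r f.
  move=> Lf; have [L1 n1] := bM f Lf; have i := L2_cintegrable Lf.
  have e x : Icc 0 r x -> E1 f x = E f x by move=> xr; rewrite E1E.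
  split; first exact: L2_ext e L1.
  apply: le_trans n1; rewrite le_eqVlt; apply/orP; left; apply/eqP.
  by rewrite /L2norm; congr Num.sqrt; apply: eq_Rintegral => x; rewrite inE => xr; rewrite e.
have inj f g : L2 r f -> L2 r g -> (forall x, Icc 0 r x -> E1 f x = E1 g x) ->
    forall x, Icc 0 r x -> f x = g x.
  move=> Lf Lg e x xr; have i := L2_cintegrable Lf; have j := L2_cintegrable Lg.
  have := @E1_inj (fun t => 1 *: f t + -1 *: g t) x _ _ xr.
  rewrite scale1r scaleN1r => h; apply/eqP; rewrite -subr_eq0 h//.
    by apply: cintegrableD; apply: (cintegrable_rlin (@rlin_scale R p 1 _)).
  by move=> t tr; rewrite (E1_lin _ _ i j tr) e// -scalerDl subrr scale0r.
(* Injectivity identifies any known preimage with the chosen one; linearity, the left inverse, (ii)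
   and the second half of (iii) all follow this way. *)
have EinvP f h : L2 r f -> L2 r h -> (forall x, Icc 0 r x -> E1 h x = f x) ->
    aeq r (Einv f) h.
  move=> Lf Lh e; have [L1 _ e1] := hE f Lf.
  by apply: aeq_Icc; apply: inj => // x xr; rewrite e1// e.
have LU (f df : R -> 'cV[C]_p) : U_with r f df -> L2 r f by move=> /(U_with_ac _ _ r0)[/ac_L2].
exists Einv; split.
- split; [|split].
  + move=> f Lf; apply: aeW => x /andP[x0 xr'].
    have ik := volterra_integrable mk bk x (cintegrable_sub (lexx 0) xr' (L2_cintegrable Lf)).
    apply: cintegrable_eq (cintegrable_mulmxl (u x) ik) => t _; exact: mulmxA.
  + by move=> f Lf; have [] := LE f Lf.
  + by exists M => f Lf; have [] := LE f Lf.
- split.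
  + by move=> f Lf; have [] := hE f Lf.
  + move=> f g z w Lf Lg; have [L1 _ e1] := hE f Lf; have [L2' _ e2] := hE g Lg.
    apply: EinvP; [by apply: L2D; exact: L2Z|by apply: L2D; exact: L2Z|].
    move=> x xr.
    by rewrite (E1_lin _ _ (L2_cintegrable L1) (L2_cintegrable L2') xr) e1// e2.
  + by exists M' => f Lf; have [] := hE f Lf.
  + move=> f Lf; have [L1 _ e1] := hE f Lf; apply: aeq_Icc => x xr.
    by rewrite (E1E (L2_cintegrable L1) xr) e1.
  + move=> f Lf; have [L1 _] := LE f Lf; apply: (EinvP _ _ L1 Lf) => x xr.
    by rewrite (E1E (L2_cintegrable Lf) xr).
- split.
  + move=> f x Lf xr; have [L1 _ e1] := hE f Lf; have i1 := L2_cintegrable L1.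
    have [LE1 _] := bM _ L1; have /andP[x0 xr'] := xr.
    have eK : Kdiff f x = Kdiff (E1 (Einv f)) x.
      rewrite /Kdiff (@cint_eq _ _ _ 0 x _ (fun t => mxstar (Y t) *m E1 (Einv f) t)); last first.
        by move=> t /andP[t0 tx]; rewrite e1//; exact: (introT andP (conj t0 (le_trans tx xr'))).
      rewrite (@cint_eq _ _ _ 0 x (fun t => Xs t *m f t) (fun t => Xs t *m E1 (Einv f) t))//.
      by move=> t /andP[t0 tx]; rewrite e1//; exact: (introT andP (conj t0 (le_trans tx xr'))).
    rewrite eK (intertwine i1 LE1 xr) E1E//.
    exact: cintegrable_eq (fun t => @Aop_VV _ t i1) (VV_integrable _ _ i1).
  + move=> A; apply: EinvP; last by move=> x xr; exact: E1_cst.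
      exact: ac_L2 (ac_rlin (@rlin_mulmxr R p p 1 A) aB).
    exact: ac_L2 (ac_cst r A).
  + move=> f [df Uf]; have Lf := LU _ _ Uf; split.
      exists (E1 f); split; first exact: E1_U Uf.
      by apply: aeq_Icc => x xr; rewrite (E1E (L2_cintegrable Lf) xr).
    have [g [[dg Ug] eg]] := E1_U_surj Uf; exists g; split; first by exists dg.
    exact: (EinvP _ _ Lf (LU _ _ Ug) eg).
Qed.

End Similarity.

(** * Translation from beta to Y and X, and the conclusion *)

Section Blocks.
Variable R : realType.
Local Notation C := (R[i]).
Local Notation im := (Complex 0 1 : C).
Local Opaque cint cintegrable.

(** Polarisation: the pure products of equal blocks cancel in Y(x) Y(t)^* - X(x) X(t)^* and the
    mixed ones double, so the factor i becomes i/2. *)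
Lemma Kop_Kdiff p (r : R) (beta : R -> 'M[C]_(p, p + p)) f x :
  h1 r beta -> cintegrable 0 r f -> Icc 0 r x ->
  Kop beta f x = Kdiff (fun t => lsubmx (beta t) + rsubmx (beta t))
                       (fun t => rsubmx (beta t) - lsubmx (beta t)) f x.
Proof.
move=> hb hf xr; have /andP[x0 xr'] := xr.
have hf' := cintegrable_sub (lexx 0) xr' hf.
have im_ (n : nat) (L : 'M[C]_(p, p + p) -> 'M[C]_(p, n)) : rlin L ->
    cintegrable 0 x (fun t => mxstar (L (beta t)) *m f t).
  move=> hL; have [d Ld ad] := hb; have aL := ac_rlin (@rlin_star R p n) (ac_rlin hL ad).
  have [c bc] := ac_bdd aL; apply: (cintegrable_sub (lexx 0) xr').
  exact: (cintegrableMl (ac_meas aL) bc hf).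
have lY : rlin (fun M : 'M[C]_(p, p + p) => lsubmx M + rsubmx M).
  have [l1 l2] := @rlin_lsubmx R p p p; have [r1 r2] := @rlin_rsubmx R p p p.
  by split=> [A D|z A]; rewrite ?l1 ?r1 ?l2 ?r2 ?scalerDr// addrACA.
have lX : rlin (fun M : 'M[C]_(p, p + p) => rsubmx M - lsubmx M).
  have [l1 l2] := @rlin_lsubmx R p p p; have [r1 r2] := @rlin_rsubmx R p p p.
  by split=> [A D|z A]; rewrite ?l1 ?r1 ?l2 ?r2 ?scalerBr// opprD addrACA.
have lid : rlin (fun M : 'M[C]_(p, p + p) => M) by split.
have i0 := im_ _ _ lid; have iY := im_ _ _ lY; have iX := im_ _ _ lX.
rewrite /Kop /Kdiff -(cint_mulmxl _ i0) -(cint_mulmxl _ iY) -(cint_mulmxl _ iX).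
have jY := cintegrable_mulmxl (lsubmx (beta x) + rsubmx (beta x)) iY.
have jX := cintegrable_mulmxl (rsubmx (beta x) - lsubmx (beta x)) iX.
have j0 := cintegrable_mulmxl (beta x *m Jmx p) i0.
rewrite -(cintB jY jX) -(cint_rlin (@rlin_scale R p 1 _) j0).
rewrite -(cint_rlin (@rlin_scale R p 1 _) (cintegrableB jY jX)); apply: cint_eq => t _.
rewrite [beta x *m _ *m _]mulmxA JmxE !mulmxA -mulmxBl !scalemxAl; congr (_ *m _).
move: (lsubmx (beta x)) (rsubmx (beta x)) (lsubmx (beta t)) (rsubmx (beta t)) => A D A' D'.
rewrite mxstarD mxstarB !mulmxDl !mulmxDr !mulmxN !mulNmx opprK.
move: (A *m mxstar A') (A *m mxstar D') (D *m mxstar A') (D *m mxstar D') => s1 s2 s3 s4.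
have -> : s1 + s2 + (s3 + s4) - (s4 - s3 + (- s2 + s1)) = 2%:R *: (s3 + s2).
  by apply/matrixP => i j; rewrite !mxE; ring.
rewrite scalerA; congr (_ *: _).
by apply/eqP; rewrite eq_complex /=; apply/andP; split; apply/eqP; lra.
Qed.

End Blocks.

Theorem theorem2p4 (R : realType) (p : nat) (r : R) (hr : 0 < r)
  (beta dbeta : R -> 'M[R[i]]_(p, p + p))
  (hU : U_with r beta dbeta)
  (h1 : forall x, Icc 0 r x -> beta x *m Jmx p *m mxstar (beta x) = 0)
  (h2 : forall x, Icc 0 r x ->
          dbeta x *m Jmx p *m mxstar (beta x) = (Complex 0 1)%:M)
  (hdet : \det (rsubmx (beta 0)) != 0) :
  exists (u : R -> 'M[R[i]]_p) (Ek : R -> R -> 'M[R[i]]_p)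
         (Einv : (R -> 'cV[R[i]]_p) -> (R -> 'cV[R[i]]_p)),
    let E := Eop u (rsubmx (beta 0)) Ek in
    (* u in U^{p x p}[0,r], unitary, u(0) = I_p *)
    [/\ [/\ Ucls r u,
           (forall x, Icc 0 r x -> u x \in unitmx /\ mxstar (u x) = invmx (u x)) &
           u 0 = 1%:M],
    (* E is a well-defined bounded operator on L_2^p(0,r) *)
        (forall f : R -> 'cV[R[i]]_p, L2 r f ->
           {ae (@lebesgue_measure R), forall x, Icc 0 r x ->
              cintegrable 0 x (fun t => Ek x t *m f t)}) /\
        (forall f : R -> 'cV[R[i]]_p, L2 r f -> L2 r (E f)) /\
        (exists M : R, forall f : R -> 'cV[R[i]]_p, L2 r f -> L2norm r (E f) <= M * L2norm r f),
    (* Einv is a bounded linear operator on L_2^p(0,r) inverse to E *)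
        [/\ forall f : R -> 'cV[R[i]]_p, L2 r f -> L2 r (Einv f),
            forall (f g : R -> 'cV[R[i]]_p) (a b : R[i]), L2 r f -> L2 r g ->
              aeq r (Einv (fun x => a *: f x + b *: g x))
                    (fun x => a *: Einv f x + b *: Einv g x),
            exists M : R, forall f : R -> 'cV[R[i]]_p, L2 r f -> L2norm r (Einv f) <= M * L2norm r f,
            forall f : R -> 'cV[R[i]]_p, L2 r f -> aeq r (E (Einv f)) f &
            forall f : R -> 'cV[R[i]]_p, L2 r f -> aeq r (Einv (E f)) f] &
    (* (i), (ii), (iii) *)
        [/\ forall f : R -> 'cV[R[i]]_p, L2 r f -> aeq r (Kop beta f) (E (Aop (Einv f))),
            forall j : 'I_p,
              aeq r (Einv (fun x => col j (rsubmx (beta x))))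
                    (fun _ => col j (1%:M : 'M[R[i]]_p)) &
            forall f : R -> 'cV[R[i]]_p, Ucls r f ->
              (exists g, Ucls r g /\ aeq r (E f) g) /\
              (exists g, Ucls r g /\ aeq r (Einv f) g)]].
Proof.
move: h1 h2 => hJ hdJ; have r0 := ltW hr.
have /(U_with_ac _ _ r0)[ab hdb] := hU.
have hb := ac_h1 ab (h1_L2 hdb).
pose B1 x := lsubmx (beta x); pose B2 x := rsubmx (beta x).
pose D1 x := lsubmx (dbeta x); pose D2 x := rsubmx (dbeta x).
have a1 : ac r B1 D1 := ac_rlin (@rlin_lsubmx R p p p) ab.
have a2 : ac r B2 D2 := ac_rlin (@rlin_rsubmx R p p p) ab.
have hD1 : h1 r D1 := h1_lsubmx hdb.
have hD2 : h1 r D2 := h1_rsubmx hdb.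
have eB x : Icc 0 r x -> B2 x *m mxstar (B1 x) + B1 x *m mxstar (B2 x) = 0.
  by move=> xr; rewrite -JmxE hJ.
have eD x : Icc 0 r x -> D2 x *m mxstar (B1 x) + D1 x *m mxstar (B2 x) = (Complex 0 1)%:M.
  by move=> xr; rewrite -JmxE hdJ.
(* The derivative blocks are in [h1], hence bounded; one bound [cd] for both makes the inverses of Y
   and X bounded uniformly on [0, r]. *)
have [c1 b1] := h1_bdd hD1; have [c2 b2] := h1_bdd hD2; pose cd := Num.max c1 c2.
have b1' x : Icc 0 r x -> nrm (D1 x) <= cd by move=> xr; rewrite le_max b1.
have b2' x : Icc 0 r x -> nrm (D2 x) <= cd by move=> xr; rewrite le_max b2// orbT.
have pY x (xr : Icc 0 r x) := unit_Y (eB x xr) (eD x xr) (b1' x xr) (b2' x xr).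
have pX x (xr : Icc 0 r x) := unit_X (eB x xr) (eD x xr) (b1' x xr) (b2' x xr).
have aY := acD a1 a2; have aX := acD a2 (ac_rlin (@rlin_opp R p p) a1).
have hdY := h1D hD1 hD2; have hdX := h1B hD2 hD1.
have uY x (xr : Icc 0 r x) := (pY x xr).1; have bY x (xr : Icc 0 r x) := (pY x xr).2.
have uX x (xr : Icc 0 r x) := (pX x xr).1; have bX x (xr : Icc 0 r x) := (pX x xr).2.
have YX x (xr : Icc 0 r x) := YYstar (eB x xr).
have dYX x (xr : Icc 0 r x) := dYYstar (eD x xr).
have uB : B2 0 \in unitmx by rewrite unitmxE unitfE.
have [u [k [ck [E1 [E2 [[u0 Uu uu] [mk bk] E1k aE1 [aE2 E2c E2D E2e]]]]]]] :=
  intertwining_pair r0 aY hdY aX hdX a2 hD2 uY uX bY bX YX dYX.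
have hu : h1 r u.
  by have [du /(U_with_ac _ _ r0)[au hdu]] := Uu; exact: (ac_h1 au (h1_L2 hdu)).
have [Einv [pE pI [pK pc pU]]] := similarity r0 aY hdY aX hdX a2 hD2 uY uX bY bX YX dYX uB
  hu uu mk bk E1k aE1 aE2 E2c E2D E2e.
exists u, (fun x t => u x *m k (x, t)), Einv; split.
- split; [exact: Uu| |exact: u0] => x xr.
  have uU : u x \in unitmx by have [_ uU] := mulmx1_unit (uu x xr).
  by split=> //; rewrite -[LHS](mulmxK uU) uu// mul1mx.
- exact: pE.
- exact: pI.
- split; [|move=> j|exact: pU].
  + move=> f Lf; apply: aeW => x xr.
    by rewrite -(pK f x Lf xr) (Kop_Kdiff hb (L2_cintegrable Lf) xr).
  (* A column of beta_2 is beta_2 times a constant vector, which is the form that [similarity]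
     provides. *)
  + have -> : (fun x => col j (rsubmx (beta x))) = (fun x => B2 x *m col j 1%:M).
      by apply/funext => x; rewrite !colE mul1mx.
    exact: pc.
Qed.
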